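(* Let $K$ be a number field and let $a\in K$ with $a\neq 0,1$ and $a^2-a+1\neq 0$. Let $E_a/K$ be the elliptic curve $y^2=x(x-1)(x-a)$. If $K$ contains both $\sqrt{-1}$ and $\sqrt{a(1-a)(a^2-a+1)}$, then there exist infinitely many linearly disjoint (over $K$) $\mathcal{A}_4$-extensions $L_1,L_2,\ldots$ of $K$ such that $\mathrm{rank}\,E_a(L_i)\ge \mathrm{rank}\,E_a(K)+3$ for every $i$.
   Context: $\mathcal{A}_4$ is the alternating group of degree 4; an $\mathcal{A}_4$-extension of $K$ is a finite Galois extension $L/K$ with Galois group isomorphic to $\mathcal{A}_4$. $\mathrm{rank}\,E(L)$ is the rank of the Mordell–Weil group $E(L)$. *)

(* Defs.v *)
From HB Require Import structures.
From mathcomp Require Import all_boot all_order all_algebra all_fingroup.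
From mathcomp Require Import all_solvable all_field.
From mathcomp Require Import boolp classical_sets constructive_ereal.
From mathcomp Require Import ring.

Set Implicit Arguments.
Unset Strict Implicit.
Unset Printing Implicit Defensive.

Import Order.TTheory GRing.Theory Num.Theory.
Local Open Scope ring_scope.

Section LegendreCurve.
Variables (F : fieldType) (a : F).
Implicit Types p q : option (F * F).

(* [None] is the point at infinity. *)
Definition on_curve p : bool :=
  if p is Some (x, y) then y ^+ 2 == x * (x - 1) * (x - a) else true.

Definition opp_coord p : option (F * F) :=
  if p is Some (x, y) then Some (x, - y) else None.

(* Chord-tangent law for y^2 = x^3 - (1 + a) x^2 + a x.  The slope is only used
   when x1 != x2 or y1 + y2 != 0; if x1 = x2 on the curve, the latter forces
   y1 = y2, so that the first branch is the usual tangent slope. *)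
Definition slope (x1 y1 x2 y2 : F) : F :=
  if x1 == x2 then (3%:R * x1 ^+ 2 - 2%:R * (1 + a) * x1 + a) / (y1 + y2)
  else (y2 - y1) / (x2 - x1).

Definition add_coord p q : option (F * F) :=
  match p, q with
  | None, _ => q
  | _, None => p
  | Some (x1, y1), Some (x2, y2) =>
    if (x1 == x2) && (y1 + y2 == 0) then None else
    let m := slope x1 y1 x2 y2 in
    let x3 := m ^+ 2 + (1 + a) - x1 - x2 in
    Some (x3, m * (x1 - x3) - y1)
  end.

Lemma on_curve_opp p : on_curve p -> on_curve (opp_coord p).
Proof. by case: p => [[x y]|] //=; rewrite sqrrN. Qed.

Lemma on_curve_add p q : on_curve p -> on_curve q -> on_curve (add_coord p q).
Proof.
case: p => [[x1 y1]|] //; case: q => [[x2 y2]|] //= /eqP H1 /eqP H2.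
case: ifPn => //= nopp; set m := slope _ _ _ _.
have Hm : x2 ^+ 2 + x2 * x1 + x1 ^+ 2 - (1 + a) * (x2 + x1) + a
          = 2%:R * m * y1 + m ^+ 2 * (x2 - x1).
  rewrite /m /slope; case: eqP nopp => [x12|/eqP x12] /= nopp.
    rewrite -x12 in H2 *.
    have y12 : y1 = y2.
      by apply/eqP; rewrite -subr_eq0 -(mulIr_eq0 _ (mulIf nopp)) -subr_sqr
        H1 H2 subrr.
    by rewrite -y12 in nopp *; field.
  have x21 : x2 - x1 != 0 by rewrite subr_eq0 eq_sym.
  apply: (mulIf x21).
  transitivity (x2 * (x2 - 1) * (x2 - a) - x1 * (x1 - 1) * (x1 - a)).
    by ring.
  by rewrite -H1 -H2; field.
move/eqP: Hm; rewrite -subr_eq0 => /eqP Hm.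
move/eqP: H1; rewrite -subr_eq0 => /eqP H1.
rewrite -subr_eq0; apply/eqP; set x3 := _ + _ - _ - _.
transitivity ((y1 ^+ 2 - x1 * (x1 - 1) * (x1 - a))
  - (x3 - x1) * (x2 ^+ 2 + x2 * x1 + x1 ^+ 2 - (1 + a) * (x2 + x1) + a
                 - (2%:R * m * y1 + m ^+ 2 * (x2 - x1)))).
  by rewrite /x3; ring.
by rewrite H1 Hm mulr0 subr0.
Qed.

Definition ec_point := {p : option (F * F) | on_curve p}.

Definition ec_zero : ec_point := exist on_curve None isT.

Definition ec_opp (P : ec_point) : ec_point :=
  exist on_curve _ (on_curve_opp (svalP P)).

Definition ec_add (P Q : ec_point) : ec_point :=
  exist on_curve _ (on_curve_add (svalP P) (svalP Q)).

Definition ec_mulz (c : int) (P : ec_point) : ec_point :=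
  match c with
  | Posz n => iter n (ec_add P) ec_zero
  | Negz n => ec_opp (iter n.+1 (ec_add P) ec_zero)
  end.

Definition ec_indep (n : nat) (P : 'I_n -> ec_point) : Prop :=
  forall c : 'I_n -> int,
    \big[ec_add/ec_zero]_(i < n) ec_mulz (c i) (P i) = ec_zero ->
    forall i, c i = 0.

Definition has_mw_rank (r : nat) : Prop :=
  (exists P : 'I_r -> ec_point, ec_indep P) /\
  (forall (n : nat) (P : 'I_n -> ec_point), ec_indep P -> (n <= r)%N).

(* The rank takes the value +oo when there are arbitrarily large independent
   families; over a number field it is finite by the Mordell-Weil theorem. *)
Definition mw_rank : \bar int :=
  if pselect (exists r, has_mw_rank r) is left h
  then (Posz (projT1 (cid h)))%:E else +oo%E.

End LegendreCurve.

Definition A4_extension (K : fieldType) (L : splittingFieldType K) : Prop :=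
  galois 1%VS {:L}%VS /\ ('Gal({:L} / 1) \isog 'Alt_('I_4))%g.

Local Open Scope classical_set_scope.

Section LinearDisjointness.
Variable Omega : fieldType.
Implicit Types k E M : set Omega.

Definition subfield_set E : Prop := divring_closed [in E].

Definition compositum (I : Type) (J : set I) (E : I -> set Omega) :
    set Omega :=
  smallest subfield_set (\bigcup_(j in J) E j).

Definition lin_indep_over k (n : nat) (v : 'I_n -> Omega) : Prop :=
  forall c : 'I_n -> Omega, (forall i, k (c i)) ->
    \sum_(i < n) c i * v i = 0 -> forall i, c i = 0.

Definition lin_disjoint k E M : Prop :=
  forall (n : nat) (v : 'I_n -> Omega),
    (forall i, E (v i)) -> lin_indep_over k v -> lin_indep_over M v.

Definition lin_disjoint_family k (I : Type) (E : I -> set Omega) : Prop :=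
  forall i, lin_disjoint k (E i) (compositum [set j | j <> i] E).

End LinearDisjointness.

(* Main.v *)
(** Write f(x) = x(x-1)(x-a).  For an integer c the map rho(x) = c(x-c)/x has
    order 3, and its orbits are the root sets {x1, x2, x3} of the cubics
    x^3 - c t x^2 + c^2 (t-3) x + c^3.  Since f(x1) f(x2) f(x3) is, up to a
    constant factor, a product of two affine functions of t, a Moebius
    substitution t = t(w) makes it a square y^2, y in K.  Let
    L = K(x_i, g_i) with g_i^2 = f(x_i) and g1 g2 g3 = y.  When the cubic is
    irreducible and the f(x_i) are not squares in its cubic field, [L : K] = 12
    and the Galois group permutes the four numbers +-g1 +- g2 +- g3 (signs of
    product 1) as A4.  The Klein four-group fixes E(K) and changes the signs of
    two of the three points Q_i = (x_i, g_i), so Q1, Q2, Q3 raise the rank by 3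
    as soon as they are non-torsion.

    Given a number field M, the parameter w is found by congruences: at one
    place of degree one of M the cubic cannot have a root because its Kummer
    generator has valuation prime to 3, at another one the resolvent quartic
    of the f(x_i) has no root because t has valuation -1.  So the 12 monomials
    x1^i {1, g1, g2, g3} stay independent over M, which gives linear
    disjointness from M; taking for M a field containing the extensions already
    built, one obtains the infinite family.

    Moreover w is divisible by a high power of 2, which brings one x_i
    2-adically close to 1, and 2 Q_i close to infinity; there doubling
    multiplies 1/x by 4 times a unit, so Q_i is non-torsion, and the Galois
    action carries this over to the other two points. *)

(* The parameter w is one natural number, yet it must meet conditions at places of a field M that
   grows at each stage. Places of degree one make this possible: natural numbers represent all their
   residue classes, and the Chinese remainder theorem combines the conditions. To know which class
   to aim at, M is first enlarged by a primitive cube root of unity om, by a zero g1 of the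
   numerator of t + 3 om as a function of w, and by a pole g2 of t. Asking that w - g1 and w - g2
   have valuation exactly 1 at the respective places turns this zero and this pole into valuations 1
   and -1. The conditions [good_c] on c keep g1 and g2 nonzero and the zeros and poles in question
   apart. The 2-adic place must serve all fields at once, since the power of 2 dividing w is fixed
   before M is known. It is therefore a valuation ring of the whole of [algC], a maximal subring
   without 1/2, and all 2-adic estimates are memberships in that ring. *)
Require Import Defs.
From HB Require Import structures.
From mathcomp Require Import all_boot all_order all_algebra all_fingroup.
From mathcomp Require Import all_solvable all_field.
From mathcomp Require Import boolp classical_sets constructive_ereal.
From mathcomp Require Import ring zify.

Set Implicit Arguments.
Unset Strict Implicit.
Unset Printing Implicit Defensive.

Import Order.TTheory GRing.Theory Num.Theory.
Local Open Scope ring_scope.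

(** * The group law *)

Section GroupLaw.
Variables (F : fieldType) (a : F).
Hypotheses (two0 : 2%:R != 0 :> F) (a0 : a != 0) (a1 : a != 1).
Implicit Types (x y m : F) (p q r : option (F * F)) (P Q R : ec_point a).

(** Two equations that hold for chords and tangents alike: the second is the difference of the curve
    equations divided by x2 - x1. Unless the points are opposite, at least one of them determines
    m. *)
Definition is_slope x1 y1 x2 y2 m : Prop :=
  m * (x2 - x1) = y2 - y1 /\
  m * (y1 + y2) = x1 ^+ 2 + x1 * x2 + x2 ^+ 2 - (1 + a) * (x1 + x2) + a.

Lemma same_abscissa x y1 y2 :
  on_curve a (Some (x, y1)) -> on_curve a (Some (x, y2)) ->
  y1 + y2 != 0 -> y1 = y2.
Proof.
move=> /= /eqP H1 /eqP H2 nz; apply/eqP; rewrite -subr_eq0.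
by rewrite -(mulIr_eq0 _ (mulIf nz)) -subr_sqr H1 H2 subrr.
Qed.

Lemma slopeP x1 y1 x2 y2 :
  on_curve a (Some (x1, y1)) -> on_curve a (Some (x2, y2)) ->
  ~~ ((x1 == x2) && (y1 + y2 == 0)) ->
  is_slope x1 y1 x2 y2 (slope a x1 y1 x2 y2).
Proof.
move=> C1 C2; rewrite /slope; case: eqP => [E|/eqP N] /= nopp.
  subst x2; have E := same_abscissa C1 C2 nopp; subst y2.
  by split; [rewrite !subrr mulr0 | field].
have d : x2 - x1 != 0 by rewrite subr_eq0 eq_sym.
move: C1 C2 => /= /eqP H1 /eqP H2; split; first by field.
apply: (mulIf d); transitivity ((y2 ^+ 2 - y1 ^+ 2)); first by field.
by rewrite H1 H2; ring.
Qed.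

Lemma slope_uniq x1 y1 x2 y2 m m' :
  ~~ ((x1 == x2) && (y1 + y2 == 0)) ->
  is_slope x1 y1 x2 y2 m -> is_slope x1 y1 x2 y2 m' -> m = m'.
Proof.
move=> nopp [A B] [A' B']; case: (eqVneq x1 x2) nopp => [_|N] /= nopp.
  by apply: (mulIf nopp); rewrite B B'.
have d : x2 - x1 != 0 by rewrite subr_eq0 eq_sym.
by apply: (mulIf d); rewrite A A'.
Qed.

Lemma slope_sym x1 y1 x2 y2 m :
  is_slope x1 y1 x2 y2 m -> is_slope x2 y2 x1 y1 m.
Proof.
move=> [A B]; split; last by rewrite addrC B; ring.
by rewrite -[LHS]opprK -mulrN opprB A opprB.
Qed.

Lemma add_coord_slope x1 y1 x2 y2 m :
  on_curve a (Some (x1, y1)) -> on_curve a (Some (x2, y2)) ->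
  ~~ ((x1 == x2) && (y1 + y2 == 0)) -> is_slope x1 y1 x2 y2 m ->
  add_coord a (Some (x1, y1)) (Some (x2, y2)) =
    let x3 := m ^+ 2 + (1 + a) - x1 - x2 in Some (x3, m * (x1 - x3) - y1).
Proof.
move=> C1 C2 nopp S /=; rewrite (negPf nopp).
by rewrite (slope_uniq nopp (slopeP C1 C2 nopp) S).
Qed.

Lemma add_coordC p q : on_curve a p -> on_curve a q ->
  add_coord a p q = add_coord a q p.
Proof.
case: p => [[x1 y1]|]; case: q => [[x2 y2]|] // C1 C2.
case: (boolP ((x1 == x2) && (y1 + y2 == 0))) => [/andP[/eqP -> /eqP E]|nopp].
  by rewrite /= !eqxx E (addrC y2) E eqxx.
have S := slopeP C1 C2 nopp.
have nopp' : ~~ ((x2 == x1) && (y2 + y1 == 0)) by rewrite eq_sym addrC.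
rewrite (add_coord_slope C1 C2 nopp S).
rewrite (add_coord_slope C2 C1 nopp' (slope_sym S)).
case: S; move: (slope _ _ _ _ _) => m A B; rewrite /=.
congr (Some (_, _)); first by ring.
have -> : y1 = y2 - m * (x2 - x1) by rewrite A; ring.
by ring.
Qed.

Lemma opp_coordK p : opp_coord (opp_coord p) = p.
Proof. by case: p => [[x y]|] //=; rewrite opprK. Qed.

Lemma opp_coordD p q : on_curve a p -> on_curve a q ->
  opp_coord (add_coord a p q) = add_coord a (opp_coord p) (opp_coord q).
Proof.
case: p => [[x1 y1]|]; case: q => [[x2 y2]|] // C1 C2.
have C1' := on_curve_opp C1; have C2' := on_curve_opp C2.
case: (boolP ((x1 == x2) && (y1 + y2 == 0))) => [/andP[/eqP -> /eqP E]|nopp].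
  by rewrite /= !eqxx -opprD E oppr0 eqxx.
have S := slopeP C1 C2 nopp.
have nopp' : ~~ ((x1 == x2) && (- y1 + - y2 == 0)) by rewrite -opprD oppr_eq0.
have S' : is_slope x1 (- y1) x2 (- y2) (- slope a x1 y1 x2 y2).
  case: S => A B; split; last by rewrite -opprD mulrNN B.
    by rewrite mulNr A; ring.
rewrite (add_coord_slope C1 C2 nopp S) /= in C1' C2' *.
rewrite (negPf nopp') (slope_uniq nopp' (slopeP C1' C2' nopp') S').
by congr (Some (_, _)); ring.
Qed.

(* A root of X (X - 1) (X - a) is simple. *)
Lemma two_torsion_slope x : x * (x - 1) * (x - a) = 0 ->
  x ^+ 2 + x * x + x ^+ 2 - (1 + a) * (x + x) + a != 0.
Proof.
move/eqP; rewrite !mulf_eq0 !subr_eq0 -orbA => /or3P[]/eqP ->.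
- by apply: contra a0 => /eqP <-; apply/eqP; ring.
- by rewrite [X in X != 0](_ : _ = 1 - a); [rewrite subr_eq0 eq_sym | ring].
- by rewrite [X in X != 0](_ : _ = a * (a - 1)); [rewrite mulf_neq0 ?subr_eq0 | ring].
Qed.

Lemma add_coordK p q : on_curve a p -> on_curve a q ->
  add_coord a (add_coord a p q) (opp_coord q) = p.
Proof.
case: p => [[x1 y1]|]; case: q => [[x2 y2]|] // C1 C2; last 1 first.
- by rewrite /= eqxx subrr eqxx.
have C2' := on_curve_opp C2.
case: (boolP ((x1 == x2) && (y1 + y2 == 0))) => [/andP[/eqP E1 /eqP E2]|nopp].
  subst x2; rewrite /= eqxx E2 eqxx /=; congr (Some (_, _)).
  by apply/eqP; rewrite -subr_eq0 -opprD addrC E2 oppr0.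
have S := slopeP C1 C2 nopp.
have C4 := on_curve_add C1 C2.
rewrite (add_coord_slope C1 C2 nopp S) in C4 *.
move: S C4; move: (slope _ _ _ _ _) => m /= [A B] C4.
set x4 := _ - x2 in C4 *; set y4 := _ - y1 in C4 *.
have y4E : y4 = m * (x2 - x4) - y2.
  by rewrite /y4 (_ : y1 = y2 - m * (x2 - x1)); [ring | rewrite A; ring].
have S' : is_slope x4 y4 x2 (- y2) (- m).
  split; first by rewrite y4E; ring.
  have -> : y4 + - y2 = m * (x2 - x4) - (y1 + y2) + m * (x1 - x2).
    by rewrite y4E (_ : y1 = y2 - m * (x2 - x1)); [ring | rewrite A; ring].
  have -> : - m * (m * (x2 - x4) - (y1 + y2) + m * (x1 - x2)) =
    m * (y1 + y2) - m ^+ 2 * (x1 - x4) by ring.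
  by rewrite B /x4; ring.
(* This is the case P + Q = Q: then y2 = 0, and the second slope equation would make x2 a double
   root of X (X - 1) (X - a). *)
case: (boolP ((x4 == x2) && (y4 + - y2 == 0))) => [|nopp'].
  case/andP=> /eqP E1 /eqP E2.
  have y20 : y2 = 0.
    apply/eqP; rewrite -(mulrI_eq0 _ (mulfI two0)); apply/eqP.
    by transitivity (y2 - y4); [rewrite y4E E1; ring | rewrite -opprB E2 oppr0].
  have f0 : x2 * (x2 - 1) * (x2 - a) = 0.
    by move: C2 => /= /eqP <-; rewrite y20 expr0n.
  have := two_torsion_slope f0; case: S' => _; rewrite E2 mulr0 E1 => <-.
  by rewrite eqxx.
rewrite (slope_uniq nopp' (slopeP C4 C2' nopp') S').
congr (Some (_, _)); first by rewrite /x4; ring.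
by rewrite /y4 /x4; ring.
Qed.

(** Here [l] is the ordinate at x3 of the line through the first two points. That line meets the
    curve at x1, x2, x4, so y3^2 - l^2 = (x3 - x1) (x3 - x2) (x3 - x4); the second equation is this
    divided by x3 - x2, and it survives when x2 = x3. *)
Lemma chord_parabola x1 y1 x2 y2 x3 y3 m1 m3 :
  on_curve a (Some (x1, y1)) -> on_curve a (Some (x2, y2)) ->
  on_curve a (Some (x3, y3)) ->
  let x4 := m1 ^+ 2 + (1 + a) - x1 - x2 in let l := m1 * (x3 - x1) + y1 in
  ~~ ((x2 == x3) && (y2 + y3 == 0)) ->
  is_slope x1 y1 x2 y2 m1 -> is_slope x2 y2 x3 y3 m3 ->
  y3 - l = (m3 - m1) * (x3 - x2) /\
  (x3 - x1) * (x3 - x4) = (m3 - m1) * (y3 + l).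
Proof.
move=> /eqP C1 /eqP C2 /eqP C3 x4 l n23 [A1 B1] [A3 B3].
have chord : y3 - l = (m3 - m1) * (x3 - x2).
  by rewrite mulrBl A3 /l (_ : y2 = y1 + m1 * (x2 - x1)); [ring | rewrite A1; ring].
split=> //; case: (eqVneq x2 x3) n23 => [E|N] /= n23.
  subst x3; have E := same_abscissa (introT eqP C2) (introT eqP C3) n23; subst y3.
  have -> : l = y2 by rewrite /l A1; ring.
  rewrite [RHS]mulrBl B3 -[m1 * (y2 + y2)](_ : m1 * (y1 + y2) + m1 * (y2 - y1) = _); last by ring.
  by rewrite B1 -A1 /x4; ring.
have d : x3 - x2 != 0 by rewrite subr_eq0 eq_sym.
apply: (mulIf d); rewrite -mulrA [RHS]mulrAC -chord.
have -> : (y3 - l) * (y3 + l) = y3 ^+ 2 - l ^+ 2 by ring.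
rewrite C3.
have -> : l ^+ 2 = m1 ^+ 2 * (x3 - x1) ^+ 2 + 2%:R * m1 * y1 * (x3 - x1) + y1 ^+ 2.
  by rewrite /l; ring.
rewrite C1 (_ : 2%:R * m1 * y1 = m1 * (y1 + y2) - m1 * (m1 * (x2 - x1))); last first.
  by rewrite A1; ring.
by rewrite B1 /x4; ring.
Qed.

(* The parabola Y = y1 + m1 (X - x1) + n (X - x1) (X - x2) with
   n = (m3 - m1) / (x3 - x1) meets the curve at the three given points; the
   lemma says that the leading coefficient n is the inverse of m1 + m2. *)
Lemma parabola_slope x1 y1 x2 y2 x3 y3 m1 m2 m3 :
  on_curve a (Some (x1, y1)) -> on_curve a (Some (x2, y2)) ->
  on_curve a (Some (x3, y3)) ->
  let x4 := m1 ^+ 2 + (1 + a) - x1 - x2 in let y4 := m1 * (x1 - x4) - y1 in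
  on_curve a (Some (x4, y4)) ->
  ~~ ((x2 == x3) && (y2 + y3 == 0)) -> ~~ ((x4 == x3) && (y4 + y3 == 0)) ->
  is_slope x1 y1 x2 y2 m1 -> is_slope x2 y2 x3 y3 m3 ->
  is_slope x4 y4 x3 y3 m2 ->
  (m1 + m2) * (m3 - m1) = x3 - x1.
Proof.
move=> C1 C2 C3 x4 y4 C4 n23 n43 S1 S3 [A2 B2].
have [chord tang] := chord_parabola C1 C2 C3 n23 S1 S3.
move: S1 S3 chord tang => [A1 B1] [A3 B3].
set l := m1 * (x3 - x1) + y1.
rewrite -/l -/x4 => chord tang.
have y4E : y4 = - l + m1 * (x3 - x4) by rewrite /y4 /l; ring.
case: (eqVneq x4 x3) n43 => [E|N] /= n43.
  have E' : y4 = y3.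
    by apply: (same_abscissa C4) n43; rewrite E.
  apply: (mulIf n43); rewrite mulrAC mulrDl B2.
  have l3 : l = - y3 by rewrite -E' y4E E; ring.
  have -> : (x3 - x1) * (y4 + y3) = (m3 - m1) * ((x4 - x1) * (x4 - x2)).
    by rewrite E E' [RHS]mulrCA -chord l3; ring.
  rewrite mulrC -E -E'; congr (_ * _).
  rewrite (_ : m1 * (y4 + y4) =
    m1 * (m1 * (x2 - x1)) + 2%:R * m1 ^+ 2 * (x1 - x4) - m1 * (y1 + y2)).
    by rewrite B1 /x4; ring.
  by rewrite A1 /y4; ring.
have d : x3 - x4 != 0 by rewrite subr_eq0 eq_sym.
apply: (mulIf d); rewrite mulrAC mulrDl A2 [RHS]tang.
by rewrite y4E; ring.
Qed.
Lemma add_coordKl p q : on_curve a p -> on_curve a q ->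
  add_coord a (opp_coord p) (add_coord a p q) = q.
Proof.
move=> C1 C2; have C3 := on_curve_add C1 C2.
by rewrite (add_coordC (on_curve_opp C1) C3) (add_coordC C1 C2) add_coordK.
Qed.

Lemma add_coord0 p : add_coord a p None = p.
Proof. by case: p => [[x y]|]. Qed.

Lemma add_coordN p : add_coord a p (opp_coord p) = None.
Proof. by case: p => [[x y]|] //=; rewrite eqxx subrr eqxx. Qed.

Lemma opposite_coord x1 y1 x2 y2 :
  (x1 == x2) && (y1 + y2 == 0) -> Some (x1, y1) = opp_coord (Some (x2, y2)).
Proof. by case/andP=> /eqP-> /=; rewrite addr_eq0 => /eqP->. Qed.

Lemma add_coord_opp_assoc p q : on_curve a p -> on_curve a q ->
  add_coord a (add_coord a p q) (opp_coord (add_coord a p q)) =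
  add_coord a p (add_coord a q (opp_coord (add_coord a p q))).
Proof.
move=> C1 C2; have C1' := on_curve_opp C1; have C2' := on_curve_opp C2.
rewrite add_coordN opp_coordD // (add_coordC C1' C2').
have -> : add_coord a q (add_coord a (opp_coord q) (opp_coord p)) = opp_coord p.
  by rewrite -{1}[q]opp_coordK add_coordKl.
by rewrite add_coordN.
Qed.

Lemma add_coordA p q r : on_curve a p -> on_curve a q -> on_curve a r ->
  add_coord a (add_coord a p q) r = add_coord a p (add_coord a q r).
Proof.
case: p => [[x1 y1]|] //; case: q => [[x2 y2]|] //; case: r => [[x3 y3]|]; last first.
  by rewrite !add_coord0.
move=> C1 C2 C3.
have C1' := on_curve_opp C1; have C3' := on_curve_opp C3.
have C12 := on_curve_add C1 C2; have C23 := on_curve_add C2 C3.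
case: (boolP ((x1 == x2) && (y1 + y2 == 0))) => [/opposite_coord E|n12].
  by rewrite E add_coordKl // (add_coordC (on_curve_opp C2) C2) add_coordN.
case: (boolP ((x2 == x3) && (y2 + y3 == 0))) => [/opposite_coord E|n23].
  rewrite E; have := add_coordK C1 C3'; rewrite opp_coordK => ->.
  by rewrite (add_coordC C3' C3) add_coordN add_coord0.
case: (boolP ((x1 == x3) && (y1 + y3 == 0))) => [/opposite_coord E|n13].
  rewrite E (add_coordC C3' C2); have := add_coordK C2 C3'.
  by rewrite opp_coordK => ->; rewrite (add_coordC C2 C3) add_coordKl.
(* Equal abscissae leave P = R, where associativity follows from commutativity. *)
case: (eqVneq x1 x3) => [E|N13].
  subst x3; rewrite eqxx in n13; have E := same_abscissa C1 C3 n13; subst y3.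
  by rewrite (add_coordC C1 C2) [RHS]add_coordC ?on_curve_add.
set m1 := slope a x1 y1 x2 y2; have S1 : is_slope _ _ _ _ m1 := slopeP C1 C2 n12.
set m3 := slope a x2 y2 x3 y3; have S3 : is_slope _ _ _ _ m3 := slopeP C2 C3 n23.
have E12 := add_coord_slope C1 C2 n12 S1.
have E23 := add_coord_slope C2 C3 n23 S3.
move: E12 E23; rewrite [X in _ = X -> _]/= [X in _ -> _ = X -> _]/=.
set x4 := _ - x2; set y4 := _ - y1; set x5 := _ - x3; set y5 := _ - y2.
move=> E12 E23.
(* The cases R = -(P + Q) here and P = -(Q + R) next both reduce to [add_coord_opp_assoc]. *)
case: (boolP ((x4 == x3) && (y4 + y3 == 0))) => [/opposite_coord E|n43].
  have -> : Some (x3, y3) = opp_coord (add_coord a (Some (x1, y1)) (Some (x2, y2))).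
    by rewrite E12 E opp_coordK.
  exact: add_coord_opp_assoc.
case: (boolP ((x5 == x1) && (y5 + y1 == 0))) => [/opposite_coord E|n51].
  have -> : Some (x1, y1) = opp_coord (add_coord a (Some (x3, y3)) (Some (x2, y2))).
    by rewrite (add_coordC C3 C2) E23 E opp_coordK.
  have C0 := on_curve_add C3 C2.
  rewrite add_coordC ?on_curve_add ?on_curve_opp //.
  rewrite [X in add_coord a _ X]add_coordC ?on_curve_opp //.
  rewrite -add_coord_opp_assoc // [RHS]add_coordC ?on_curve_opp ?on_curve_add //.
  by rewrite (add_coordC C2 C3).
rewrite E12 E23; rewrite E12 in C12; rewrite E23 in C23.
have n15 : ~~ ((x1 == x5) && (y1 + y5 == 0)) by rewrite eq_sym addrC.
have S2 := slopeP C12 C3 n43; have S4 := slope_sym (slopeP C1 C23 n15).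
have n32 : ~~ ((x3 == x2) && (y3 + y2 == 0)) by rewrite eq_sym addrC.
have n21 : ~~ ((x2 == x1) && (y2 + y1 == 0)) by rewrite eq_sym addrC.
have S3' := slope_sym S3; have S1' := slope_sym S1.
rewrite (add_coord_slope C12 C3 n43 S2) (add_coord_slope C1 C23 n15 (slope_sym S4)).
move: S2 S4; move: (slope a x4 y4 x3 y3) (slope a x1 y1 x5 y5) => m2 m4 S2 S4.
(* The parabola through the three points does not depend on their order. Reading them backwards
   replaces m1 + m2 by m3 + m4, whence the equality of these sums. *)
have K1 := parabola_slope C1 C2 C3 C12 n23 n43 S1 S3 S2.
have x5E : m3 ^+ 2 + (1 + a) - x3 - x2 = x5 by rewrite /x5; ring.
have y5E : m3 * (x3 - x5) - y3 = y5.
  case: S3 => A _; rewrite (_ : y3 = m3 * (x3 - x2) + y2); last by rewrite A; ring.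
  by rewrite /y5; ring.
have K2 : (m3 + m4) * (m1 - m3) = x1 - x3.
  by apply: (@parabola_slope x3 y3 x2 y2 x1 y1 m3 m4 m1); rewrite // x5E y5E.
have d0 : m3 - m1 != 0.
  by apply: contra N13 => /eqP E; rewrite E mulr0 in K1; rewrite eq_sym -subr_eq0 -K1.
have K3 : m1 + m2 = m3 + m4.
  by apply: (mulIf d0); rewrite K1 -[m3 - m1]opprB mulrN K2 opprB.
have m4E : m4 = m1 + m2 - m3 by rewrite K3; ring.
have X : m2 ^+ 2 + (1 + a) - x4 - x3 = m4 ^+ 2 + (1 + a) - x1 - x5.
  apply/eqP; rewrite -subr_eq0; apply/eqP.
  transitivity (2%:R * ((m1 + m2) * (m3 - m1) - (x3 - x1))); last by rewrite K1; ring.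
  by rewrite m4E /x4 /x5; ring.
congr (Some (_, _)) => //=; rewrite -X; set x6 := _ - x3.
have [_ tang] := chord_parabola C1 C2 C3 n23 S1 S3.
rewrite -/x4 in tang; apply: (mulIf d0).
apply/eqP; rewrite -subr_eq0; apply/eqP.
have [chord _] := chord_parabola C1 C2 C3 n23 S1 S3.
set u := (m1 + m2) * (m3 - m1) - (x3 - x1).
set v := (x3 - x1) * (x3 - x4) - (m3 - m1) * (y3 + (m1 * (x3 - x1) + y1)).
set z := y3 - (m1 * (x3 - x1) + y1) - (m3 - m1) * (x3 - x2).
have u0 : u = 0 by rewrite /u K1 subrr.
have v0 : v = 0 by rewrite /v tang subrr.
have z0 : z = 0 by rewrite /z chord subrr.
transitivity (u * (x4 - x1 - 2%:R * (x3 - x1) - u + 2%:R * m1 * (m3 - m1)) - v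
              - (m3 - m1) * z); last by rewrite u0 v0 z0; ring.
by rewrite m4E /u /v /z /x6 /y4 /x4; ring.
Qed.

End GroupLaw.

Definition elliptic (F : fieldType) (a : F) :=
  [&& (2%:R : F) != 0, a != 0 & a != 1].

(** A copy of [ec_point a] indexed by the proof of ellipticity, on which the group axioms depend, so
    that the additive group instance can be attached to it. *)
Definition ec_group (F : fieldType) (a : F) of elliptic a := ec_point a.

Section GroupStructure.
Variables (F : fieldType) (a : F) (ell : elliptic a).
Implicit Types P Q R : ec_group ell.

HB.instance Definition _ :=
  Choice.copy (ec_group ell) {p : option (F * F) | on_curve a p}.

Fact ec_addA : associative (@ec_add F a : ec_group ell -> _ -> _).
Proof.
case/and3P: (ell) => two0 a0 a1 P Q R; apply: val_inj => /=.
by rewrite add_coordA ?(svalP P, svalP Q, svalP R).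
Qed.

Fact ec_addC : commutative (@ec_add F a : ec_group ell -> _ -> _).
Proof.
case/and3P: (ell) => two0 a0 a1 P Q; apply: val_inj => /=.
by rewrite add_coordC ?(svalP P, svalP Q).
Qed.

Fact ec_add0 : left_id (ec_zero a) (@ec_add F a : ec_group ell -> _ -> _).
Proof. by move=> P; apply: val_inj. Qed.

Fact ec_addN : left_inverse (ec_zero a) (@ec_opp F a)
  (@ec_add F a : ec_group ell -> _ -> _).
Proof. by move=> P; rewrite ec_addC; apply: val_inj; rewrite /= add_coordN. Qed.

HB.instance Definition _ :=
  GRing.isZmodule.Build (ec_group ell) ec_addA ec_addC ec_add0 ec_addN.

Lemma ec_mulzE (c : int) (P : ec_group ell) : ec_mulz c P = P *~ c.
Proof.
have H n : iter n (ec_add P) (ec_zero a) = P *+ n.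
  by elim: n => [|n IH] //=; rewrite IH mulrS.
by case: c => n; rewrite /ec_mulz H.
Qed.

End GroupStructure.

(** * Base change and the rank *)

Section PointMap.
Variables (F F' : fieldType) (phi : {rmorphism F -> F'}) (a : F) (a' : F').
Variables (ell : elliptic a) (ell' : elliptic a').
Hypothesis phia : phi a = a'.

Definition map_coord (p : option (F * F)) : option (F' * F') :=
  omap (fun xy => (phi xy.1, phi xy.2)) p.

Lemma on_curve_map p : on_curve a p -> on_curve a' (map_coord p).
Proof.
case: p => [[x y]|] //= /eqP C; apply/eqP.
by rewrite -rmorphXn C !rmorphM !rmorphB /= rmorph1 phia.
Qed.

Lemma map_coordD p q :
  map_coord (add_coord a p q) = add_coord a' (map_coord p) (map_coord q).
Proof.
case: p => [[x1 y1]|] //; case: q => [[x2 y2]|] //=.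
rewrite -rmorphD !fmorph_eq0 (inj_eq (fmorph_inj phi)).
case: ifP => //= _.
have -> : slope a' (phi x1) (phi y1) (phi x2) (phi y2) = phi (slope a x1 y1 x2 y2).
  rewrite /slope (inj_eq (fmorph_inj phi)); case: ifP => _.
    by rewrite fmorph_div !(rmorph_nat, rmorphB, rmorphD, rmorphM, rmorphXn, rmorph1) /= phia.
  by rewrite fmorph_div !rmorphB.
move: (slope _ _ _ _ _) => m.
by rewrite !(rmorphB, rmorphD, rmorphM, rmorphXn, rmorph1) /= phia.
Qed.

Definition map_point (P : ec_group ell) : ec_group ell' :=
  exist (on_curve a') _ (on_curve_map (svalP P)).

Fact map_point_is_zmod_morphism : zmod_morphism map_point.
Proof.
have D P Q : map_point (P + Q) = map_point P + map_point Q.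
  by apply: val_inj; rewrite /= map_coordD.
by move=> P Q; apply: (addIr (map_point Q)); rewrite -D !subrK.
Qed.

HB.instance Definition _ :=
  GRing.isZmodMorphism.Build _ _ map_point map_point_is_zmod_morphism.

Lemma map_point_inj : injective map_point.
Proof.
move=> P Q /(congr1 val) /= E; apply: val_inj; move: E => /=.
case: (sval P) => [[x y]|]; case: (sval Q) => [[x' y']|] //=.
by case=> /fmorph_inj-> /fmorph_inj->.
Qed.

End PointMap.

Section Rank.

Lemma ec_indepP (F : fieldType) (a : F) (ell : elliptic a) n
    (P : 'I_n -> ec_group ell) :
  ec_indep P <->
  forall c : 'I_n -> int, \sum_i P i *~ c i = 0 -> forall i, c i = 0.
Proof.
have E c : \big[@ec_add F a/ec_zero a]_(i < n) ec_mulz (c i) (P i) =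
           \sum_(i < n) (P i *~ c i).
  by apply: eq_bigr => i _; rewrite ec_mulzE.
by split=> H c; [rewrite -E | rewrite E]; apply: H.
Qed.

(** If the rank of [b] is finite, its bound on independent families also bounds those of [a],
    through [ext]. So the rank of [a] is finite too, and [ext] is applied to a family of that
    size. *)
Lemma mw_rank_extend (K L : fieldType) (a : K) (b : L) (k : nat) :
  (forall s (P : 'I_s -> ec_point a), ec_indep P ->
     exists Q : 'I_(s + k) -> ec_point b, ec_indep Q) ->
  (mw_rank a + (Posz k)%:E <= mw_rank b)%E.
Proof.
move=> ext; rewrite [X in (_ <= X)%E]/mw_rank.
case: pselect => [hr|_]; last by rewrite leey.
case: (cid _) => r [_ bnd] /=.
pose A n := `[< exists P : 'I_n -> ec_point a, ec_indep P >].
have A0 : exists n, A n.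
  by exists 0%N; apply/asboolP; exists (fun=> ec_zero a) => c _ [].
have Ar n : A n -> (n <= r)%N.
  move=> /asboolP[P /ext[Q /bnd]]; apply: leq_trans; exact: leq_addr.
have [s /asboolP[P Pi] smax] := ex_maxnP A0 Ar.
have hs : exists s, has_mw_rank a s.
  exists s; split; first by exists P.
  by move=> n P' iP'; apply: smax; apply/asboolP; exists P'.
rewrite /mw_rank; case: pselect => [h|//]; case: (cid _) => s' [[P' iP'] _] /=.
rewrite -EFinD lee_fin -PoszD lez_nat.
by have [Q /bnd] := ext _ _ iP'.
Qed.

Variables (K L : fieldType) (phi : {rmorphism K -> L}) (a : K) (b : L).
Variables (ell : elliptic a) (ell' : elliptic b).
Hypothesis phia : phi a = b.

(* The sign automorphisms [s i] isolate the component of each [Q i]. *)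
Lemma mw_rank_sign_jump (Q : 'I_3 -> ec_group ell')
    (s : 'I_3 -> {additive ec_group ell' -> ec_group ell'}) :
  (forall i (P : ec_group ell), s i (map_point ell' phia P) = map_point ell' phia P) ->
  (forall i j, s i (Q j) = if i == j then Q j else - Q j) ->
  (forall i n, Q i *+ n = 0 -> n = 0%N) ->
  (mw_rank a + 3%:E <= mw_rank b)%E.
Proof.
move=> sK sQ tors; apply: (@mw_rank_extend K L a b 3) => r P /(ec_indepP (ell := ell)) iP.
exists (fun i => match fintype.split i with
  | inl j => map_point ell' phia (P j : ec_group ell) | inr j => Q j end).
apply/(ec_indepP (ell := ell')) => c; rewrite big_split_ord /=.
pose d j := c (rshift r j); pose e j := c (lshift 3 j).
set U := \sum_(i < r) _; set V := \sum_(i < 3) _.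
have UE : U = map_point ell' phia (\sum_(i < r) (P i : ec_group ell) *~ e i).
  rewrite raddf_sum; apply: eq_bigr => i _.
  by rewrite raddfMz -[lshift _ _]/(unsplit (inl i)) unsplitK.
have VE : V = \sum_(j < 3) Q j *~ d j.
  by apply: eq_bigr => i _; rewrite -[rshift _ _]/(unsplit (inr i)) unsplitK.
move=> UV.
have sU i : s i U = U by rewrite UE sK.
have sV i : s i V = Q i *~ d i *+ 2 - V.
  rewrite VE raddf_sum (bigD1 i) //= [in RHS](bigD1 i) //=.
  rewrite raddfMz sQ eqxx opprD mulr2n addrACA subrr add0r; congr (_ + _).
  rewrite -sumrN; apply: eq_bigr => j ji.
  by rewrite raddfMz sQ eq_sym (negPf ji) mulNrz.
(* Adding to U + V = 0 its image under s_i leaves 2 U + 2 d_i Q_i = 0. For j <> i, s_j reverses the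
   sign of the last term only, and the difference is 4 d_i Q_i = 0. *)
have d0 i : d i = 0.
  have E1 : U *+ 2 + Q i *~ d i *+ 2 = 0.
    have := congr1 (s i) UV; rewrite raddfD /= sU sV raddf0 => E.
    transitivity (U + (Q i *~ d i *+ 2 - V) + (U + V)); last by rewrite E UV addr0.
    by rewrite [RHS]addrACA subrK -mulr2n.
  have [j ij] : exists j : 'I_3, j != i.
    by exists (if i == ord0 then ord_max else ord0); case: (eqVneq i ord0) => [->|] //; rewrite eq_sym.
  have E2 : U *+ 2 - Q i *~ d i *+ 2 = 0.
    have := congr1 (s j) E1; rewrite raddf0 raddfD /= !raddfMn /= sU raddfMz sQ.
    by rewrite (negPf ij) mulNrz mulNrn.
  have E3 : Q i *~ d i *+ 4 = 0.
    have := congr2 (fun x y => x - y) E1 E2.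
    by rewrite opprD opprK addrACA subrr add0r -mulrnDr subrr.
  move: E3; case: (d i) => n.
    by rewrite -[_ *~ Posz n]/(_ *+ n) -mulrnA => /tors; case: n.
  rewrite NegzE mulrNz -[_ *~ Posz _]/(_ *+ n.+1) mulNrn => /eqP.
  by rewrite oppr_eq0 => /eqP; rewrite -mulrnA => /tors.
have U0 : U = 0.
  by move: UV; rewrite VE big1 ?addr0 // => i _; rewrite d0.
have e0 : forall i, e i = 0.
  by apply: iP; apply: (@map_point_inj _ _ phi _ _ ell ell' phia); rewrite -UE U0 raddf0.
by move=> i; rewrite -(splitK i); case: (fintype.split i).
Qed.

End Rank.

(** * Points close to infinity over a 2-adic ring *)

Section TwoAdic.
Variables (F : fieldType) (R : set F).

(** A valuation ring in which 2 is not a unit. The valuation itself is not named; over [algC] its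
    value group is not discrete, as 2 has roots of all orders. *)
Definition two_adic_ring : Prop :=
  [/\ R 1, forall x y, R x -> R y -> R (x - y), forall x y, R x -> R y -> R (x * y),
      forall x, R x \/ R x^-1 & ~ R 2%:R^-1].

Hypothesis vR : two_adic_ring.

Lemma two_adic1 : R 1. Proof. by case: vR. Qed.

Lemma two_adicB x y : R x -> R y -> R (x - y). Proof. by case: vR => _ H *; apply: H. Qed.

Lemma two_adicM x y : R x -> R y -> R (x * y). Proof. by case: vR => _ _ H *; apply: H. Qed.

Lemma two_adic0 : R 0. Proof. by rewrite -(subrr 1); apply: two_adicB; exact: two_adic1. Qed.

Lemma two_adicN x : R x -> R (- x).
Proof. by rewrite -sub0r; apply: two_adicB; exact: two_adic0. Qed.

Lemma two_adicD x y : R x -> R y -> R (x + y).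
Proof. by move=> Rx Ry; rewrite -(opprK y); apply: two_adicB => //; apply: two_adicN. Qed.

Lemma two_adicX x n : R x -> R (x ^+ n).
Proof.
by move=> Rx; elim: n => [|n IH]; rewrite ?exprS; [exact: two_adic1 | exact: two_adicM].
Qed.

Lemma two_adic_nat n : R n%:R.
Proof.
elim: n => [|n IH]; first exact: two_adic0.
by rewrite -natr1; apply: two_adicD IH two_adic1.
Qed.

Lemma two_adic2_neq0 : (2%:R : F) != 0.
Proof.
apply/eqP => E; case: vR => _ _ _ _; rewrite E invr0; apply; exact: two_adic0.
Qed.

(** With u = 1 + 2 r, the identity 1/2 = u/2 - r keeps u/2 out of [R]. Hence 2/u is in [R], and so
    is 1/u = 1 - r (2/u). *)
Lemma two_adic_unit r : R r -> 1 + 2%:R * r != 0 /\ R (1 + 2%:R * r)^-1.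
Proof.
have two0 := two_adic2_neq0; move=> Rr; set u := 1 + _.
have half : 2%:R^-1 = u / 2%:R - r by rewrite /u; field.
have n2 : ~ R (u / 2%:R).
  by move=> H; case: vR => _ _ _ _; rewrite half; apply; apply: two_adicB.
have u0 : u != 0 by apply/eqP => E; apply: n2; rewrite E mul0r; exact: two_adic0.
split=> //; case: vR => _ _ _ /(_ (u / 2%:R)) [//|H] _.
rewrite (_ : u^-1 = 1 - r * (u / 2%:R)^-1).
  by apply: two_adicB; [exact: two_adic1 | exact: two_adicM].
rewrite invf_div; apply: (mulIf u0); rewrite mulVf // mulrBl -mulrA divfK //.
by rewrite /u; ring.
Qed.

Lemma two_adic_pow4 n v : R v -> (4%:R ^+ n.+1 * v : F) <> 1.
Proof.
have two0 := two_adic2_neq0; move=> Rv E; case: vR => _ _ _ _; apply.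
have -> : 2%:R^-1 = 2%:R * 4%:R ^+ n * v.
  apply: (mulfI two0); transitivity (4%:R ^+ n.+1 * v); first by rewrite E mulfV.
  by rewrite exprS; ring.
by do 2!apply: two_adicM => //; rewrite -?natrX; exact: two_adic_nat.
Qed.

(* Points so close to infinity that doubling multiplies 1 / x by 4 times a
   unit; their multiples by powers of 2 are therefore distinct. *)
Variables (a : F) (ell : elliptic a).

Definition near_infinity (p : option (F * F)) : Prop :=
  if p is Some (x, y) then [/\ x != 0, R (x^-1 / 2%:R) & R (a * x^-1 / 2%:R)]
  else False.

Lemma double_abscissa x y : on_curve a (Some (x, y)) -> y != 0 ->
  exists y', add_coord a (Some (x, y)) (Some (x, y)) =
    Some ((x ^+ 2 - a) ^+ 2 / (4%:R * (x * (x - 1) * (x - a))), y').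
Proof.
case/and3P: ell => two0 a0 a1 C y0.
have yy : y + y != 0 by rewrite -mulr2n -mulr_natl mulf_neq0.
eexists; rewrite /= eqxx (negPf yy) /=; congr (Some (_, _)).
rewrite /slope eqxx; move: C => /= /eqP C; rewrite -C.
transitivity (((3%:R * x ^+ 2 - 2%:R * (1 + a) * x + a) ^+ 2 +
  4%:R * y ^+ 2 * (1 + a - x - x)) / (4%:R * y ^+ 2)).
  by field; rewrite y0 yy (natrM _ 2 2) mulf_neq0.
by congr (_ * _); rewrite C; ring.
Qed.

Lemma near_infinity_double p : on_curve a p -> near_infinity p ->
  near_infinity (add_coord a p p) /\
  exists2 v, R v & forall x y x' y', p = Some (x, y) ->
    add_coord a p p = Some (x', y') -> x'^-1 = 4%:R * x^-1 * v.
Proof.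
have two0 := two_adic2_neq0; case/and3P: (ell) => _ a0 a1.
have nhalf : ~ R 2%:R^-1 by case: vR.
case: p => [[x y]|] // C [x0 R1 R2].
have x1 : x != 1 by apply/eqP => E; apply: nhalf; rewrite E invr1 mul1r in R1.
have xa : x != a by apply/eqP => E; apply: nhalf; rewrite E divff // mul1r in R2.
have f0 : x * (x - 1) * (x - a) != 0 by rewrite !mulf_neq0 ?subr_eq0.
have y0 : y != 0 by apply: contra f0 => /eqP E; move: C => /= /eqP <-; rewrite E expr0n.
have [y' D] := double_abscissa C y0.
set w := x^-1 in R1 R2 *.
have Rw : R w by rewrite -[w](divfK two0); apply: two_adicM => //; exact: two_adic_nat.
have Raw : R (a * w) by rewrite -[a * w](divfK two0); apply: two_adicM => //; exact: two_adic_nat.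
(* The parameter [a] may lie outside [R], but a w / 2 and w lie in it, so 1 - a w^2 is a unit. *)
have [u0 Ru] : 1 + 2%:R * (- (a * w / 2%:R * w)) != 0 /\
    R (1 + 2%:R * (- (a * w / 2%:R * w)))^-1.
  by apply: two_adic_unit; apply: two_adicN; apply: two_adicM.
have uE : 1 + 2%:R * (- (a * w / 2%:R * w)) = 1 - a * w ^+ 2 by field.
rewrite uE in u0 Ru.
have w0 : w != 0 by rewrite invr_eq0.
have xw : x = w^-1 by rewrite invrK.
have qE : x ^+ 2 - a = (1 - a * w ^+ 2) / w ^+ 2 by rewrite xw; field.
have q0 : x ^+ 2 - a != 0 by rewrite qE mulf_neq0 ?invr_eq0 ?expf_neq0.
pose v := (1 - w) * (1 - a * w) * (1 - a * w ^+ 2)^-1 ^+ 2.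
have Rv : R v.
  apply: two_adicM; last exact: two_adicX.
  by apply: two_adicM; apply: two_adicB => //; exact: two_adic1.
have iE : ((x ^+ 2 - a) ^+ 2 / (4%:R * (x * (x - 1) * (x - a))))^-1 = 4%:R * w * v.
  by rewrite invf_div qE /v xw; field; rewrite u0 w0.
rewrite D; split; last first.
  by exists v => // x1' y1' x2' y2' [<- _] [<- _].
have four0 : 4%:R != 0 :> F by rewrite (natrM _ 2 2) mulf_neq0.
have N0 := mulf_neq0 four0 f0.
split; first by apply: mulf_neq0; rewrite ?invr_eq0 // expf_neq0.
  rewrite iE (_ : _ / _ = 2%:R * w * v); last by field.
  by do 2!apply: two_adicM => //; exact: two_adic_nat.
rewrite iE (_ : _ / _ = 2%:R * (a * w) * v); last by field.
by do 2!apply: two_adicM => //; exact: two_adic_nat.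
Qed.

Lemma near_infinity_pow2 (P : ec_group ell) k j : near_infinity (val P) ->
  near_infinity (val (P *+ 2 ^ k)) /\
  (P *+ 2 ^ k = P *+ 2 ^ (k + j.+1) -> False).
Proof.
move=> nP.
have step (Q : ec_group ell) : near_infinity (val Q) -> near_infinity (val (Q *+ 2)) /\
  exists2 v, R v & forall x y x' y', val Q = Some (x, y) ->
    val (Q *+ 2) = Some (x', y') -> x'^-1 = 4%:R * x^-1 * v.
  by move=> nQ; rewrite mulr2n; apply: near_infinity_double nQ; exact: (svalP Q).
have powS (Q : ec_group ell) i : Q *+ 2 ^ i.+1 = Q *+ 2 ^ i *+ 2.
  by rewrite -mulrnA expnSr.
have nk i : near_infinity (val (P *+ 2 ^ i)).
  by elim: i => [|i IH]; [rewrite expn0 mulr1n | rewrite powS; case: (step _ IH)].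
split=> // E.
have chain (Q : ec_group ell) i : near_infinity (val Q) ->
  near_infinity (val (Q *+ 2 ^ i)) /\
  exists2 v, R v & forall x y x' y', val Q = Some (x, y) ->
    val (Q *+ 2 ^ i) = Some (x', y') -> x'^-1 = 4%:R ^+ i * x^-1 * v.
  move=> nQ; elim: i => [|i [IH [v Rv IHv]]].
    rewrite expn0 mulr1n; split=> //; exists 1; first exact: two_adic1.
    by move=> x y x' y' -> [-> _]; rewrite expr0 mul1r mulr1.
  rewrite powS; have [n2 [u Ru Hu]] := step _ IH; split=> //.
  exists (u * v); first exact: two_adicM.
  move=> x y x' y' EQ E2.
  case EV: (val (Q *+ 2 ^ i)) IH => [[x1 y1]|] // _.
  rewrite (Hu _ _ _ _ EV E2) (IHv _ _ _ _ EQ EV) exprS.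
  by ring.
have [n1 [v Rv Hv]] := chain (P *+ 2 ^ k) j.+1 (nk k).
have E' : P *+ 2 ^ k *+ 2 ^ j.+1 = P *+ 2 ^ k by rewrite -mulrnA -expnD E.
rewrite E' in n1 Hv; case EV: (val (P *+ 2 ^ k)) n1 => [[x y]|] // [x0 _ _].
have := Hv _ _ _ _ EV EV; rewrite mulrAC -{1}[x^-1]mul1r => H.
have ix0 : x^-1 != 0 by rewrite invr_eq0.
by apply: (@two_adic_pow4 j v Rv); apply: (mulIf ix0); rewrite -H.
Qed.

(** Write n = 2^e o with o odd. By Euler, 2^(e + phi(o)) and 2^e agree modulo n, so n P = 0 would
    identify two multiples of P by different powers of 2. *)
Lemma near_infinity_nontorsion (P : ec_group ell) n :
  near_infinity (val P) -> P *+ n = 0 -> n = 0%N.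
Proof.
move=> nP Pn; case: (posnP n) => // n0; exfalso.
have o0 := part_gt0 (2%N)^' n.
pose e := logn 2 n; pose o := (n`_(2%N)^')%N.
have nE : n = (2 ^ e * o)%N by rewrite -p_part partnC.
have co : coprime 2 o by rewrite (@pnat_coprime 2%N) ?pnat_id ?part_pnat.
have := Euler_exp_totient co; case tE : (totient o) => [|k].
  by move: o0; rewrite -totient_gt0 -/o tE.
move=> /eqP; rewrite eqn_mod_dvd ?expn_gt0 // => /dvdnP[q Eq].
have E : (2 ^ (e + k.+1) = 2 ^ e + n * q)%N.
  rewrite nE -mulnA [(o * q)%N]mulnC -Eq expnD mulnBr muln1 subnKC //.
  by rewrite leq_pmulr // expn_gt0.
have [_] := near_infinity_pow2 e k nP; apply.
by rewrite E mulrnDr mulrnA Pn mul0rn addr0.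
Qed.

End TwoAdic.

(** * A valuation ring of [algC] in which 2 is not invertible *)

Section TwoAdicPlace.
Local Open Scope classical_set_scope.

Definition subring_set (S : set algC) : Prop :=
  [/\ S 1, forall x y, S x -> S y -> S (x - y) & forall x y, S x -> S y -> S (x * y)].

Lemma subring_set0 S : subring_set S -> S 0.
Proof. by case=> S1 SB _; rewrite -(subrr 1); apply: (SB). Qed.

Lemma subring_setD S x y : subring_set S -> S x -> S y -> S (x + y).
Proof.
move=> HS Sx Sy; have S0 := subring_set0 HS; case: HS => _ SB _.
by rewrite -(opprK y); apply: (SB) => //; rewrite -sub0r; apply: (SB).
Qed.

Lemma subring_set_sum S (I : Type) (r : seq I) (P : pred I) (E : I -> algC) :
  subring_set S -> (forall i, P i -> S (E i)) -> S (\sum_(i <- r | P i) E i).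
Proof.
move=> HS HE; elim/big_ind: _ => //; first exact: subring_set0.
by move=> x y; apply: subring_setD.
Qed.

Definition adjoin_set (S : set algC) (x : algC) : set algC :=
  [set z | exists2 p : {poly algC}, (forall i, S p`_i) & z = p.[x]].

Lemma adjoin_subring S x : subring_set S -> subring_set (adjoin_set S x).
Proof.
move=> HS; have S0 := subring_set0 HS; case: (HS) => S1 SB SM; split.
- by exists 1; rewrite ?hornerC // => i; rewrite coef1; case: (i == 0%N).
- move=> _ _ [p Sp ->] [q Sq ->]; exists (p - q); rewrite ?hornerE // => i.
  by rewrite coefB; apply: (SB).
- move=> _ _ [p Sp ->] [q Sq ->]; exists (p * q); rewrite ?hornerM // => i.
  by rewrite coefM; apply: subring_set_sum => // j _; apply: (SM).
Qed.

Lemma sub_adjoin S x : subring_set S -> S `<=` adjoin_set S x.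
Proof.
move=> HS y Sy; exists y%:P; rewrite ?hornerC // => i; rewrite coefC.
by case: (i == 0%N) => //; exact: subring_set0.
Qed.

Lemma adjoin_self S x : subring_set S -> adjoin_set S x x.
Proof.
move=> HS; exists 'X; rewrite ?hornerX // => i; rewrite coefX.
by case: (i == 1%N); [case: HS | exact: subring_set0].
Qed.

Lemma maximal_subring : exists R : set algC,
  [/\ subring_set R, ~ R 2%:R^-1 &
   forall S, subring_set S -> ~ S 2%:R^-1 -> R `<=` S -> S `<=` R].
Proof.
pose P S := S = set0 \/ subring_set S /\ ~ S 2%:R^-1.
have [F FP totF|R [PR maxR]] := @Zorn_bigcup algC P.
  case: (pselect (exists2 X, F X & X !=set0)) => [[X FX [x Xx]]|nF]; last first.
    left; apply/seteqP; split=> // x [X FX Xx]; case: nF; exists X => //; by exists x.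
  have sub Y y : F Y -> Y y -> subring_set Y /\ ~ Y 2%:R^-1.
    by move=> FY Yy; case: (FP Y FY) => // E; rewrite E in Yy.
  right; split; last by move=> [Y FY Y2]; case: (sub Y _ FY Y2).
  have two (op : algC -> algC -> algC) :
      (forall Y, subring_set Y -> forall x y, Y x -> Y y -> Y (op x y)) ->
      forall x y, (\bigcup_(X in F) X) x -> (\bigcup_(X in F) X) y ->
        (\bigcup_(X in F) X) (op x y).
    move=> H u v [Y FY Yu] [Z FZ Zv].
    have [YZ|ZY] := totF _ _ FY FZ.
      by exists Z => //; apply: H => //; [case: (sub Z _ FZ Zv) | exact: YZ].
    by exists Y => //; apply: H => //; [case: (sub Y _ FY Yu) | exact: ZY].
  split; first by exists X => //; case: (sub X x FX Xx) => -[].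
    by apply: two => Y [].
  by apply: two => Y [].
pose Zs : set algC := [set z | z \is a Num.int].
have ZsP : subring_set Zs /\ ~ Zs 2%:R^-1.
  split; first by split=> [|x y|x y]; rewrite /Zs /= ?rpred1 //; [apply: rpredB | apply: rpredM].
  move=> /= /intrP [m E]; have := congr1 ( *%R 2%:R) E.
  rewrite mulfV ?pnatr_eq0 // -[2%:R]/((2 : int)%:~R) -intrM => /eqP.
  rewrite -[1]/((1 : int)%:~R) eqr_int => /eqP E2.
  by have := congr1 (fun z => (z %% 2)%Z) E2; rewrite modzMr.
have [HR R2] : subring_set R /\ ~ R 2%:R^-1.
  case: PR => // E; exfalso; apply: (maxR Zs); last by right.
  by rewrite E; split=> // /(_ 0); rewrite /Zs /= rpred0 => /(_ isT).
exists R; split=> // S HS S2 RS x Sx.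
case: (pselect (S `<=` R)) => [/(_ x Sx)//|nSR].
by case: (maxR S) => //; right.
Qed.

Section Maximal.
Variable R : set algC.
Hypotheses (HR : subring_set R) (R2 : ~ R 2%:R^-1).
Hypothesis maxR :
  forall S, subring_set S -> ~ S 2%:R^-1 -> R `<=` S -> S `<=` R.

Lemma maximal_adjoin x : ~ R x -> adjoin_set R x 2%:R^-1.
Proof.
move=> nRx; apply: contrapT => nA; apply: nRx.
apply: (maxR (adjoin_subring x HR) nA); last exact: adjoin_self.
exact: sub_adjoin.
Qed.

(* Localising R at the multiplicative set 1 + 2R does not invert 2. *)
Lemma maximal_unit r : R r -> 1 + 2%:R * r != 0 /\ R (1 + 2%:R * r)^-1.
Proof.
have R0 := subring_set0 HR; case: (HR) => R1 RB RM Rr.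
have RD u v : R u -> R v -> R (u + v) by exact: subring_setD.
pose S : set algC := [set z | exists s t, [/\ R s, R t & z = s / (1 + 2%:R * t)]].
have nz t : R t -> 1 + 2%:R * t != 0.
  move=> Rt; apply/eqP => E; apply: R2; rewrite (_ : _^-1 = - t).
    by rewrite -sub0r; apply: (RB).
  apply: (@mulfI _ 2%:R); first by rewrite pnatr_eq0.
  by rewrite mulfV ?pnatr_eq0 // mulrN; apply/eqP; rewrite eq_sym -subr_eq0 -opprD oppr_eq0 addrC E.
split; first exact: nz.
have HS : subring_set S.
  split; first by exists 1, 0; rewrite mulr0 addr0 divr1.
    move=> _ _ [s [t [Rs Rt ->]]] [s' [t' [Rs' Rt' ->]]].
    exists (s * (1 + 2%:R * t') - s' * (1 + 2%:R * t)), (t + t' + 2%:R * (t * t')).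
    have Rt2 u : R u -> R (1 + 2%:R * u).
      by move=> Ru; apply: (RD) => //; rewrite mulr_natl mulr2n; apply: (RD).
    split.
    - by apply: (RB); apply: (RM) => //; apply: Rt2.
    - by apply: (RD); [apply: (RD) | rewrite mulr_natl mulr2n; apply: (RD); apply: (RM)].
    have E : 1 + 2%:R * (t + t' + 2%:R * (t * t')) = (1 + 2%:R * t) * (1 + 2%:R * t') by ring.
    by rewrite E; field; rewrite !nz.
  move=> _ _ [s [t [Rs Rt ->]]] [s' [t' [Rs' Rt' ->]]].
  exists (s * s'), (t + t' + 2%:R * (t * t')); split; first exact: RM.
    by apply: (RD); [apply: (RD) | rewrite mulr_natl mulr2n; apply: (RD); apply: (RM)].
  have E : 1 + 2%:R * (t + t' + 2%:R * (t * t')) = (1 + 2%:R * t) * (1 + 2%:R * t') by ring.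
  by rewrite E; field; rewrite !nz.
apply: (maxR HS).
- move=> [s [t [Rs Rt E]]]; apply: R2.
  rewrite (_ : 2%:R^-1 = s - t); first exact: RB.
  have two0 : (2%:R : algC) != 0 by rewrite pnatr_eq0.
  have -> : s = 2%:R^-1 * (1 + 2%:R * t) by rewrite E divfK ?nz.
  by field.
- by move=> x Rx; exists x, 0; rewrite mulr0 addr0 divr1.
- by exists 1, r; rewrite mul1r.
Qed.

(** A witness, of degree at most m, that 1/2 lies in R[x]. Such relations for both x and 1/x are
    excluded by descent on the degrees, as in the classical proof that a maximal subring of this
    kind is a valuation ring. *)
Definition half_relation (m : nat) (x : algC) : Prop :=
  exists2 b : nat -> algC, forall i, R (b i) & \sum_(i < m.+1) 2%:R * b i * x ^+ i = 1.

Lemma half_relation_widen m n x : (m <= n)%N -> half_relation m x -> half_relation n x.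
Proof.
move=> mn [b Rb E]; exists (fun i => if (i <= m)%N then b i else 0).
  by move=> i; case: ifP => // _; exact: subring_set0.
rewrite -[RHS]E (big_ord_widen n.+1 (fun i => 2%:R * b i * x ^+ i)) //=.
rewrite [RHS]big_mkcond /=; apply: eq_bigr => i _.
by rewrite ltnS; case: (leqP i m) => _; rewrite ?mulr0 ?mul0r.
Qed.

Lemma half_relation0 x : ~ half_relation 0 x.
Proof.
move=> [b Rb]; rewrite big_ord1 expr0 mulr1 => E; apply: R2.
have -> // : 2%:R^-1 = b 0%N.
by apply: (@mulfI _ 2%:R); rewrite ?E ?mulfV ?pnatr_eq0.
Qed.

(** In the relation for 1/x, u = 1 - 2 d_0 is a unit, so multiplication by x^(m+1) expresses u
    x^(m+1) through lower powers of x. Substituting this for the leading power in the relation for x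
    lowers its degree. *)
Lemma half_relation_reduce m x : x != 0 ->
  half_relation m.+1 x -> half_relation m.+1 x^-1 -> half_relation m x.
Proof.
move=> x0 [b Rb Eb] [d Rd Ed]; case: (HR) => R1 RB RM.
have RN z : R z -> R (- z) by move=> Rz; rewrite -sub0r; apply: (RB) => //; exact: subring_set0.
have RD u v : R u -> R v -> R (u + v) by exact: subring_setD.
have [u0 Ru] := maximal_unit (RN _ (Rd 0%N)).
set u := 1 + _ in u0 Ru; pose k := 2%:R * b m.+1 / u.
exists (fun i => b i + k * d (m.+1 - i)%N).
  move=> i; apply: (RD) => //; apply: (RM) => //; apply: (RM) => //.
  by rewrite mulr_natl mulr2n; apply: (RD).
have Ed' : \sum_(i < m.+1) 2%:R * d (m.+1 - i)%N * x ^+ i = u * x ^+ m.+1.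
  have -> : u = \sum_(i < m.+1) 2%:R * d i.+1 * x^-1 ^+ i.+1.
    apply: (@addrI _ (2%:R * d 0%N)); move: Ed; rewrite big_ord_recl expr0 mulr1 => Ed.
    by rewrite [RHS]Ed /u mulrN addrC subrK.
  rewrite mulr_suml (reindex_inj rev_ord_inj) /=; apply: eq_bigr => i _.
  have im : (i <= m)%N by rewrite -ltnS.
  rewrite subSS subSn ?leq_subr // subKn // -[RHS]mulrA; congr (_ * _).
  have -> : x ^+ m.+1 = x ^+ i.+1 * x ^+ (m - i) by rewrite -exprD addSn subnKC.
  by rewrite mulrA -exprMn mulVf // expr1n mul1r.
rewrite -[RHS]Eb [RHS]big_ord_recr /= -(divfK u0 (2%:R * b m.+1)) -/k -mulrA -Ed' mulr_sumr.
rewrite -big_split /=; apply: eq_bigr => i _; ring.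
Qed.

Lemma half_relation_absurd m n x : x != 0 ->
  half_relation m x -> half_relation n x^-1 -> False.
Proof.
elim: {m n}(m + n)%N {-2}m {-2}n (erefl (m + n)%N) x => [|k IH] m n.
  by case: m => // _ x _ /half_relation0.
move=> E x x0 Am An.
case: (leqP n m) => nm.
  case: m E Am nm => [_ /half_relation0//|m E Am nm].
  apply: (IH m n _ x) => //; first by case: E.
  by apply: half_relation_reduce => //; apply: half_relation_widen An.
case: n E An nm => [_ /half_relation0//|n E An nm].
apply: (IH m n _ x) => //; first by rewrite addnS in E; case: E.
apply: half_relation_reduce; rewrite ?invr_eq0 // invrK.
by apply: half_relation_widen Am; exact: ltnW.
Qed.

Lemma half_relation_adjoin x : ~ R x -> exists m, half_relation m x.
Proof.
move=> /maximal_adjoin[p Rp E]; exists (size p); exists (fun i => p`_i) => //.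
have E2 : 2%:R * p.[x] = 1 by rewrite -E mulfV ?pnatr_eq0.
rewrite -[RHS]E2 (horner_coef_wide x (leqnSn _)) mulr_sumr; apply: eq_bigr => i _.
by rewrite mulrA.
Qed.

Lemma maximal_two_adic : two_adic_ring R.
Proof.
case: (HR) => R1 RB RM; split=> // x; case: (pselect (R x)) => [|nx]; first by left.
case: (pselect (R x^-1)) => [|nx']; [by right | exfalso].
have x0 : x != 0 by apply/eqP => E; apply: nx; rewrite E; exact: subring_set0.
have [m Am] := half_relation_adjoin nx; have [n An] := half_relation_adjoin nx'.
exact: (half_relation_absurd x0 Am An).
Qed.

End Maximal.

Lemma two_adic_exists : exists R : set algC, two_adic_ring R.
Proof. by have [R [HR R2 maxR]] := maximal_subring; exists R; apply: maximal_two_adic. Qed.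

(** If x is not in [R] then 1/x is, and dividing an integral equation of degree n for x by x^(n-1)
    shows that q_n x is in [R], with q_n the leading coefficient. The odd part of q_n is a unit of
    [R], which leaves a power of 2. *)
Lemma two_adic_archimedean (R : set algC) (x : algC) : two_adic_ring R ->
  exists k, R (2%:R ^+ k * x).
Proof.
move=> vR; case: (vR) => R1 RB RM Rx _.
case: (Rx x) => [xR|yR]; first by exists 0%N; rewrite mul1r.
have [p [Ep mp _]] := minCpolyP x.
have := root_minCpoly x; rewrite Ep.
have [q [d d0 Eq]] := rat_poly_scale p.
have q0 : q != 0.
  by apply/eqP => E; move: (monic_neq0 mp); rewrite Eq E rmorph0 scaler0 eqxx.
rewrite Eq map_polyZ rootZ ?fmorph_eq0 ?invr_eq0 ?intr_eq0 // -map_poly_comp.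
move=> /rootP qx.
have R0 : R 0 := two_adic0 vR.
case: (eqVneq x 0) => [->|x0]; first by exists 0%N; rewrite mulr0.
pose n := (size q).-1; have sq : size q = n.+1 by rewrite prednK // size_poly_gt0.
have {}qx : \sum_(i < n.+1) (q`_i)%:~R * x ^+ i = 0.
  rewrite -[RHS]qx (@horner_coef_wide _ n.+1); last by rewrite -sq size_poly.
  by apply: eq_bigr => i _; rewrite coef_map /= ratr_int.
pose s := \sum_(i < n) (q`_i)%:~R * x^-1 ^+ (n.-1 - i).
have Rint (m : int) : R m%:~R.
  by case: m => m; rewrite ?NegzE ?mulrNz; [|apply: (two_adicN vR)]; exact: two_adic_nat.
have Rs : R s.
  rewrite /s; elim/big_ind: _ => // [u v|i _]; first exact: two_adicD.
  by apply: (two_adicM vR) => //; apply: two_adicX.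
have E : (q`_n)%:~R * x = - s.
  apply/eqP; rewrite -subr_eq0 opprK; apply/eqP.
  apply: (@mulfI _ (x ^+ n)); first by rewrite expf_neq0.
  transitivity (x * \sum_(i < n.+1) (q`_i)%:~R * x ^+ i); last by rewrite qx !mulr0.
  rewrite mulrDr big_ord_recr /= mulrDr addrC; congr (_ + _); last by ring.
  rewrite /s !mulr_sumr; apply: eq_bigr => i _.
  have -> : x ^+ n = x * x ^+ i * x ^+ (n.-1 - i).
    have n0 : (0 < n)%N := leq_ltn_trans (leq0n i) (ltn_ord i).
    by rewrite -exprS -exprD addSn subnKC -1?ltnS prednK.
  move: (n.-1 - i)%N => k.
  have yk : x ^+ k * x^-1 ^+ k = 1 by rewrite -exprMn mulfV // expr1n.
  by rewrite mulrACA yk mulr1 -mulrA [x ^+ i * _]mulrC.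
have qn0 : q`_n != 0 by rewrite -lead_coefE lead_coef_eq0.
pose N := `|(q`_n)%R|%N; have N0 : (0 < N)%N by rewrite absz_gt0.
have RNx : R (N%:R * x).
  have [e Ee] : exists e : bool, q`_n = (-1) ^+ e * N%:Z.
    by exists (q`_n < 0)%R; rewrite -intEsign.
  have -> : N%:R * x = (-1) ^+ e * ((q`_n)%:~R * x).
    by rewrite Ee rmorphM /= rmorphXn /= rmorphN1 mulrA mulrA -expr2 sqrr_sign mul1r.
  rewrite E; apply: (two_adicM vR); last exact: two_adicN.
  by apply: two_adicX => //; apply: two_adicN.
pose o := (N`_(2%N)^')%N.
have NE : N = (2 ^ logn 2 N * o)%N by rewrite -p_part partnC.
have oo : odd o by rewrite -coprime2n (@pnat_coprime 2%N) ?pnat_id ?part_pnat.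
exists (logn 2 N).
have [u0 Ru] := two_adic_unit vR (two_adic_nat vR o./2).
have oE : 1 + 2%:R * o./2%:R = o%:R :> algC.
  by rewrite -natrM -[1]/(1%:R) -natrD mul2n -[in RHS](odd_double_half o) oo.
rewrite oE in u0 Ru.
have -> : 2%:R ^+ logn 2 N * x = N%:R * x * o%:R^-1.
  by rewrite {2}NE natrM natrX; field.
exact: two_adicM.
Qed.

End TwoAdicPlace.

(** * Places of degree one *)

Section Places.

Lemma nonroot_in_sequence (D : idomainType) (p : {poly D}) (u : nat -> D) :
  injective u -> p != 0 -> exists k, p.[u k] != 0.
Proof.
move=> ui p0; apply: contrapT => H.
have := @max_poly_roots D p [seq u k | k <- iota 0 (size p)] p0.
rewrite size_map size_iota ltnn map_inj_uniq ?iota_uniq // => E.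
suff /E/(_ isT) : all (root p) [seq u k | k <- iota 0 (size p)] by [].
apply/allP=> _ /mapP[k _ ->]; apply/eqP.
by apply: contrapT => /eqP nr; apply: H; exists k.
Qed.

(* Schur: H(c N k) = c (1 + N k H1(c N k)) with c = H(0). *)
Lemma prime_divisor_of_values (H : {poly int}) (N : nat) :
  (1 < size H)%N -> (0 < N)%N ->
  exists2 q, prime q /\ ~~ (q %| N)%N & exists n : int, (q%:Z %| H.[n])%Z.
Proof.
move=> sH N0; pose c := H.[0].
case: (eqVneq c 0) => [c0|c0].
  exists (pdiv N.+1); last by exists 0; rewrite -/c c0 dvdz0.
  split; first exact: pdiv_prime.
  apply/negP => d; have := pdiv_dvd N.+1; rewrite -addn1 dvdn_addr ?addn1 //.
  by rewrite dvdn1 => /eqP E; have := @pdiv_prime N.+1; rewrite E => /(_ N0).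
pose u (k : nat) : int := c * N%:Z * k%:Z.
have cN : c * N%:Z != 0 by rewrite mulf_neq0 // -lt0n.
have ui : injective u by move=> i j /(mulfI cN) [].
(* A point where H^2 <> c^2 makes the cofactor e different from 1 and -1, so that it has a prime
   divisor. *)
have nz : H ^+ 2 - (c ^+ 2)%:P != 0.
  rewrite -size_poly_gt0 size_polyDl; first by rewrite size_poly_gt0 expf_neq0 // -size_poly_gt0 ltnW.
  rewrite size_polyN size_polyC expf_neq0 //=.
  have H0 : H != 0 by rewrite -size_poly_gt0 ltnW.
  by rewrite expr2 size_mul //; case: (size H) sH => [|[|m]] //= _; rewrite addnS.
have [k] := nonroot_in_sequence ui nz; rewrite !hornerE => nk.
have [G GE] : exists G : {poly int}, H = c%:P + 'X * G.
  have /factor_theorem [G GE] : root (H - c%:P) 0 by rewrite /root !hornerE subrr.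
  by exists G; rewrite -[LHS](subrK c%:P) GE polyC0 subr0 addrC mulrC.
pose e : int := 1 + N%:Z * (k%:Z * G.[u k]).
have eE : H.[u k] = c * e by rewrite GE !hornerE /e /u; ring.
have e1 : `|e|%N != 1%N.
  apply: contra nk => /eqP E; rewrite eE exprMn.
  have -> : e ^+ 2 = 1 by rewrite -[e ^+ 2]gez0_abs ?sqr_ge0 // abszX E.
  by rewrite mulr1 subrr.
have [q qp qe] : exists2 q, prime q & (q %| `|e|)%N.
  case: (posnP `|e|%N) => [->|e0]; first by exists 2%N.
  by exists (pdiv `|e|); [apply: pdiv_prime; rewrite ltn_neqAle eq_sym e1 | exact: pdiv_dvd].
exists q; last by exists (u k); rewrite eE dvdz_mull.
split=> //; apply/negP => qN; have : (q%:Z %| 1)%Z.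
  have : (q%:Z %| e)%Z by [].
  by rewrite /e rpredDr // dvdz_mulr.
by rewrite dvdzE /= dvdn1 => /eqP E; rewrite E in qp.
Qed.

(* [v] is a valuation normalised by [v q = 1] with residue field [F_q]; its
   value at 0 is irrelevant. *)
Record degree_one_place (F : fieldType) (q : nat) (v : F -> int) : Prop := DegreeOnePlace {
  place_prime : prime q;
  placeM : forall x y, x != 0 -> y != 0 -> v (x * y) = v x + v y;
  placeD : forall x y, x != 0 -> y != 0 -> x + y != 0 ->
    v x <= v (x + y) \/ v y <= v (x + y);
  place_unif : q%:R != 0 :> F /\ v q%:R = 1;
  place_residue : forall x, x != 0 -> 0 <= v x ->
    exists n : nat, x = n%:R \/ 1 <= v (x - n%:R) }.

(** * The local ring at a simple root modulo q of an integral equation of the generator z *)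

Section Construction.
Variables (F : fieldType) (z : F).
Hypothesis char0 : forall n : nat, n%:R = 0 :> F -> n = 0%N.
Let ev (A : {poly int}) : F := (map_poly intr A).[z].

Let evB A B : ev (A - B) = ev A - ev B.
Proof. by rewrite /ev rmorphB /= !hornerE. Qed.
Let evD A B : ev (A + B) = ev A + ev B.
Proof. by rewrite /ev rmorphD /= !hornerE. Qed.
Let evM A B : ev (A * B) = ev A * ev B.
Proof. by rewrite /ev rmorphM /= !hornerE. Qed.
Let evC c : ev c%:P = c%:~R.
Proof. by rewrite /ev map_polyC hornerC. Qed.
Let ev1 : ev 1 = 1.
Proof. by rewrite /ev rmorph1 hornerC. Qed.
Let evX : ev 'X = z.
Proof. by rewrite /ev map_polyX hornerX. Qed.

Hypothesis gen : forall x, exists A (d : nat), d != 0%N /\ x = ev A / d%:R.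

Lemma int_neq0 (m : int) : m != 0 -> m%:~R != 0 :> F.
Proof.
apply: contra => /eqP; case: m => n; first by move/char0->.
by rewrite NegzE mulrNz => /eqP; rewrite oppr_eq0 => /eqP/char0.
Qed.

Variables (H : {poly int}) (q : nat) (n : int).
Hypotheses (H0 : H != 0) (evH : ev H = 0) (qp : prime q).
Hypothesis Hmin : forall B, B != 0 -> ev B = 0 -> (size H <= size B)%N.
Hypotheses (qlc : ~~ (q%:Z %| lead_coef H)%Z) (qH : (q%:Z %| H.[n])%Z).
Hypothesis qdH : ~~ (q%:Z %| H^`().[n])%Z.

Let dvdq := fun m : int => (q%:Z %| m)%Z.

Let dvdqM a b : dvdq (a * b) = dvdq a || dvdq b.
Proof. by rewrite /dvdq !dvdzE abszM /= Euclid_dvdM. Qed.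

(** Pseudo-division by [H] leaves remainder 0 by minimality, so B times a power of the leading
    coefficient, which is prime to q, is a multiple of [H]. This makes the reduction sending z to n
    modulo q well defined. *)
Lemma ev_eq0 B : ev B = 0 -> dvdq B.[n].
Proof.
move=> evB0.
have E := Pdiv.Idomain.divp_eq B H; set k := scalp B H in E.
have r0 : B %% H = 0.
  apply/eqP/negPn/negP => r0.
  have : ev (B %% H) = 0.
    have := congr1 ev E; rewrite evD evM evH mulr0 add0r -mul_polyC evM evB0 mulr0.
    by move->.
  by move/(Hmin r0); rewrite leqNgt ltn_modp H0.
have := congr1 (fun p => p.[n]) E; rewrite r0 addr0 hornerZ hornerM => E2.
have : dvdq (lead_coef H ^+ k * B.[n]) by rewrite E2 dvdqM (qH : dvdq _) orbT.
rewrite dvdqM => /orP[|//]; elim: k {E E2} => [|k IH].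
  by rewrite expr0 /dvdq dvdzE /= dvdn1 => /eqP E; move: qp; rewrite E.
by rewrite exprS dvdqM => /orP[|//]; rewrite /dvdq (negPf qlc).
Qed.

(** The local ring of the place sending z to n modulo q, and next its units. The valuation will be
    the exponent of q in front of a unit. *)
Let inR x := exists A B, ~~ dvdq B.[n] /\ x = ev A / ev B.
Let inU x := exists A B, [/\ ~~ dvdq A.[n], ~~ dvdq B.[n] & x = ev A / ev B].

Let ev_neq0 B : ~~ dvdq B.[n] -> ev B != 0.
Proof. by apply: contra => /eqP/ev_eq0. Qed.

Let qF : F := q%:R.
Let qF0 : qF != 0.
Proof. by apply/eqP => /char0 E; move: qp; rewrite E. Qed.
Let evq : ev q%:Z%:P = qF. Proof. by rewrite evC. Qed.

Let ndvd1 : ~~ dvdq 1.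
Proof. by rewrite /dvdq dvdzE /= dvdn1; case: (q) qp => [|[]]. Qed.

Let inR_ev A : inR (ev A).
Proof. by exists A, 1; rewrite hornerC; split; [|rewrite ev1 divr1]. Qed.

Let inRM x y : inR x -> inR y -> inR (x * y).
Proof.
move=> [A [B [nB ->]]] [C [D [nD ->]]]; exists (A * C), (B * D).
by rewrite hornerM dvdqM negb_or nB nD !evM mulf_div.
Qed.

Let inRD x y : inR x -> inR y -> inR (x + y).
Proof.
move=> [A [B [nB ->]]] [C [D [nD ->]]]; exists (A * D + C * B), (B * D).
by rewrite hornerM dvdqM negb_or nB nD evD !evM addf_div ?ev_neq0.
Qed.

Let inR_of_U x : inU x -> inR x.
Proof. by move=> [A [B [_ nB ->]]]; exists A, B. Qed.

Let inUM x y : inU x -> inU y -> inU (x * y).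
Proof.
move=> [A [B [nA nB ->]]] [C [D [nC nD ->]]]; exists (A * C), (B * D).
by rewrite !hornerM !dvdqM !negb_or nA nC nB nD !evM mulf_div.
Qed.

Let inU_neq0 x : inU x -> x != 0.
Proof. by move=> [A [B [nA nB ->]]]; rewrite mulf_neq0 ?invr_eq0 ?ev_neq0. Qed.

Let inU_notq x : inR x -> ~ inU (qF * x).
Proof.
move=> [A [B [nB ->]]] [C [D [nC nD E]]].
have : ev (q%:Z%:P * A * D - C * B) = 0.
  rewrite evB !evM evq; apply/eqP; rewrite subr_eq0; apply/eqP.
  apply: (@mulIf _ ((ev B)^-1 / ev D)); first by rewrite mulf_neq0 ?invr_eq0 ?ev_neq0.
  transitivity (qF * (ev A / ev B)); first by field; rewrite !ev_neq0.
  by rewrite E; field; rewrite !ev_neq0.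
move/ev_eq0; rewrite !hornerE /dvdq rpredBl; last by rewrite -mulrA dvdz_mulr.
by rewrite -/(dvdq _) dvdqM (negPf nC) (negPf nB).
Qed.

(** The simplicity of the root enters here. Write H = H(n) + (X - n) H1; then H1(n) = H'(n) is prime
    to q, and z - n = - H(n) / H1(z) is q times an element of the local ring. So q generates the
    maximal ideal. *)
Let residue A : dvdq A.[n] -> exists2 x, inR x & ev A = qF * x.
Proof.
have split_at (G : {poly int}) : exists G1, G = G.[n]%:P + ('X - n%:P) * G1.
  have /factor_theorem [G1 GE] : root (G - G.[n]%:P) n by rewrite /root !hornerE subrr.
  by exists G1; rewrite -[LHS](subrK G.[n]%:P) GE addrC mulrC.
have [H1 HE] := split_at H; have [A1 AE] := split_at A.
have nH1 : ~~ dvdq H1.[n].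
  by apply: contra qdH; rewrite {1}HE !derivE !hornerE subrr mul0r ?addr0 ?add0r.
have zn : z - n%:~R = qF * (- ((H.[n] %/ q%:Z)%Z)%:~R / ev H1).
  have := evH; rewrite {1}HE evD evC evM evB evX evC => /eqP.
  rewrite addrC addr_eq0 => /eqP E; apply: (@mulIf _ (ev H1)); first exact: ev_neq0.
  rewrite E -{1}(divzK qH) intrM; field; exact: ev_neq0.
move=> dA; exists (ev ((A.[n] %/ q%:Z)%Z%:P) + (- ((H.[n] %/ q%:Z)%Z)%:~R / ev H1) * ev A1).
  apply: inRD; first exact: inR_ev.
  apply: inRM; last exact: inR_ev.
  by exists (- ((H.[n] %/ q%:Z)%Z))%:P, H1; rewrite evC rmorphN.
by rewrite {1}AE evD evC evM evB evX evC zn -{1}(divzK dA) intrM evC; ring.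
Qed.

Let inUV x : inU x -> inU x^-1.
Proof. by move=> [A [B [nA nB ->]]]; exists B, A; rewrite invf_div. Qed.

Let inRq x k : inR x -> inR (qF ^+ k * x).
Proof.
move=> Rx; apply: inRM => //; elim: k => [|k IH].
  by rewrite expr0 -ev1; apply: inR_ev.
by rewrite exprS; apply: inRM => //; rewrite -evq; apply: inR_ev.
Qed.

Let nat_decomp (d : nat) : d != 0%N -> exists k u, inU u /\ d%:R = qF ^+ k * u.
Proof.
move=> d0; pose d' := (d`_(q^'))%N.
have dE : d = (q ^ logn q d * d')%N by rewrite -p_part partnC // lt0n.
exists (logn q d), d'%:R; split; last by rewrite {1}dE natrM natrX.
exists (d'%:Z)%:P, 1; rewrite !hornerC; split=> //.
  by rewrite /dvdq dvdzE /= -prime_coprime // (@pnat_coprime q) ?pnat_id ?part_pnat.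
by rewrite ev1 evC divr1.
Qed.

(** Division by q stops because some ev B satisfies ev A ev B = d with d a nonzero natural number,
    whose exponent of q bounds the number of steps. *)
Let ev_decomp A : ev A != 0 -> exists k u, inU u /\ ev A = qF ^+ k * u.
Proof.
move=> A0; have [B [d [d0 E]]] := gen (ev A)^-1.
have dF0 : d%:R != 0 :> F by apply: contra d0 => /eqP/char0->.
have AB : ev A * ev B = d%:R.
  by rewrite -[ev B](divfK dF0) -E mulVKf.
have [i [w [Uw dE]]] := nat_decomp d0.
have step j : (exists k u, inU u /\ ev A = qF ^+ k * u) \/
    exists2 r, inR r & ev A = qF ^+ j * r.
  elim: j => [|j [IH|[r [C [D [nD rE]]] AE]]]; [|by left|].
    by right; exists (ev A); rewrite ?mul1r //; apply: inR_ev.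
  case: (boolP (dvdq C.[n])) => [dC|nC]; last first.
    by left; exists j, r; split=> //; exists C, D.
  right; have [x Rx xE] := residue dC; exists (x / ev D).
    by apply: inRM => //; exists 1, D; rewrite ev1 mul1r.
  by rewrite AE rE xE exprSr !mulrA.
case: (step i.+1) => // -[r Rr AE]; exfalso.
apply: (@inU_notq (r * ev B)); first by apply: inRM => //; apply: inR_ev.
suff -> : qF * (r * ev B) = w by [].
apply: (@mulfI _ (qF ^+ i)); first by rewrite expf_neq0.
by rewrite -dE -AB AE exprSr; ring.
Qed.

Let decomp x : x != 0 -> exists k : int, exists u, inU u /\ x = qF ^ k * u.
Proof.
move=> x0; have [A [d [d0 E]]] := gen x.
have A0 : ev A != 0 by apply: contra x0 => /eqP A0; rewrite E A0 mul0r.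
have [k [u [Uu uE]]] := ev_decomp A0; have [l [w [Uw wE]]] := nat_decomp d0.
exists (k%:Z - l%:Z), (u / w); split; first by apply: inUM => //; apply: inUV.
by rewrite E uE wE expfzDr // -exprnN invfM mulrACA.
Qed.

Let decomp_le (k l : int) u w : inR u -> inU w -> qF ^ k * u = qF ^ l * w -> k <= l.
Proof.
move=> Ru Uw E; rewrite leNgt; apply/negP => lk.
have [m mE] : exists m : nat, k = l + m.+1%:Z.
  case: (k - l) (subrK l k) lk => m <-; first last.
    by rewrite NegzE ltrDr oppr_gt0.
  by case: m => [|m _]; [rewrite add0r ltxx | exists m; rewrite addrC].
apply: (@inU_notq (qF ^+ m * u)); first exact: inRq.
suff -> : qF * (qF ^+ m * u) = w by [].
apply: (@mulfI _ (qF ^ l)); first by rewrite expfz_neq0.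
by rewrite -E mE expfzDr // -exprnP exprS; ring.
Qed.

Lemma place_at_root : exists v : F -> int, degree_one_place q v /\
  forall A B C D (x : F), x = ev A / ev B -> x^-1 = ev C / ev D ->
    ~~ dvdq B.[n] -> ~~ dvdq D.[n] -> x != 0 -> v x = 0.
Proof.
have vP x : {k : int | x != 0 -> exists u, inU u /\ x = qF ^ k * u}.
  apply: cid; case: (eqVneq x 0) => [->|x0]; first by exists 0.
  by have [k Hk] := decomp x0; exists k.
pose v x := sval (vP x); have vE x : x != 0 -> exists u, inU u /\ x = qF ^ (v x) * u.
  exact: (svalP (vP x)).
have v_ge x k u : x != 0 -> inR u -> x = qF ^ k * u -> k <= v x.
  by move=> x0 Ru E; have [w [Uw]] := vE x x0; rewrite {1}E => /(decomp_le Ru Uw).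
have v_eq x k u : x != 0 -> inU u -> x = qF ^ k * u -> v x = k.
  move=> x0 Uu E; apply/eqP; rewrite eq_le (v_ge _ _ u) ?andbT //; last exact: inR_of_U.
  have [w [Uw Ew]] := vE x x0; apply: (decomp_le (inR_of_U Uw) Uu).
  by rewrite -Ew.
have inR1 : inR 1 by rewrite -ev1.
have inU1 : inU 1.
  by exists 1, 1; rewrite hornerC ndvd1 ev1 divr1.
exists v; split; last first.
  move=> A B C D x xE x'E nB nD x0; apply/eqP; rewrite eq_le; apply/andP; split; last first.
    by apply: (v_ge _ _ x) => //; [exists A, B | rewrite mul1r].
  have [w [Uw E]] := vE x x0; have w0 := inU_neq0 Uw.
  apply: (@decomp_le _ _ (w * x^-1) 1) => //.
    by apply: inRM; [exact: inR_of_U | exists C, D].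
  by rewrite mulrA -E divff // expr0z mul1r.
split=> //.
- move=> x y x0 y0; have [u [Uu xE]] := vE x x0; have [w [Uw yE]] := vE y y0.
  apply: (v_eq _ _ (u * w)); rewrite ?mulf_neq0 //; first exact: inUM.
  by rewrite {1}xE {1}yE expfzDr // mulrACA.
- have main x y : x != 0 -> y != 0 -> x + y != 0 -> v x <= v y -> v x <= v (x + y).
    move=> x0 y0 xy0 le; have [u [Uu xE]] := vE x x0; have [w [Uw yE]] := vE y y0.
    case: (v y - v x) (subrK (v x) (v y)) le => m mE le; last first.
      by move: le; rewrite -mE lerDr NegzE oppr_ge0.
    apply: (v_ge _ _ (u + qF ^+ m * w)) => //.
      by apply: inRD; [exact: inR_of_U | apply: inRq; exact: inR_of_U].
    rewrite mulrDr -xE mulrA; congr (_ + _).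
    by rewrite {1}yE -mE expfzDr // -exprnP [_ ^+ m * _]mulrC.
  move=> x y x0 y0 xy0; case: (leP (v x) (v y)) => [le|/ltW le]; first by left; apply: main.
  by right; rewrite addrC; apply: main; rewrite // addrC.
- by split=> //; apply: (v_eq _ _ 1); rewrite // expr1z mulr1.
move=> x x0 vx; have [u [Uu xE]] := vE x x0.
have [A [B [nB xAB]]] : inR x.
  case: (v x) vx xE => // k _ ->; rewrite -exprnP; apply: inRq; exact: inR_of_U.
have cB : coprime q `|B.[n]|%N by rewrite prime_coprime.
(* The residue m is A(n) / B(n) modulo q, computed with a Bezout inverse of B(n). *)
have [m Em] : exists m : nat, dvdq (A.[n] - m%:Z * B.[n]).
  have [u' [w' Ew]] := Bezoutz q%:Z B.[n].
  have {Ew} Ew : u' * q%:Z + w' * B.[n] = 1.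
    by rewrite Ew /gcdz /=; move/eqP: cB => ->.
  exists `|((A.[n] * w') %% q%:Z)%Z|%N; rewrite gez0_abs; last first.
    by rewrite modz_ge0 // eqz_nat -lt0n prime_gt0.
  have -> : A.[n] - ((A.[n] * w') %% q%:Z)%Z * B.[n] =
      (A.[n] * u' + ((A.[n] * w') %/ q%:Z)%Z * B.[n]) * q%:Z.
    have dE := divz_eq (A.[n] * w') q%:Z.
    set k := (_ %/ _)%Z in dE *; set m := (_ %% _)%Z in dE *.
    have -> : m = A.[n] * w' - k * q%:Z by rewrite dE; ring.
    transitivity (A.[n] * (u' * q%:Z + w' * B.[n]) - (A.[n] * w' - k * q%:Z) * B.[n]).
      by rewrite Ew mulr1.
    by ring.
  by rewrite /dvdq dvdz_mull.
exists m; case: (eqVneq x m%:R) => [|xm]; [by left | right].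
rewrite -subr_eq0 in xm.
have [y Ry yE] : exists2 y, inR y & ev (A - (m%:Z)%:P * B) = qF * y.
  by apply: residue; rewrite !hornerE.
apply: (v_ge _ _ (y / ev B)) => //.
  by apply: inRM => //; exists 1, B; rewrite ev1 mul1r.
rewrite expr1z mulrA -yE evB evM evC mulrBl mulfK ?ev_neq0 //.
by rewrite xAB.
Qed.
End Construction.

Lemma exists_place_gen (F : fieldType) (z : F) (S : seq F) (N : nat) :
  (forall n : nat, n%:R = 0 :> F -> n = 0%N) ->
  (forall x, exists (A : {poly int}) (d : nat),
     d != 0%N /\ x = (map_poly intr A).[z] / d%:R) ->
  (exists2 H : {poly int}, H != 0 & (map_poly intr H).[z] = 0) -> (0 < N)%N ->
  exists q (v : F -> int), [/\ degree_one_place q v, ~~ (q %| N)%N &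
    {in S, forall x, x != 0 -> v x = 0}].
Proof.
move=> char0 gen [H1 H10 evH1] N0; pose ev (A : {poly int}) := (map_poly intr A).[z].
pose ok n := `[< exists H, [/\ H != 0, ev H = 0 & size H = n] >].
have okH1 : exists n, ok n by exists (size H1); apply/asboolP; exists H1.
have [_ /asboolP[H [H0 evH <-]] Hmin'] := ex_minnP okH1.
have Hmin B : B != 0 -> ev B = 0 -> (size H <= size B)%N.
  by move=> B0 evB; apply: Hmin'; apply/asboolP; exists B.
have sH : (1 < size H)%N.
  rewrite ltnNge; apply/negP => /size1_polyC HE.
  move: evH H0; rewrite HE /ev map_polyC hornerC => E.
  by rewrite polyC_eq0 => /(int_neq0 char0); rewrite E eqxx.
have dH0 : H^`() != 0.
  apply/eqP => /polyP/(_ (size H).-2); rewrite coef_deriv coef0.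
  have -> : (size H).-2.+1 = (size H).-1 by case: (size H) sH => [|[]].
  move/eqP; rewrite -lead_coefE mulrn_eq0 lead_coef_eq0 (negPf H0) orbF.
  by case: (size H) sH => [|[]].
have evdH : ev H^`() != 0.
  by apply/eqP => /(Hmin _ dH0); rewrite leqNgt lt_size_deriv.
have [U [d [d0 UE]]] := gen (ev H^`())^-1.
have /choice[Af AfP] := gen.
have /choice[df dfP] : forall x, exists d : nat, d != 0%N /\ x = ev (Af x) / d%:R by [].
(* A prime outside B divides neither N nor the leading coefficient of H; it does not divide d, so
   the inverse U(z) / d of H'(z) forces the root to be simple; and it makes the nonzero elements of
   S units, since the denominators of x and 1/x are included. *)
pose B := (N * (`|lead_coef H| * d * \prod_(x <- S) (df x * df x^-1)))%N.
have B0 : (0 < B)%N.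
  rewrite !muln_gt0 N0 absz_gt0 lead_coef_eq0 H0 lt0n d0 /=.
  apply: prodn_gt0 => x; rewrite muln_gt0 !lt0n.
  by case: (dfP x) (dfP x^-1) => -> _ [-> _].
have [q [qp qB] [n qH]] := prime_divisor_of_values sH B0.
have nq m : (m %| B)%N -> ~~ (q %| m)%N.
  by move=> mB; apply: contra qB => /dvdn_trans; apply.
have qlc : ~~ (q%:Z %| lead_coef H)%Z.
  by rewrite dvdzE /=; apply: nq; rewrite /B mulnCA -!mulnA dvdn_mulr.
have qd : ~~ (q %| d)%N by apply: nq; rewrite /B -mulnA mulnCA mulnC -!mulnA mulnCA dvdn_mulr.
have char0d : d%:R != 0 :> F by apply: contra d0 => /eqP/char0->.
have qdH : ~~ (q%:Z %| H^`().[n])%Z.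
  have E : ev (H^`() * U - (d%:Z)%:P) = 0.
    rewrite /ev rmorphB rmorphM /= map_polyC !hornerE -[LHS]subr0 -/(ev _) -/(ev _).
    by rewrite -[ev U](divfK char0d) -UE mulVKf // subr0 subrr.
  have := ev_eq0 H0 evH qp Hmin qlc qH E.
  rewrite !hornerE => Eq; apply: contra qd => dH.
  by move: Eq; rewrite rpredBl ?dvdz_mulr // dvdzE.
have [v [pv vE]] := place_at_root char0 gen H0 evH qp Hmin qlc qH qdH.
exists q, v; split=> //; first by apply: nq; rewrite dvdn_mulr.
move=> x xS x0; have [dx xE] := dfP x; have [dx' xE'] := dfP x^-1.
apply: (vE (Af x) (df x)%:Z%:P (Af x^-1) (df x^-1)%:Z%:P) => //.
- by rewrite map_polyC hornerC.
- by rewrite map_polyC hornerC.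
- rewrite hornerC dvdzE; apply: nq; rewrite /B (big_rem x) //=.
  by rewrite mulnC -!mulnA dvdn_mull // dvdn_mull // dvdn_mulr.
- rewrite hornerC dvdzE; apply: nq; rewrite /B (big_rem x) //=.
  by rewrite mulnC -!mulnA dvdn_mull // dvdn_mull // mulnCA dvdn_mulr.
Qed.

Lemma fieldext_natr_eq0 (M : fieldExtType rat) n : (n%:R == 0 :> M) = (n == 0%N).
Proof. by rewrite -(rmorph_nat (in_alg M)) fmorph_eq0 pnatr_eq0. Qed.

Lemma exists_place (M : fieldExtType rat) (S : seq M) (N : nat) : (0 < N)%N ->
  exists q (v : M -> int), [/\ degree_one_place q v, ~~ (q %| N)%N &
    {in S, forall x, x != 0 -> v x = 0}].
Proof.
move=> N0; have char0 (n : nat) : n%:R = 0 :> M -> n = 0%N.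
  by move/eqP; rewrite fieldext_natr_eq0 => /eqP.
have ratE (p : {poly rat}) (x : M) : exists (A : {poly int}) (d : nat),
    d != 0%N /\ (map_poly (in_alg M) p).[x] = (map_poly intr A).[x] / d%:R.
  have [A [d d0 pE]] := rat_poly_scale p.
  exists ((-1) ^+ (d < 0)%R *: A), `|d|%N; split; first by rewrite absz_eq0.
  have mapE : map_poly (in_alg M) (map_poly intr A) = map_poly intr A.
    by rewrite -map_poly_comp; apply: eq_map_poly => c; rewrite /= scaler_int.
  have dE : d = (-1) ^+ (d < 0)%R * (`|d|%N)%:Z by rewrite -intEsign.
  have dM0 : (`|d|%N)%:R != 0 :> M by apply/eqP => /char0/eqP; rewrite absz_eq0 (negPf d0).
  have key : (d%:~R^-1 : rat)%:A = ((-1) ^+ (d < 0)%R : int)%:~R / (`|d|%N)%:R :> M.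
    rewrite -[LHS]/(in_alg M _) fmorphV rmorph_int {1}dE intrM invfM; congr (_ * _).
    by case: (d < 0)%R; rewrite ?expr0 ?expr1 ?mulrNz ?invrN invr1.
  by rewrite pE !map_polyZ /= !hornerZ mapE key mulrAC.
have pc0 : [pchar M] =i pred0 by move=> p; rewrite pchar_lalg pchar_num.
have sep : separable 1%VS {:M}%VS by apply/separableP => y _; apply: pcharf0_separable.
have gen1 := eq_adjoin_separable_generator sep (sub1v _).
set z := separable_generator _ _ in gen1.
apply: (@exists_place_gen M z) => //.
- move=> x; have : x \in <<1; z>>%VS by rewrite -gen1 memvf.
  by case/Fadjoin_polyP => _ /polyOver1P[p ->] ->; exact: ratE.
have /polyOver1P[p pE] := minPolyOver 1%VS z.
have := root_minPoly 1%VS z; have := monic_neq0 (monic_minPoly 1%VS z).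
rewrite pE map_poly_eq0 => p0 /rootP pz0.
have [A [d d0 AE]] := rat_poly_scale p; exists A.
  by apply: contra p0 => /eqP A0; rewrite AE A0 rmorph0 scaler0.
move: pz0; rewrite AE map_polyZ hornerZ => /eqP.
rewrite mulf_eq0 fmorph_eq0 invr_eq0 intr_eq0 (negPf d0) /= -map_poly_comp => /eqP E.
by rewrite -[RHS]E; congr (_.[_]); apply: eq_map_poly => c; rewrite /= scaler_int.
Qed.

End Places.

(** * The family of cubics *)

Section Family.
Variable F : fieldType.
Implicit Types a c t w x : F.

Definition abscissa_cubic c t x : F :=
  x ^+ 3 - c * t * x ^+ 2 + c ^+ 2 * (t - 3%:R) * x + c ^+ 3.

(** The cubic takes the value num0 + den0 t at 1, num2 + den2 t at a, and c^3 at 0. Up to sign, the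
    product of these three values is the product of the f(x_i). *)
Definition num0 c : F := 1 - 3%:R * c ^+ 2 + c ^+ 3.
Definition num2 a c : F := a ^+ 3 - 3%:R * c ^+ 2 * a + c ^+ 3.
Definition den0 c : F := c * (c - 1).
Definition den2 a c : F := c * a * (c - a).

Definition den_t a c w : F := den0 c + c * w ^+ 2 * den2 a c.

(* Solves (num0 + den0 t) = - c w^2 (num2 + den2 t), which makes
   - c^3 (num0 + den0 t) (num2 + den2 t) a square. *)
Definition par_t a c w : F := - (num0 c + c * w ^+ 2 * num2 a c) / den_t a c w.

Definition par_y a c w : F := c ^+ 2 * w * (num2 a c + den2 a c * par_t a c w).

(* With s1 = c t, s2 = c^2 (t - 3), s3 = - c^3 the elementary symmetric
   functions of the roots x_i of the cubic, these are the sums of the f(x_i)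
   and of the f(x_i) f(x_j). *)
Definition sum_f a (s1 s2 s3 : F) : F :=
  s1 ^+ 3 - 3%:R * s1 * s2 + 3%:R * s3 - (1 + a) * (s1 ^+ 2 - 2%:R * s2) + a * s1.

Definition sum_ff a (s1 s2 s3 : F) : F :=
  let p2 := s2 ^+ 2 - 2%:R * s1 * s3 in
  s2 ^+ 3 - 3%:R * s1 * s2 * s3 + 3%:R * s3 ^+ 2
  - (1 + a) * (s1 * p2 - s2 * s3) + a * (s1 ^+ 2 * s2 - 5%:R * s1 * s3 - 2%:R * p2)
  + (1 + a) ^+ 2 * p2 - (1 + a) * a * (s1 * s2 - 3%:R * s3) + a ^+ 2 * s2.

(** The quartic satisfied by e = g1 + g2 + g3 when g_i^2 = f(x_i) and g1 g2 g3 = y: indeed e^2 - S =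
    2 (g1 g2 + g1 g3 + g2 g3), whose square is 4 S' + 8 e y. *)
Definition resolvent a c w (e : F) : F :=
  let t := par_t a c w in
  let S := sum_f a (c * t) (c ^+ 2 * (t - 3%:R)) (- c ^+ 3) in
  let S' := sum_ff a (c * t) (c ^+ 2 * (t - 3%:R)) (- c ^+ 3) in
  (e ^+ 2 - S) ^+ 2 - 8%:R * e * par_y a c w - 4%:R * S'.

Lemma sum_fE a x1 x2 x3 :
  let f x := x * (x - 1) * (x - a) in
  f x1 + f x2 + f x3 =
  sum_f a (x1 + x2 + x3) (x1 * x2 + x1 * x3 + x2 * x3) (x1 * x2 * x3).
Proof. by rewrite /sum_f /=; ring. Qed.

Lemma sum_ffE a x1 x2 x3 :
  let f x := x * (x - 1) * (x - a) in
  f x1 * f x2 + f x1 * f x3 + f x2 * f x3 =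
  sum_ff a (x1 + x2 + x3) (x1 * x2 + x1 * x3 + x2 * x3) (x1 * x2 * x3).
Proof. by rewrite /sum_ff /=; ring. Qed.

Lemma par_y_sqr a c w : den_t a c w != 0 ->
  - c ^+ 3 * (num0 c + den0 c * par_t a c w) * (num2 a c + den2 a c * par_t a c w)
  = par_y a c w ^+ 2.
Proof.
move=> nz; have -> : num0 c + den0 c * par_t a c w =
    - c * w ^+ 2 * (num2 a c + den2 a c * par_t a c w).
  by rewrite /par_t; move: nz; rewrite /den_t => nz; field.
by rewrite /par_y; ring.
Qed.

(** Up to the factor c, this is the determinant of the Moebius map that sends w^2 to t. *)
Lemma num_den_det a c :
  num0 c * den2 a c - den0 c * num2 a c =
  c * (a - 1) * (c ^+ 2 - a * c + a) * (c ^+ 2 - c + a).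
Proof. by rewrite /num0 /den2 /den0 /num2; ring. Qed.

(** The first two quadratic expressions are the norms of a + c om and 1 + c om for a primitive cube
    root of unity om; the other two are factors of the determinant above. *)
Definition good_c a c : bool :=
  [&& c != 0, c != 1, c != a, c ^+ 2 - a * c + a ^+ 2 != 0, c ^+ 2 - c + 1 != 0,
      c ^+ 2 - a * c + a != 0 & c ^+ 2 - c + a != 0].

End Family.

(** * Calculus with the valuation of a place *)

Section PlaceTheory.
Variables (F : fieldType) (q : nat) (v : F -> int).
Hypothesis pv : degree_one_place q v.

Definition val_ge (k : int) (x : F) : Prop := x = 0 \/ k <= v x.
Definition val_eq (k : int) (x : F) : Prop := x != 0 /\ v x = k.

Lemma val_ge0 k : val_ge k 0. Proof. by left. Qed.

Lemma val_geM k l x y : val_ge k x -> val_ge l y -> val_ge (k + l) (x * y).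
Proof.
case=> [->|kx]; first by left; rewrite mul0r.
case=> [->|ly]; first by left; rewrite mulr0.
case: (eqVneq x 0) => [->|x0]; first by left; rewrite mul0r.
case: (eqVneq y 0) => [->|y0]; first by left; rewrite mulr0.
by right; rewrite (placeM pv) // lerD.
Qed.

Lemma val_eqM k l x y : val_eq k x -> val_eq l y -> val_eq (k + l) (x * y).
Proof. by move=> [x0 <-] [y0 <-]; split; rewrite ?mulf_neq0 ?(placeM pv). Qed.

Lemma val_eq_mul k l m x y : val_eq k x -> val_eq l y -> k + l = m -> val_eq m (x * y).
Proof. by move=> kx ly <-; apply: val_eqM. Qed.

Lemma val_ge_mul k l m x y : val_ge k x -> val_ge l y -> k + l = m -> val_ge m (x * y).
Proof. by move=> kx ly <-; apply: val_geM. Qed.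

Lemma val_eq1 : val_eq 0 1.
Proof.
split; first exact: oner_neq0.
apply: (@addrI _ (v 1)); rewrite -(placeM pv) ?oner_neq0 // mulr1 addr0 //.
Qed.

Lemma val_eqX k x n : val_eq k x -> val_eq (k *+ n) (x ^+ n).
Proof.
move=> kx; elim: n => [|n IH]; first exact: val_eq1.
by rewrite exprS mulrS; apply: val_eqM.
Qed.

Lemma val_eqN1 : val_eq 0 (- 1).
Proof.
have n0 : (-1 : F) != 0 by rewrite oppr_eq0 oner_neq0.
split=> //; have := placeM pv n0 n0.
rewrite mulrNN mulr1 (val_eq1.2) => /esym/eqP.
by rewrite -mulr2n mulrn_eq0 => /eqP.
Qed.

Lemma val_eqN k x : val_eq k x -> val_eq k (- x).
Proof. by move=> kx; rewrite -mulN1r -[k]add0r; apply: val_eqM => //; exact: val_eqN1. Qed.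

Lemma val_eqV k x : val_eq k x -> val_eq (- k) x^-1.
Proof.
move=> [x0 <-]; split; first by rewrite invr_eq0.
apply: (@addrI _ (v x)); rewrite -(placeM pv) ?invr_eq0 // divff // subrr.
exact: val_eq1.2.
Qed.

Lemma val_eq_ge k x : val_eq k x -> val_ge k x.
Proof. by move=> [_ <-]; right. Qed.

Lemma val_ge_eq k l x : val_eq k x -> l <= k -> val_ge l x.
Proof. by move=> [_ <-]; right. Qed.

Lemma val_geW k l x : val_ge k x -> l <= k -> val_ge l x.
Proof. by case=> [->|kx] lk; [left | right; apply: le_trans kx]. Qed.

Lemma val_geN k x : val_ge k x -> val_ge k (- x).
Proof. by move=> kx; rewrite -mulN1r -[k]add0r; apply: val_geM => //; apply: val_eq_ge val_eqN1. Qed.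

Lemma val_geD k x y : val_ge k x -> val_ge k y -> val_ge k (x + y).
Proof.
case=> [->|kx]; first by rewrite add0r.
case=> [->|ky]; first by rewrite addr0; right.
case: (eqVneq x 0) => [->|x0]; first by rewrite add0r; right.
case: (eqVneq y 0) => [->|y0]; first by rewrite addr0; right.
case: (eqVneq (x + y) 0) => [->|s0]; first by left.
by right; case: (placeD pv x0 y0 s0); apply: le_trans.
Qed.

Lemma val_geB k x y : val_ge k x -> val_ge k y -> val_ge k (x - y).
Proof. by move=> kx ky; apply: val_geD => //; apply: val_geN. Qed.

Lemma val_geX k x n : val_ge k x -> val_ge (k *+ n) (x ^+ n).
Proof.
move=> kx; elim: n => [|n IH]; first by apply: val_eq_ge; exact: val_eq1.
by rewrite exprS mulrS; apply: val_geM.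
Qed.

Lemma val_ge_nat n : val_ge 0 n%:R.
Proof.
elim: n => [|n IH]; first exact: val_ge0.
by rewrite -natr1; apply: val_geD => //; apply: val_eq_ge; exact: val_eq1.
Qed.

Lemma val_ge0M x y : val_ge 0 x -> val_ge 0 y -> val_ge 0 (x * y).
Proof. by move=> x0 y0; apply: (val_ge_mul x0 y0). Qed.

Lemma val_ge0X x n : val_ge 0 x -> val_ge 0 (x ^+ n).
Proof. by move=> x0; have := val_geX n x0; rewrite mul0rn. Qed.

Lemma val_ge01 : val_ge 0 1.
Proof. exact: val_eq_ge val_eq1. Qed.

Lemma val_eqD k x y : val_eq k x -> val_ge (k + 1) y -> val_eq k (x + y).
Proof.
move=> [x0 kx] ky.
have nge z : val_ge (k + 1) z -> z != x.
  move=> H; apply/eqP => E; rewrite E in H; case: H => [E0|].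
    by rewrite E0 eqxx in x0.
  by rewrite kx gerDl.
have s0 : x + y != 0.
  by rewrite addrC addr_eq0; apply/eqP => E; have := nge _ (val_geN ky); rewrite E opprK eqxx.
split=> //; apply/eqP; rewrite eq_le; apply/andP; split.
  rewrite leNgt; apply/negP => lt; have : val_ge (k + 1) (x + y - y).
    by apply: val_geB => //; right; rewrite lezD1.
  by rewrite addrK => /nge; rewrite eqxx.
case: (@val_geD k x y) => [||E|//]; first by right; rewrite kx.
  by apply: val_geW ky _; rewrite lerDl.
by rewrite E eqxx in s0.
Qed.

Lemma val_equ k x y : val_eq k x -> val_ge (k + 1) (y - x) -> val_eq k y.
Proof. by move=> kx H; rewrite -(subrK x y) addrC; apply: val_eqD. Qed.

Lemma val_unif : val_eq 1 q%:R.
Proof. by case: (place_unif pv). Qed.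

(** If n approximates x to order at least 2, then n + q does so to order exactly 1. Exactness is
    what later produces a valuation prime to 3 and a simple pole. *)
Lemma approx_to_order1 x : val_ge 0 x -> exists n : nat, val_eq 1 (n%:R - x).
Proof.
move=> vx; have [n nx] : exists n : nat, val_ge 1 (x - n%:R).
  case: (eqVneq x 0) => [->|x0].
    by exists 0%N; rewrite subr0; exact: val_ge0.
  case: vx => [E|vx]; first by rewrite E eqxx in x0.
  have [n [->|xn]] := place_residue pv x0 vx; exists n; last by right.
  by rewrite subrr; exact: val_ge0.
have [[E n1]|nn] := pselect (val_eq 1 (x - n%:R)).
  by exists n; rewrite -opprB; apply: val_eqN.
exists (n + q)%N; rewrite natrD [n%:R + _]addrC -addrA -opprB; apply: val_eqD.
  exact: val_unif.
apply: val_geN; case: nx => [->|nx]; first exact: val_ge0.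
case: (eqVneq (x - n%:R) 0) => [->|x0]; first exact: val_ge0.
right; rewrite lezD1 lt_neqAle nx andbT eq_sym; apply/eqP => E; apply: nn.
by split.
Qed.

Lemma val_ge_dvd n k : (q ^ k %| n)%N -> val_ge k%:Z n%:R.
Proof.
move=> /dvdnP[m ->]; rewrite natrM -[_%:Z]add0r; apply: val_geM; first exact: val_ge_nat.
by rewrite natrX; have := val_geX k (val_eq_ge val_unif); rewrite natz.
Qed.

Lemma val_eq_congr (n m : nat) x : val_eq 1 (m%:R - x) -> n = m %[mod q ^ 2] ->
  val_eq 1 (n%:R - x).
Proof.
move=> mx /eqP nm; apply: (val_equ mx).
rewrite opprB addrA subrK; case: (leqP m n) => le; last first.
  rewrite -opprB -natrB ?(ltnW le) //; apply: val_geN; apply: (@val_ge_dvd _ 2).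
  by rewrite -eqn_mod_dvd ?(ltnW le) // eq_sym.
by rewrite -natrB //; apply: (@val_ge_dvd _ 2); rewrite -eqn_mod_dvd.
Qed.

End PlaceTheory.

(** * Local obstructions to roots of the cubic and of the resolvent *)

Section Core.
Variables (F : fieldType) (q : nat) (v : F -> int) (a c : F) (w : nat).
Hypothesis pv : degree_one_place q v.
Notation val_eq := (val_eq v).
Notation val_ge := (val_ge v).

(* At a root x, z = (x + c om) / (x + c om^2) has a rational cube. *)
Lemma cubic_kummer om t x : om ^+ 2 + om + 1 = 0 ->
  abscissa_cubic c t x = 0 ->
  (x + c * om) ^+ 3 * (t + 3%:R * om ^+ 2) = (x + c * om ^+ 2) ^+ 3 * (t + 3%:R * om).
Proof.
move=> om2 hx; have E : om ^+ 2 = - 1 - om by apply/eqP; rewrite -subr_eq0 -om2; apply/eqP; ring.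
have e1 : (x + c * om) ^+ 3 = c * (t + 3%:R * om) * x * (x - c).
  rewrite -[RHS]addr0 -hx /abscissa_cubic; apply/eqP; rewrite -subr_eq0; apply/eqP.
  transitivity ((om ^+ 2 + om + 1) * (3%:R * x * c ^+ 2 + c ^+ 3 * (om - 1))).
    by ring.
  by rewrite om2 mul0r.
have e2 : (x + c * om ^+ 2) ^+ 3 = c * (t + 3%:R * om ^+ 2) * x * (x - c).
  rewrite -[RHS]addr0 -hx /abscissa_cubic E; apply/eqP; rewrite -subr_eq0; apply/eqP.
  transitivity ((om ^+ 2 + om + 1) * (3%:R * x * c ^+ 2 + c ^+ 3 * (- 1 - om - 1))).
    by ring.
  by rewrite om2 mul0r.
by rewrite e1 e2; ring.
Qed.

Definition kummer_num om : F := (1 + c * om) ^+ 3 + c * w%:R ^+ 2 * (a + c * om) ^+ 3.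

Lemma kummer_numE om : om ^+ 2 + om + 1 = 0 -> den_t a c w%:R != 0 ->
  (par_t a c w%:R + 3%:R * om) * den_t a c w%:R = - kummer_num om.
Proof.
move=> om2 nz; rewrite mulrDl /par_t divfK //.
apply/eqP; rewrite -subr_eq0; apply/eqP.
transitivity ((om ^+ 2 + om + 1) * (3%:R * c ^+ 2 + c ^+ 3 * (om - 1)
   + c * w%:R ^+ 2 * (3%:R * a * c ^+ 2 + c ^+ 3 * (om - 1)))).
  by rewrite /kummer_num /den_t /num0 /num2 /den0 /den2; ring.
by rewrite om2 mul0r.
Qed.

(** As a function of w, [kummer_num om] vanishes at g to first order, while [kummer_num (om ^+ 2)]
    is a unit there. At a root x the Kummer relation would give 3 v(x + c om) = 3 v(x + c om^2) +
    1. *)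
Lemma no_cubic_root om g x : 3%:R != 0 :> F -> om ^+ 2 + om + 1 = 0 -> c != 0 ->
  den_t a c w%:R != 0 ->
  val_eq 0 c -> val_eq 0 (2%:R * g) -> val_eq 0 (a + c * om) -> val_ge 0 (a + c * om ^+ 2) ->
  c * g ^+ 2 * (a + c * om) ^+ 3 = - (1 + c * om) ^+ 3 ->
  val_eq 0 ((1 + c * om ^+ 2) ^+ 3 + c * g ^+ 2 * (a + c * om ^+ 2) ^+ 3) ->
  val_eq 1 (w%:R - g) ->
  abscissa_cubic c (par_t a c w%:R) x != 0.
Proof.
move=> three0 om2 c0 nz vc vg vao vao2 gE vN wg; apply/eqP => hx.
have om2' : (om ^+ 2) ^+ 2 + om ^+ 2 + 1 = 0.
  transitivity ((om ^+ 2 + om + 1) * (om ^+ 2 - om + 1)); first by ring.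
  by rewrite om2 mul0r.
have vwg : val_eq 0 (w%:R + g).
  rewrite (_ : _ + _ = 2%:R * g + (w%:R - g)); last by ring.
  exact: (val_eqD pv vg (val_eq_ge wg)).
have v1 : val_eq 1 (kummer_num om).
  have -> : kummer_num om = c * (a + c * om) ^+ 3 * ((w%:R - g) * (w%:R + g)).
    rewrite /kummer_num -[(1 + _) ^+ 3]opprK -gE; ring.
  apply: (val_eq_mul pv (k := 0) (l := 1)) => //.
    by apply: (val_eq_mul pv vc (val_eqX pv 3 vao)).
  by apply: (val_eq_mul pv wg vwg).
have v2 : val_eq 0 (kummer_num (om ^+ 2)).
  have -> : kummer_num (om ^+ 2) =
     (1 + c * om ^+ 2) ^+ 3 + c * g ^+ 2 * (a + c * om ^+ 2) ^+ 3
     + c * ((w%:R - g) * (w%:R + g)) * (a + c * om ^+ 2) ^+ 3.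
    by rewrite /kummer_num; ring.
  apply: (val_eqD pv vN); apply: (val_ge_mul pv _ (val_geX pv 3 vao2)) (_ : 1 + 0 = _) => //.
  apply: (val_ge_mul pv (val_eq_ge vc)) (_ : 0 + 1 = _) => //.
  by apply: val_eq_ge; apply: (val_eq_mul pv wg vwg).
have K : (x + c * om) ^+ 3 * kummer_num (om ^+ 2) = (x + c * om ^+ 2) ^+ 3 * kummer_num om.
  apply: oppr_inj; rewrite -!mulrN -!kummer_numE // mulrA [RHS]mulrA; congr (_ * _).
  exact: cubic_kummer.
have x2 : x + c * om ^+ 2 != 0.
  apply/eqP => x2; move: K; rewrite x2 expr0n mul0r => /eqP.
  rewrite mulf_eq0 expf_eq0 /= (negPf v2.1) orbF => /eqP x1.
  have : c * (om ^+ 2 - om) = 0 by rewrite -(subrr 0) -{1}x2 -x1; ring.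
  move/eqP; rewrite mulf_eq0 (negPf c0) subr_eq0 /= => /eqP oo.
  have o0 : om != 0.
    by apply/eqP => o0; move/eqP: om2; rewrite o0 expr0n !add0r oner_eq0.
  have o1 : om = 1 by apply: (mulfI o0); rewrite mulr1 -expr2.
  by case/eqP: three0; rewrite -om2 o1; ring.
have x1 : x + c * om != 0.
  apply/eqP => x1; move: K; rewrite x1 expr0n mul0r => /esym/eqP.
  by rewrite mulf_eq0 expf_eq0 /= (negPf x2) (negPf v1.1).
have V1 := val_eqM pv (val_eqX pv 3 (conj x1 (erefl (v (x + c * om))))) v2.
have V2 := val_eqM pv (val_eqX pv 3 (conj x2 (erefl (v (x + c * om ^+ 2))))) v1.
rewrite K in V1; have := V1.2; rewrite V2.2 addr0.
by move: (v _) (v _) => m n; rewrite !mulrS mulr0n; lia.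
Qed.

Ltac integral pv := repeat first [ assumption | exact: (val_ge01 pv)
  | exact: (val_ge_nat pv) | apply: (val_geN pv) | apply: (val_geB pv)
  | apply: (val_geD pv) | apply: (val_ge0M pv) | apply: (val_ge0X pv) ].

(** Since w is near a simple pole of t, v(t) = -1, v(S) = -3, v(S') >= -3 and v(y) >= -1. As v(S) is
    odd, e^2 cannot cancel S, and (e^2 - S)^2 dominates the other terms: its valuation is -6 if v(e)
    >= -1, and 4 v(e) <= -8 otherwise. *)
Lemma no_resolvent_root g e :
  val_eq 0 c -> val_eq 0 (2%:R * g) -> val_ge 0 a -> val_eq 0 (den2 a c) ->
  den0 c + c * g ^+ 2 * den2 a c = 0 ->
  val_eq 0 (num0 c + c * g ^+ 2 * num2 a c) ->
  val_eq 1 (w%:R - g) ->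
  den_t a c w%:R != 0 /\ resolvent a c w%:R e != 0.
Proof.
move=> vc vg va vD gE vN wg; have gc := val_eq_ge vc; have gD := val_eq_ge vD.
have vwg : val_eq 0 (w%:R + g).
  rewrite (_ : _ + _ = 2%:R * g + (w%:R - g)); last by ring.
  exact: (val_eqD pv vg (val_eq_ge wg)).
have vw2 := val_eq_mul pv wg vwg (erefl (1 : int)).
have gA : val_ge 0 (num2 a c) by rewrite /num2; integral pv.
have vden : val_eq 1 (den_t a c w%:R).
  have -> : den_t a c w%:R = c * den2 a c * ((w%:R - g) * (w%:R + g)).
    rewrite /den_t -[LHS]subr0 -gE; ring.
  by apply: (val_eq_mul pv _ vw2) (_ : 0 + 1 = 1) => //; apply: (val_eq_mul pv vc vD).
split; first exact: vden.1.
have vnum : val_eq 0 (num0 c + c * w%:R ^+ 2 * num2 a c).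
  have -> : num0 c + c * w%:R ^+ 2 * num2 a c =
    num0 c + c * g ^+ 2 * num2 a c + ((w%:R - g) * (w%:R + g)) * (c * num2 a c) by ring.
  apply: (val_eqD pv vN); apply: (val_ge_mul pv (val_eq_ge vw2) _) (_ : 1 + 0 = _) => //.
  by integral pv.
set t := par_t a c w%:R.
have vt : val_eq (-1) t.
  by apply: (val_eq_mul pv (val_eqN pv vnum) (val_eqV pv vden)).
(* The terms are rewritten as a power of t times a polynomial in u = 1/t, which has valuation 1. *)
have vu := val_eqV pv vt; rewrite opprK in vu; set u := t^-1 in vu.
have gu : val_ge 0 u by apply: (val_ge_eq vu).
have t0 := vt.1.
have tu : t = u^-1 by rewrite /u invrK.
have u0 : u != 0 := vu.1.
have vt3 : val_eq (-3) (t ^+ 3) := val_eqX pv 3 vt.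
rewrite /resolvent -/t; set S := sum_f _ _ _ _; set S' := sum_ff _ _ _ _; set y := par_y _ _ _.
have vS : val_eq (-3) S.
  have -> : S = (c ^+ 3 + u * (- (3%:R * c ^+ 3 * (1 - 3%:R * u)) - 3%:R * c ^+ 3 * u ^+ 2
      - (1 + a) * (c ^+ 2 - 2%:R * c ^+ 2 * (1 - 3%:R * u) * u) + a * c * u)) * t ^+ 3.
    by rewrite /S /sum_f tu; field.
  apply: (val_eq_mul pv _ vt3) (_ : 0 - 3 = -3) => //.
  apply: (val_eqD pv (val_eqX pv 3 vc)).
  apply: (val_ge_mul pv (val_eq_ge vu) _) (_ : 1 + 0 = _) => //.
  by integral pv.
have vS' : val_ge (-3) S'.
  have -> : S' = (S' * u ^+ 3) * t ^+ 3 by rewrite tu; field.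
  apply: (val_ge_mul pv _ (val_eq_ge vt3)) (_ : 0 - 3 = -3) => //.
  have -> : S' * u ^+ 3 =
    let s1 := c in let s2 := c ^+ 2 * (1 - 3%:R * u) in let s3 := - c ^+ 3 * u in
    let p2 := s2 ^+ 2 - 2%:R * s1 * s3 in
    s2 ^+ 3 - 3%:R * s1 * s2 * s3 + 3%:R * s3 ^+ 2 * u
    - (1 + a) * (s1 * p2 - s2 * s3 * u) + a * (s1 ^+ 2 * s2 - 5%:R * s1 * s3 * u - 2%:R * p2 * u)
    + (1 + a) ^+ 2 * p2 * u - (1 + a) * a * (s1 * s2 - 3%:R * s3 * u) * u
    + a ^+ 2 * s2 * u ^+ 2.
    by rewrite /S' /sum_ff tu /=; field.
  by rewrite /=; integral pv.
have vy : val_ge (-1) y.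
  have -> : y = (c ^+ 2 * w%:R * (num2 a c * u + den2 a c)) * t.
    by rewrite /y /par_y -/t tu; field.
  apply: (val_ge_mul pv _ (val_eq_ge vt)) (_ : 0 - 1 = -1) => //.
  by integral pv.
have vSN := val_eqN pv vS.
have g8 := val_ge_nat pv 8; have g4 := val_ge_nat pv 4.
have vS4 : val_ge (-3) (4%:R * S') by apply: (val_ge_mul pv g4 vS').
have concl (k : int) : val_eq k ((e ^+ 2 - S) ^+ 2) -> val_ge (k + 1) (8%:R * e * y) ->
    k + 1 <= -3 -> (e ^+ 2 - S) ^+ 2 - 8%:R * e * y - 4%:R * S' != 0.
  move=> h1 h2 h3; suff [] : val_eq k ((e ^+ 2 - S) ^+ 2 - 8%:R * e * y - 4%:R * S') by [].
  apply: (val_eqD pv); last by apply: (val_geN pv); apply: (val_geW vS4).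
  by apply: (val_eqD pv h1); apply: (val_geN pv).
case: (pselect (val_ge (-1) e)) => [ge|nge].
  have e2 : val_ge (-2) (e ^+ 2) := val_geX pv 2 ge.
  have h : val_eq (-3) (e ^+ 2 - S) by rewrite addrC; apply: (val_eqD pv vSN).
  apply: (concl (-6) (val_eqX pv 2 h)) => //.
  by apply: (val_geW (val_geM pv (val_geM pv g8 ge) vy)).
have e0 : e != 0 by apply/eqP => e0; apply: nge; left.
have ve : v e <= -2.
  by rewrite leNgt; apply/negP => H; apply: nge; right; rewrite -lezD1 in H; move: H; lia.
have vek : val_eq (v e) e by [].
have h : val_eq (v e *+ 2) (e ^+ 2 - S).
  apply: (val_eqD pv (val_eqX pv 2 vek)); apply: (val_ge_eq vSN).
  by rewrite mulr2n; lia.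
apply: (concl _ (val_eqX pv 2 h)).
  apply: (val_geW (val_geM pv (val_geM pv g8 (val_eq_ge vek)) vy)).
  by rewrite !mulr2n; lia.
by rewrite !mulr2n; lia.
Qed.

End Core.

Lemma exists_good_c (F : fieldType) (a : F) : (forall n : nat, (n%:R == 0 :> F) = (n == 0%N)) ->
  a != 0 -> a != 1 -> exists c : nat, good_c a c%:R.
Proof.
move=> char0 a0 a1.
pose p : {poly F} := 'X * ('X - 1%:P) * ('X - a%:P) * ('X ^+ 2 - a *: 'X + (a ^+ 2)%:P)
  * ('X ^+ 2 - 'X + 1%:P) * ('X ^+ 2 - a *: 'X + a%:P) * ('X ^+ 2 - 'X + a%:P).
have quad (b d : F) : 'X ^+ 2 - b *: 'X + d%:P != 0.
  apply/eqP => /polyP/(_ 2%N); rewrite !coefE /= mulr0 subr0 addr0 => /eqP.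
  by rewrite oner_eq0.
have quad1 (d : F) : 'X ^+ 2 - 'X + d%:P != 0 by rewrite -[X in _ - X + _]scale1r.
have p0 : p != 0.
  by rewrite /p !mulf_neq0 ?polyX_eq0 ?polyXsubC_eq0 ?quad ?quad1.
have ui : injective (fun n : nat => n%:R : F).
  move=> i j; wlog le : i j / (i <= j)%N.
    by move=> W E; case/orP: (leq_total i j) => le; [|symmetry]; apply: W.
  move/eqP; rewrite eq_sym -subr_eq0 -natrB // char0 subn_eq0 => ji.
  by apply/eqP; rewrite eqn_leq le.
have [c] := nonroot_in_sequence ui p0; rewrite /p !hornerE !mulf_eq0 !negb_or !subr_eq0.
move=> /andP[/andP[/andP[/andP[/andP[/andP[c0 c1] ca] h1] h2] h3] h4].
by exists c; rewrite /good_c c0 c1 ca h1 h2 h3 h4.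
Qed.

(** As functions of w, [kummer_num om] vanishes at g1 and [den_t] at g2. The two places have
    distinct odd residue characteristics, so w can be prescribed modulo q1^2, q2^2 and 2^N together;
    squares are taken so that order exactly 1 is kept. *)
Lemma exists_parameter (M : fieldExtType rat) (a : M) (c N : nat) (om g1 g2 : M) :
  a != 0 -> a != 1 -> good_c a c%:R -> om ^+ 2 + om + 1 = 0 ->
  g1 ^+ 2 = - (1 + c%:R * om) ^+ 3 / (c%:R * (a + c%:R * om) ^+ 3) ->
  g2 ^+ 2 = - den0 c%:R / (c%:R * den2 a c%:R) ->
  exists w : nat, [/\ (2 ^ N %| w)%N, den_t a c%:R w%:R != 0,
    forall x, abscissa_cubic c%:R (par_t a c%:R w%:R) x != 0 &
    forall e, resolvent a c%:R w%:R e != 0].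
Proof.
move=> a0 a1 + om2; move: (c%:R) => {}c /and5P[c0 c1 ca h1 /and3P[h2 h3 h4]] g1E g2E.
have omE : om ^+ 2 = - 1 - om by apply/eqP; rewrite -subr_eq0 -om2; apply/eqP; ring.
have two0 : 2%:R != 0 :> M by rewrite fieldext_natr_eq0.
have three0 : 3%:R != 0 :> M by rewrite fieldext_natr_eq0.
have n1 : (1 + c * om) * (1 + c * om ^+ 2) = c ^+ 2 - c + 1.
  apply/eqP; rewrite -subr_eq0; apply/eqP.
  transitivity ((om ^+ 2 + om + 1) * (c + c ^+ 2 * (om - 1))); first by ring.
  by rewrite om2 mul0r.
have n2 : (a + c * om) * (a + c * om ^+ 2) = c ^+ 2 - a * c + a ^+ 2.
  apply/eqP; rewrite -subr_eq0; apply/eqP.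
  transitivity ((om ^+ 2 + om + 1) * (a * c + c ^+ 2 * (om - 1))); first by ring.
  by rewrite om2 mul0r.
have [k1 k1'] : 1 + c * om != 0 /\ 1 + c * om ^+ 2 != 0.
  by move: h2; rewrite -n1 mulf_eq0 negb_or => /andP[].
have [k2 k2'] : a + c * om != 0 /\ a + c * om ^+ 2 != 0.
  by move: h1; rewrite -n2 mulf_eq0 negb_or => /andP[].
have g1E' : c * g1 ^+ 2 * (a + c * om) ^+ 3 = - (1 + c * om) ^+ 3.
  by rewrite g1E; field; rewrite c0 k2.
have g10 : g1 != 0.
  apply/eqP => E; move/eqP: g1E'; rewrite E expr0n mulr0 mul0r eq_sym oppr_eq0.
  by rewrite expf_eq0 (negPf k1).
pose N2 := (1 + c * om ^+ 2) ^+ 3 + c * g1 ^+ 2 * (a + c * om ^+ 2) ^+ 3.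
(* N2 is [kummer_num (om ^+ 2)] at w = g1. Multiplied by (a + c om)^3 it becomes a difference of
   cubes X^3 - Y^3, whose three linear factors are nonzero by [good_c]. *)
have N20 : N2 != 0.
  have : N2 * (a + c * om) ^+ 3 = 3%:R * (om - om ^+ 2) * c * (1 - a) * (c ^+ 2 - a * c + a) *
      (c ^+ 2 - c + a).
    transitivity (((1 + c * om ^+ 2) * (a + c * om)) ^+ 3
      + (c * g1 ^+ 2 * (a + c * om) ^+ 3) * (a + c * om ^+ 2) ^+ 3); first by rewrite /N2; ring.
    rewrite g1E' mulNr -exprMn.
    set X := _ * (a + c * om); set Y := (1 + c * om) * _.
    have -> : X ^+ 3 - Y ^+ 3 = (X - Y) * (X - om * Y) * (X - om ^+ 2 * Y).
      apply/eqP; rewrite -subr_eq0; apply/eqP.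
      transitivity ((om ^+ 2 + om + 1) * (X ^+ 2 * Y - om * X * Y ^+ 2 + (om - 1) * Y ^+ 3)).
        by ring.
      by rewrite om2 mul0r.
    have om3 : om ^+ 3 = 1.
      apply/eqP; rewrite -subr_eq0; apply/eqP.
      by transitivity ((om ^+ 2 + om + 1) * (om - 1)); [ring | rewrite om2 mul0r].
    have -> : X - Y = c * (om - om ^+ 2) * (1 - a) by rewrite /X /Y; ring.
    have -> : X - om * Y = (1 - om) * (c ^+ 2 - c + a).
      transitivity (a * (1 - om) + c * (om - om ^+ 3) + c ^+ 2 * om ^+ 3 * (1 - om)).
        by rewrite /X /Y; ring.
      by rewrite om3; ring.
    have -> : X - om ^+ 2 * Y = (1 - om ^+ 2) * (c ^+ 2 - a * c + a).
      transitivity (a * (1 - om ^+ 2) + c * (om - om * om ^+ 3) + a * c * (om ^+ 2 - om ^+ 3)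
        + c ^+ 2 * (om ^+ 3 - om ^+ 2 * om ^+ 3)); first by rewrite /X /Y; ring.
      by rewrite om3; ring.
    have om6 : (1 - om) * (1 - om ^+ 2) = 3%:R.
      transitivity (1 - om - om ^+ 2 + om ^+ 3); first by ring.
      by rewrite om3 omE; ring.
    by rewrite -om6; ring.
  move=> E; apply/eqP => N20; move/eqP: E; rewrite N20 mul0r eq_sym.
  rewrite !mulf_eq0 (negPf three0) (negPf c0) (negPf h3) (negPf h4) subr_eq0 subr_eq0.
  rewrite [1 == a]eq_sym (negPf a1) !orbF /= => /eqP oo.
  have o0 : om != 0.
    by apply/eqP => o0; move/eqP: om2; rewrite o0 expr0n !add0r oner_eq0.
  have o1 : om = 1 by apply: (mulfI o0); rewrite mulr1 -expr2.
  by case/eqP: three0; rewrite -om2 o1; ring.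
have D0 : den2 a c != 0 by rewrite /den2 !mulf_neq0 // subr_eq0.
have g2E' : den0 c + c * g2 ^+ 2 * den2 a c = 0 by rewrite g2E; field; rewrite c0 D0.
have g20 : g2 != 0.
  apply/eqP => E; move/eqP: g2E'; rewrite E expr0n mulr0 mul0r addr0.
  by rewrite /den0 mulf_eq0 subr_eq0 (negPf c0) (negPf c1).
pose A2 := num0 c + c * g2 ^+ 2 * num2 a c.
(* A2 is, up to sign, the numerator of t at its pole g2; times [den2] it is the determinant of the
   Moebius map. *)
have A20 : A2 != 0.
  have : A2 * den2 a c = c * (a - 1) * (c ^+ 2 - a * c + a) * (c ^+ 2 - c + a).
    have gD : c * g2 ^+ 2 * den2 a c = - den0 c.
      by apply/eqP; rewrite -addr_eq0 addrC g2E'.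
    transitivity (num0 c * den2 a c + num2 a c * (c * g2 ^+ 2 * den2 a c)).
      by rewrite /A2; ring.
    by rewrite gD -num_den_det; ring.
  move=> E; apply/eqP => A20; move/eqP: E; rewrite A20 mul0r eq_sym.
  by rewrite !mulf_eq0 (negPf c0) (negPf h3) (negPf h4) subr_eq0 (negPf a1).
have tg1 : 2%:R * g1 != 0 by rewrite mulf_neq0.
have tg2 : 2%:R * g2 != 0 by rewrite mulf_neq0.
have [q1 [v1 [pv1 q1N v1S]]] :=
  @exists_place M [:: c; 2%:R * g1; g1; a + c * om; a + c * om ^+ 2; N2] 2 isT.
have q10 : (0 < q1)%N by rewrite prime_gt0 ?(place_prime pv1).
have q120 : (0 < 2 * q1)%N by rewrite muln_gt0.
have [q2 [v2 [pv2 q2N v2S]]] :=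
  @exists_place M [:: c; 2%:R * g2; g2; a; den2 a c; A2] (2 * q1) q120.
have q20 : (0 < q2)%N by rewrite prime_gt0 ?(place_prime pv2).
have vu1 x : x \in [:: c; 2%:R * g1; g1; a + c * om; a + c * om ^+ 2; N2] -> x != 0 ->
  val_eq v1 0 x by move=> xS x0; split=> //; apply: v1S.
have vu2 x : x \in [:: c; 2%:R * g2; g2; a; den2 a c; A2] -> x != 0 ->
  val_eq v2 0 x by move=> xS x0; split=> //; apply: v2S.
have [m1 m1g] : exists m : nat, val_eq v1 1 (m%:R - g1).
  by apply: (approx_to_order1 pv1); apply: val_eq_ge; apply: vu1; rewrite // !inE eqxx ?orbT.
have [m2 m2g] : exists m : nat, val_eq v2 1 (m%:R - g2).
  by apply: (approx_to_order1 pv2); apply: val_eq_ge; apply: vu2; rewrite // !inE eqxx ?orbT.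
have co12 : coprime (q1 ^ 2) (q2 ^ 2).
  rewrite coprimeXl // coprimeXr // coprime_sym prime_coprime ?(place_prime pv2) //.
  by apply: contra q2N; apply: dvdn_mull.
have co2 : coprime (q1 ^ 2 * q2 ^ 2) (2 ^ N).
  rewrite coprimeMl; apply/andP; split; apply: coprimeXr; apply: coprimeXl.
    by rewrite prime_coprime ?(place_prime pv1).
  rewrite prime_coprime ?(place_prime pv2) //; apply: contra q2N => H; exact: dvdn_mulr.
pose w := chinese (q1 ^ 2 * q2 ^ 2) (2 ^ N) (chinese (q1 ^ 2) (q2 ^ 2) m1 m2) 0.
have w12 : w = chinese (q1 ^ 2) (q2 ^ 2) m1 m2 %[mod q1 ^ 2 * q2 ^ 2] by apply: chinese_modl.
have w1 : w = m1 %[mod q1 ^ 2].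
  rewrite -(chinese_modl co12 m1 m2) -(modn_dvdm _ (dvdn_mulr (q2 ^ 2) (dvdnn (q1 ^ 2)))) w12.
  by rewrite modn_dvdm // dvdn_mulr.
have w2 : w = m2 %[mod q2 ^ 2].
  rewrite -(chinese_modr co12 m1 m2) -(modn_dvdm _ (dvdn_mull (q1 ^ 2) (dvdnn (q2 ^ 2)))) w12.
  by rewrite modn_dvdm // dvdn_mull.
have wg1 := val_eq_congr pv1 m1g w1; have wg2 := val_eq_congr pv2 m2g w2.
have main2 e : den_t a c w%:R != 0 /\ resolvent a c w%:R e != 0.
  apply: (no_resolvent_root pv2 e _ _ _ _ g2E' _ wg2).
  - by apply: vu2; rewrite // !inE eqxx ?orbT.
  - by apply: vu2; rewrite // !inE eqxx ?orbT.
  - by apply: val_eq_ge; apply: vu2; rewrite // !inE eqxx ?orbT.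
  - by apply: vu2; rewrite // !inE eqxx ?orbT.
  - by apply: vu2; rewrite // !inE eqxx ?orbT.
have [nz _] := main2 0.
exists w; split=> //; last by move=> e; case: (main2 e).
  by rewrite /dvdn (chinese_modr co2) mod0n.
move=> x; apply: (no_cubic_root pv1 x three0 om2 c0 nz _ _ _ _ g1E' _ wg1).
- by apply: vu1; rewrite // !inE eqxx ?orbT.
- by apply: vu1; rewrite // !inE eqxx ?orbT.
- by apply: vu1; rewrite // !inE eqxx ?orbT.
- by apply: val_eq_ge; apply: vu1; rewrite // !inE eqxx ?orbT.
- by apply: vu1; rewrite // !inE eqxx ?orbT.
Qed.

(** * Independence of the twelve monomials *)

Section Multiquadratic.
Variables (F : fieldType) (E : set F).
Hypothesis two0 : 2%:R != 0 :> F.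
Hypotheses (E1 : E 1) (EB : forall x y, E x -> E y -> E (x - y)).
Hypotheses (EM : forall x y, E x -> E y -> E (x * y)) (EV : forall x, E x -> E x^-1).

Let E0 : E 0. Proof. by rewrite -(subrr 1); apply: (EB). Qed.
Let EN x : E x -> E (- x). Proof. by move=> Ex; rewrite -sub0r; apply: (EB). Qed.
Let ED x y : E x -> E y -> E (x + y).
Proof. by move=> Ex Ey; rewrite -(opprK y); apply: (EB) => //; apply: EN. Qed.

Let E2 x : E x -> E (x ^+ 2). Proof. by move=> Ex; rewrite expr2; apply: (EM). Qed.

Let kummer1 g u w : ~ E g -> E u -> E w -> u + w * g = 0 -> u = 0 /\ w = 0.
Proof.
move=> nEg Eu Ew E0'; case: (eqVneq w 0) => [w0|w0].
  by move: E0'; rewrite w0 mul0r addr0.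
case: nEg; have -> : g = - u / w.
  by apply: (mulIf w0); rewrite divfK // mulrC; apply/eqP; rewrite -addr_eq0 addrC E0'.
by apply: (EM); [exact: EN | exact: EV].
Qed.

(* The square classes of [g1], [g2], [g3] generate a group of order 4. *)
Lemma biquadratic_free (g1 g2 g3 u0 u1 u2 u3 : F) :
  ~ E g1 -> ~ E g2 -> ~ E g3 -> E (g1 ^+ 2) -> E (g2 ^+ 2) -> E (g3 ^+ 2) ->
  E (g1 * g2 * g3) -> E u0 -> E u1 -> E u2 -> E u3 ->
  u0 + u1 * g1 + u2 * g2 + u3 * g3 = 0 -> [/\ u0 = 0, u1 = 0, u2 = 0 & u3 = 0].
Proof.
(* The relation is multiplied by w0 + w1 h1 - w2 h2 - w3 h3. As h2 h3 is an element of E times h1,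
   the result lies in E + E h1, and its coefficient of h1 must vanish. *)
have key h1 h2 h3 w0 w1 w2 w3 : ~ E h1 -> h1 != 0 -> E (h1 ^+ 2) -> E (h2 ^+ 2) -> E (h3 ^+ 2) ->
    E (h1 * h2 * h3) -> E w0 -> E w1 -> E w2 -> E w3 ->
    w0 + w1 * h1 + w2 * h2 + w3 * h3 = 0 -> w0 * w1 * h1 ^+ 2 = w2 * w3 * (h1 * h2 * h3).
  move=> n1 h10 s1 s2 s3 Ep e0 e1 e2 e3 R.
  have : (w0 ^+ 2 + w1 ^+ 2 * h1 ^+ 2 - w2 ^+ 2 * h2 ^+ 2 - w3 ^+ 2 * h3 ^+ 2)
      + (2%:R * (w0 * w1 - w2 * w3 * (h1 * h2 * h3) / h1 ^+ 2)) * h1 = 0.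
    transitivity ((w0 + w1 * h1 + w2 * h2 + w3 * h3) * (w0 + w1 * h1 - w2 * h2 - w3 * h3)).
      by field.
    by rewrite R mul0r.
  move/kummer1 => -[] //.
  - by repeat first [done | apply: E2 | apply: (EB) | apply: ED | apply: (EM)].
  - have Etwo : E 2%:R by rewrite -[2%:R]/(1 + 1); apply: ED.
    by repeat first [done | apply: (EB) | apply: EV | apply: (EM)].
  move=> _ /eqP; rewrite mulf_eq0 (negPf two0) subr_eq0 /= => /eqP ->.
  by rewrite divfK ?expf_neq0.
move=> n1 n2 n3 s1 s2 s3 Ep e0 e1 e2 e3 R.
have nz g : ~ E g -> g != 0 by move=> ng; apply/eqP => g0; apply: ng; rewrite g0.
have [z1 z2 z3] := And3 (nz _ n1) (nz _ n2) (nz _ n3).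
set y := g1 * g2 * g3 in Ep.
have y2 : y ^+ 2 = g1 ^+ 2 * g2 ^+ 2 * g3 ^+ 2 by rewrite /y; ring.
have K1 : u0 * u1 * g1 ^+ 2 = u2 * u3 * y := key _ _ _ _ _ _ _ n1 z1 s1 s2 s3 Ep e0 e1 e2 e3 R.
have K2 : u0 * u2 * g2 ^+ 2 = u1 * u3 * y.
  rewrite (_ : y = g2 * g1 * g3); last by rewrite /y; ring.
  apply: (key g2 g1 g3 u0 u2 u1 u3) => //; last by rewrite -[RHS]R; ring.
  by rewrite (_ : g2 * g1 * g3 = y) //; rewrite /y; ring.
have K3 : u0 * u3 * g3 ^+ 2 = u1 * u2 * y.
  rewrite (_ : y = g3 * g1 * g2); last by rewrite /y; ring.
  apply: (key g3 g1 g2 u0 u3 u1 u2) => //; last by rewrite -[RHS]R; ring.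
  by rewrite (_ : g3 * g1 * g2 = y) //; rewrite /y; ring.
have y0 : y != 0 by rewrite /y !mulf_neq0.
(* If u w <> 0, multiplying the first two relations gives u0^2 = r^2 h3^2. As h3 is not in E this
   forces r = 0, against the third relation. *)
have Z u w r h1 h2 h3 : ~ E h3 -> h1 != 0 -> h2 != 0 -> E r -> y ^+ 2 = h1 ^+ 2 * h2 ^+ 2 * h3 ^+ 2 ->
    u0 * u * h1 ^+ 2 = w * r * y -> u0 * w * h2 ^+ 2 = u * r * y ->
    u0 * r * h3 ^+ 2 = u * w * y -> u * w = 0.
  move=> nh3 h10 h20 Er yE k1 k2 k3; apply/eqP/negPn/negP => uw.
  have : (u * w * h1 ^+ 2 * h2 ^+ 2) * ((u0 - r * h3) * (u0 + r * h3)) = 0.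
    transitivity ((u0 * u * h1 ^+ 2) * (u0 * w * h2 ^+ 2)
      - u * w * r ^+ 2 * (h1 ^+ 2 * h2 ^+ 2 * h3 ^+ 2)); first by ring.
    by rewrite k1 k2 -yE; ring.
  have nzz : u * w * h1 ^+ 2 * h2 ^+ 2 != 0 by do 2!(apply: mulf_neq0; last exact: expf_neq0).
  move/eqP; rewrite mulf_eq0 (negPf nzz) mulf_eq0 /= => H.
  suff r0 : r = 0 by move/eqP: k3; rewrite r0 mulr0 mul0r eq_sym mulf_eq0 (negPf uw) (negPf y0).
  move: H => /orP[/eqP H|/eqP H]; last by case: (kummer1 nh3 e0 Er H).
  have H' : u0 + (- r) * h3 = 0 by rewrite mulNr.
  by case: (kummer1 nh3 e0 (EN Er) H') => _ /eqP; rewrite oppr_eq0 => /eqP.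
have u12 : u1 * u2 = 0 by apply: (Z u1 u2 u3 g1 g2 g3).
have u13 : u1 * u3 = 0.
  by apply: (Z u1 u3 u2 g1 g3 g2); rewrite // ?y2 ?K1 ?K3 ?K2 //; ring.
have u23 : u2 * u3 = 0.
  by apply: (Z u2 u3 u1 g2 g3 g1); rewrite // ?y2 ?K1 ?K3 ?K2 //; ring.
have one (u g : F) : u * g ^+ 2 = 0 -> g != 0 -> u = 0.
  by move=> ug g0; apply: (mulIf (expf_neq0 2 g0)); rewrite ug mul0r.
have u01 : u0 * u1 = 0 by apply: (one _ g1) => //; rewrite K1 u23 mul0r.
have u02 : u0 * u2 = 0 by apply: (one _ g2) => //; rewrite K2 u13 mul0r.
have u03 : u0 * u3 = 0 by apply: (one _ g3) => //; rewrite K3 u12 mul0r.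
have z (u w : F) : u * w = 0 -> u = 0 \/ w = 0.
  by move/eqP; rewrite mulf_eq0 => /orP[] /eqP ->; [left | right].
have u1z : u1 = 0.
  case: (z _ _ u12) => // E2z; case: (z _ _ u13) => // E3z; case: (z _ _ u01) => // E0z.
  by case: (kummer1 n1 e0 e1) => //; rewrite -[RHS]R E2z E3z !mul0r !addr0.
have u2z : u2 = 0.
  case: (z _ _ u23) => // E3z; case: (z _ _ u02) => // E0z.
  by case: (kummer1 n2 e0 e2) => //; rewrite -[RHS]R u1z E3z !mul0r !addr0.
case: (@kummer1 g3 u0 u3) => //.
by rewrite -[RHS]R u1z u2z !mul0r !addr0.
Qed.
End Multiquadratic.

Section SimpleExtension.
Variables (M Om : fieldType) (j : {rmorphism M -> Om}) (h : {poly M}) (x : Om).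
Hypotheses (irr : irreducible_poly h) (hx : root (map_poly j h) x).

Definition simple_ext : set Om := [set z | exists p, z = (map_poly j p).[x]].

Lemma dvdp_vanish p : (map_poly j p).[x] = 0 -> h %| p.
Proof.
move=> px; apply: contraT; rewrite -irreducible_poly_coprime // => co.
have : coprimep (map_poly j h) (map_poly j p) by rewrite coprimep_map.
by move=> /coprimep_root /(_ hx); rewrite px eqxx.
Qed.

Lemma simple_ext1 : simple_ext 1.
Proof. by exists 1; rewrite rmorph1 hornerC. Qed.

Lemma simple_extC y : simple_ext (j y).
Proof. by exists y%:P; rewrite map_polyC hornerC. Qed.

Lemma simple_extX : simple_ext x.
Proof. by exists 'X; rewrite map_polyX hornerX. Qed.

Lemma simple_extB u w : simple_ext u -> simple_ext w -> simple_ext (u - w).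
Proof. by move=> [p ->] [r ->]; exists (p - r); rewrite rmorphB !hornerE. Qed.

Lemma simple_extM u w : simple_ext u -> simple_ext w -> simple_ext (u * w).
Proof. by move=> [p ->] [r ->]; exists (p * r); rewrite rmorphM hornerM. Qed.

Lemma simple_extV u : simple_ext u -> simple_ext u^-1.
Proof.
move=> [p ->]; case: (eqVneq (map_poly j p).[x] 0) => [->|nz].
  by exists 0; rewrite invr0 rmorph0 horner0.
have co : coprimep h p.
  rewrite irreducible_poly_coprime //; apply: contra nz => /dvdpP[r ->].
  by rewrite rmorphM hornerM (rootP hx) mulr0.
have [[r s] /= E] := Bezout_eq1_coprimepP _ _ co.
exists s; apply: (mulIf nz); rewrite mulVf //.
have := congr1 (fun p => (map_poly j p).[x]) E.
by rewrite rmorphD !rmorphM rmorph1 hornerD !hornerM (rootP hx) mulr0 add0r hornerC.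
Qed.

End SimpleExtension.

Section CubicField.
Variables (M Om : fieldType) (j : {rmorphism M -> Om}) (a c w : M).
Notation t := (par_t a c w).
Hypothesis nz : den_t a c w != 0.
Hypotheses (no_root : forall x, abscissa_cubic c t x != 0).
Hypotheses (no_res : forall e, resolvent a c w e != 0).

Definition cubic_poly : {poly M} :=
  'X^3 - (c * t) *: 'X^2 + (c ^+ 2 * (t - 3%:R)) *: 'X + (c ^+ 3)%:P.

Lemma horner_cubic x : cubic_poly.[x] = abscissa_cubic c t x.
Proof. by rewrite /cubic_poly /abscissa_cubic !hornerE. Qed.

Lemma size_cubic : size cubic_poly = 4%N.
Proof.
rewrite /cubic_poly -addrA -addrA size_polyDl ?size_polyXn //.
rewrite -[(_ * _) *: 'X^2]mul_polyC -[_ *: 'X]mul_polyC.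
rewrite (leq_ltn_trans (size_polyD _ _)) // gtn_max size_polyN.
rewrite (leq_ltn_trans (size_polyMleq _ _)); last first.
  by rewrite size_polyXn addn3 /= !ltnS size_polyC_leq1.
rewrite (leq_ltn_trans (size_polyD _ _)) // gtn_max (leq_ltn_trans (size_polyC_leq1 _)) // andbT.
rewrite (leq_ltn_trans (size_polyMleq _ _)) // size_polyX addn2 /=.
by rewrite !ltnS (leq_trans (size_polyC_leq1 _)).
Qed.

Lemma cubic_irr : irreducible_poly cubic_poly.
Proof.
apply: cubic_irreducible; first by rewrite size_cubic.
by move=> x; rewrite /root horner_cubic.
Qed.

Definition cubic_roots (x1 x2 x3 : Om) : Prop :=
  [/\ x1 + x2 + x3 = j (c * t), x1 * x2 + x1 * x3 + x2 * x3 = j (c ^+ 2 * (t - 3%:R)) &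
      x1 * x2 * x3 = j (- c ^+ 3)].

Lemma cubic_rootsC x1 x2 x3 : cubic_roots x1 x2 x3 -> cubic_roots x2 x3 x1.
Proof. by move=> [e1 e2 e3]; split; rewrite -?e1 -?e2 -?e3; ring. Qed.

Variables x1 x2 x3 : Om.
Hypothesis xs : cubic_roots x1 x2 x3.

Lemma map_cubic : map_poly j cubic_poly = ('X - x1%:P) * ('X - x2%:P) * ('X - x3%:P).
Proof.
case: xs => e1 e2 e3; rewrite /cubic_poly !rmorphD rmorphN /= !map_polyZ !map_polyXn map_polyX.
rewrite map_polyC /= -e1 -e2 (_ : j (c ^+ 3) = - (x1 * x2 * x3)); last by rewrite e3 rmorphN opprK.
by rewrite -!mul_polyC !(polyCD, polyCM, polyCN); ring.
Qed.

Lemma cubic_root_mem : root (map_poly j cubic_poly) x1.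
Proof. by rewrite map_cubic /root !hornerE subrr !mul0r. Qed.

Lemma prod_f : let f x := x * (x - 1) * (x - j a) in
  f x1 * f x2 * f x3 = j (par_y a c w) ^+ 2.
Proof.
have ev z : (z - x1) * (z - x2) * (z - x3) = (map_poly j cubic_poly).[z].
  by rewrite map_cubic !hornerE.
rewrite /= -rmorphXn -par_y_sqr //.
transitivity (x1 * x2 * x3 * ((1 - x1) * (1 - x2) * (1 - x3)) *
   ((j a - x1) * (j a - x2) * (j a - x3))); first by ring.
rewrite !ev -{1}(rmorph1 j) !horner_map !horner_cubic /=; case: xs => _ _ ->.
rewrite -!rmorphM /abscissa_cubic /num0 /den0 /num2 /den2 /=; congr (j _); ring.
Qed.

(** By irreducibility the same p would give square roots of all f(x_i). Their sum e0 is symmetric in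
    the roots, hence in M, and their product is y or -y, so e0 or -e0 would be a root of the
    resolvent. *)
Lemma nonsquare_f (p : {poly M}) : (map_poly j p).[x1] ^+ 2 <> x1 * (x1 - 1) * (x1 - j a).
Proof.
move=> sq; pose r := p %% cubic_poly; pose m x := (map_poly j r).[x].
have pm x : root (map_poly j cubic_poly) x -> (map_poly j p).[x] = m x.
  move=> hx; rewrite {1}(divp_eq p cubic_poly) rmorphD rmorphM hornerD hornerM (rootP hx).
  by rewrite mulr0 add0r.
have rt x : x \in [:: x1; x2; x3] -> root (map_poly j cubic_poly) x.
  rewrite !inE map_cubic /root => /or3P H.
  by case: H => /eqP->; rewrite !hornerE subrr ?mul0r ?mulr0 ?mul0r.
have all_sq x : x \in [:: x1; x2; x3] -> m x ^+ 2 = x * (x - 1) * (x - j a).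
  move=> xin; have dv : cubic_poly %| p ^+ 2 - 'X * ('X - 1%:P) * ('X - a%:P).
    apply: (dvdp_vanish cubic_irr cubic_root_mem).
    rewrite rmorphB rmorphXn !rmorphM !rmorphB /= map_polyX !map_polyC /= !hornerE sq rmorph1.
    by rewrite subrr.
  have [s E] := dvdpP _ _ dv; have := congr1 (fun p => (map_poly j p).[x]) E.
  rewrite rmorphB rmorphXn !rmorphM !rmorphB /= map_polyX !map_polyC /= !hornerE rmorph1.
  by rewrite (rootP (rt x xin)) mulr0 (pm _ (rt x xin)) => /eqP; rewrite subr_eq0 => /eqP.
have sr : (size r <= 3)%N by rewrite -ltnS -size_cubic ltn_modp -size_poly_gt0 size_cubic.
have mE x : m x = j r`_0 + j r`_1 * x + j r`_2 * x ^+ 2.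
  rewrite /m (@horner_coef_wide _ 3) ?(leq_trans (size_poly _ _)) //.
  by rewrite !big_ord_recl big_ord0 /= !coef_map expr0 mulr1 expr1 addr0 addrA.
have f1 : m x1 ^+ 2 = x1 * (x1 - 1) * (x1 - j a) by apply: all_sq; rewrite !inE eqxx.
have f2 : m x2 ^+ 2 = x2 * (x2 - 1) * (x2 - j a) by apply: all_sq; rewrite !inE eqxx orbT.
have f3 : m x3 ^+ 2 = x3 * (x3 - 1) * (x3 - j a) by apply: all_sq; rewrite !inE eqxx !orbT.
have [e0 eE] : exists e, m x1 + m x2 + m x3 = j e.
  case: xs => E1 E2 _.
  (* The coefficients 3, s1 and s1^2 - 2 s2 are the power sums of the roots in degrees 0, 1 and
     2. *)
  exists (3%:R * r`_0 + r`_1 * (c * t) + r`_2 * ((c * t) ^+ 2 - 2%:R * (c ^+ 2 * (t - 3%:R)))).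
  move: (c * t) (c ^+ 2 * _) E1 E2 => s1 s2 E1 E2.
  rewrite !mE !(rmorph_nat, rmorphD, rmorphN, rmorphM, rmorphXn) /= -E1 -E2.
  by ring.
have sfE : m x1 ^+ 2 + m x2 ^+ 2 + m x3 ^+ 2 =
    j (sum_f a (c * t) (c ^+ 2 * (t - 3%:R)) (- c ^+ 3)).
  case: xs => E1 E2 E3; rewrite f1 f2 f3 (sum_fE (j a)) E1 E2 E3.
  by rewrite /sum_f !(rmorph_nat, rmorphD, rmorphN, rmorphM, rmorphXn, rmorph1).
have sffE : m x1 ^+ 2 * m x2 ^+ 2 + m x1 ^+ 2 * m x3 ^+ 2 + m x2 ^+ 2 * m x3 ^+ 2 =
    j (sum_ff a (c * t) (c ^+ 2 * (t - 3%:R)) (- c ^+ 3)).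
  case: xs => E1 E2 E3; rewrite f1 f2 f3 (sum_ffE (j a)) E1 E2 E3.
  by rewrite /sum_ff /= !(rmorph_nat, rmorphD, rmorphN, rmorphM, rmorphXn, rmorph1).
have yE : (m x1 * m x2 * m x3) ^+ 2 = j (par_y a c w) ^+ 2.
  by rewrite -prod_f /= -f1 -f2 -f3; ring.
have nres e : (e ^+ 2 - sum_f a (c * t) (c ^+ 2 * (t - 3%:R)) (- c ^+ 3)) ^+ 2
    - 8%:R * e * par_y a c w
    - 4%:R * sum_ff a (c * t) (c ^+ 2 * (t - 3%:R)) (- c ^+ 3) != 0 := no_res e.
move: (sum_f _ _ _ _) sfE (sum_ff _ _ _ _) sffE (par_y a c w) yE nres.
move=> S sfE S' sffE y yE nres.
have res (e : M) : j e ^+ 2 = j e0 ^+ 2 -> j e * j y = j e0 * (m x1 * m x2 * m x3) -> False.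
  move=> e2 ey; have /eqP := nres e; apply; apply: (fmorph_inj j).
  rewrite rmorph0 !(rmorph_nat, rmorphD, rmorphN, rmorphXn, rmorphM) /= e2 -sfE -sffE.
  by rewrite -[8%:R * j e * _]mulrA ey -eE; ring.
have /eqP := yE; rewrite -subr_eq0 subr_sqr mulf_eq0 subr_eq0 addr_eq0 => /orP[] /eqP E.
  by apply: (res e0); rewrite ?E.
by apply: (res (- e0)); rewrite ?E rmorphN ?sqrrN // mulNr mulrN.
Qed.

End CubicField.

(** Here y = rho(x) and z = rho(rho(x)). Solving the cubic for t gives (x + y + z) / c, which is
    invariant under rho; this is the origin of the family. *)
Lemma cubic_orbit (F : fieldType) (c t x : F) : c != 0 -> abscissa_cubic c t x = 0 ->
  let y := c * (x - c) / x in let z := c ^+ 2 / (c - x) in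
  [/\ x != 0, c - x != 0, x + y + z = c * t,
      x * y + x * z + y * z = c ^+ 2 * (t - 3%:R) & x * y * z = - c ^+ 3].
Proof.
move=> c0 hx y z.
have x0 : x != 0.
  apply/eqP => x0; move/eqP: hx; rewrite /abscissa_cubic x0 !expr0n /= !mulr0 subr0 !add0r.
  by rewrite expf_eq0 (negPf c0).
have xc : c - x != 0.
  rewrite subr_eq0; apply/eqP => xc; have := expf_neq0 3 c0.
  by rewrite -oppr_eq0 -hx /abscissa_cubic -xc -subr_eq0 => /eqP[]; ring.
have tE : t = (x ^+ 3 - 3%:R * c ^+ 2 * x + c ^+ 3) / (c * x * (x - c)).
  have nz : c * x * (x - c) != 0 by rewrite !mulf_neq0 // -opprB oppr_eq0.
  apply: (mulIf nz); rewrite divfK // -[RHS]subr0 -hx /abscissa_cubic; ring.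
have xc' : x - c != 0 by rewrite -opprB oppr_eq0.
by split=> //; rewrite /y /z ?tE; field; rewrite ?x0 ?xc ?xc' ?c0.
Qed.

Section Monomials.
Variables (M Om : fieldType) (j : {rmorphism M -> Om}) (a c w : M).
Notation t := (par_t a c w).
Hypotheses (two0 : 2%:R != 0 :> Om) (nz : den_t a c w != 0).
Hypotheses (no_root : forall x, abscissa_cubic c t x != 0).
Hypotheses (no_res : forall e, resolvent a c w e != 0).
Variables x1 x2 x3 g1 g2 g3 : Om.
Hypothesis xs : cubic_roots j a c w x1 x2 x3.
Hypotheses (x2E : x2 = j c * (x1 - j c) / x1) (x3E : x3 = j c * (x2 - j c) / x2).
Hypothesis x1E : x1 = j c * (x3 - j c) / x3.
Hypotheses (g1E : g1 ^+ 2 = x1 * (x1 - 1) * (x1 - j a)) (g2E : g2 ^+ 2 = x2 * (x2 - 1) * (x2 - j a)).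
Hypotheses (g3E : g3 ^+ 2 = x3 * (x3 - 1) * (x3 - j a)) (gE : g1 * g2 * g3 = j (par_y a c w)).

Let irr := cubic_irr no_root.

Lemma simple_ext_trans x y z : simple_ext j x y -> simple_ext j y z -> simple_ext j x z.
Proof. by move=> [p ->] [q ->]; exists (q \Po p); rewrite map_comp_poly horner_comp. Qed.

Let moebius x : root (map_poly j (cubic_poly a c w)) x -> simple_ext j x (j c * (x - j c) / x).
Proof.
move=> hx; apply: simple_extM.
  by apply: simple_extM; [apply: simple_extC | apply: simple_extB; [apply: simple_extX | apply: simple_extC]].
by apply: (simple_extV irr hx); apply: simple_extX.
Qed.

Let xs2 := cubic_rootsC xs.
Let xs3 := cubic_rootsC xs2.
Let r1 := cubic_root_mem xs.
Let r2 := cubic_root_mem xs2.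
Let r3 := cubic_root_mem xs3.

Let nonsquare x y z g : cubic_roots j a c w x y z -> g ^+ 2 = x * (x - 1) * (x - j a) ->
  ~ simple_ext j x g.
Proof. by move=> xyz gE' [p pE]; case: (nonsquare_f nz no_root no_res xyz (p := p)); rewrite -pE. Qed.

(** Since rho is defined over M, the three roots generate the same cubic field; non-squares at x2
    and x3 thus remain so over M(x1). *)
Let ext12 : simple_ext j x1 x2. Proof. by rewrite x2E; apply: moebius. Qed.
Let ext23 : simple_ext j x2 x3. Proof. by rewrite x3E; apply: moebius. Qed.
Let ext31 : simple_ext j x3 x1. Proof. by rewrite x1E; apply: moebius. Qed.
Let ext13 : simple_ext j x1 x3. Proof. exact: simple_ext_trans ext12 ext23. Qed.
Let ext21 : simple_ext j x2 x1. Proof. exact: simple_ext_trans ext23 ext31. Qed.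

Let f_ext x y : simple_ext j x y -> simple_ext j x (y * (y - 1) * (y - j a)).
Proof.
move=> xy; apply: simple_extM; last by apply: simple_extB => //; apply: simple_extC.
by apply: simple_extM => //; apply: simple_extB => //; apply: simple_ext1.
Qed.

Lemma horner_small_eq0 (p : {poly M}) : (size p <= 3)%N -> (map_poly j p).[x1] = 0 -> p = 0.
Proof.
move=> sp px; apply/eqP; apply: contraT => p0.
have := dvdp_leq p0 (dvdp_vanish irr r1 px).
by rewrite size_cubic => /leq_trans/(_ sp).
Qed.

Lemma monomials_free (p0 p1 p2 p3 : {poly M}) :
  (size p0 <= 3)%N -> (size p1 <= 3)%N -> (size p2 <= 3)%N -> (size p3 <= 3)%N ->
  (map_poly j p0).[x1] + (map_poly j p1).[x1] * g1 + (map_poly j p2).[x1] * g2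
    + (map_poly j p3).[x1] * g3 = 0 ->
  [/\ p0 = 0, p1 = 0, p2 = 0 & p3 = 0].
Proof.
move=> s0 s1 s2 s3 R.
have [|||||||||||||||z0 z1 z2 z3] := @biquadratic_free Om (simple_ext j x1) two0 _ _ _ _
  g1 g2 g3 _ _ _ _ _ _ _ _ _ _ _ _ _ _ _ R.
- exact: simple_ext1.
- exact: simple_extB.
- exact: simple_extM.
- exact: (simple_extV irr r1).
- exact: nonsquare xs g1E.
- by move=> H; apply: (nonsquare xs2 g2E); apply: simple_ext_trans H.
- by move=> H; apply: (nonsquare xs3 g3E); apply: simple_ext_trans H.
- by rewrite g1E; apply: f_ext; apply: simple_extX.
- by rewrite g2E; apply: f_ext.
- by rewrite g3E; apply: f_ext.
- by rewrite gE; apply: simple_extC.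
- by exists p0.
- by exists p1.
- by exists p2.
- by exists p3.
by split; apply: horner_small_eq0.
Qed.

End Monomials.

(** * The Galois group *)

Section AdjoinNumbers.
Variables (K : fieldExtType rat) (iota : {rmorphism K -> algC}).

(** A primitive element z of the numbers s over the rationals generates them over K as well. L is
    the quotient of K[X] by a polynomial of least degree vanishing at z. *)
Lemma adjoin_numbers (s : seq algC) :
  exists (L : fieldExtType K) (sigma : {rmorphism L -> algC}) (s1 : seq L),
    [/\ map sigma s1 = s, <<1 & s1>>%VS = fullv & forall x : K, sigma x%:A = iota x].
Proof.
have [z [m zE] [ps sE]] := algC_PET s.
pose ok n := `[< exists p : {poly K}, [/\ p != 0, root (map_poly iota p) z & size p = n] >].
have exok : exists n, ok n.
  have [r [_ mr] /(_ r)] := minCpolyP z; rewrite dvdpp => rz.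
  exists (size (map_poly (in_alg K) r)); apply/asboolP; exists (map_poly (in_alg K) r).
  split=> //; first by rewrite map_poly_eq0 monic_neq0.
  rewrite -map_poly_comp (_ : map_poly _ r = map_poly ratr r) //.
  by apply: eq_map_poly => c; rewrite /= alg_num_field fmorph_rat.
have [_ /asboolP[p [p0 pz <-]] pmin] := ex_minnP exok.
have irr : irreducible_poly p.
  apply/(subfx_irreducibleP pz p0) => q qz q0; apply: pmin; apply/asboolP.
  by exists q.
pose L := SubFieldExtType pz irr; pose sigma : {rmorphism L -> algC} := @subfx_inj _ _ iota z p.
pose z1 : L := subfx_root iota z p.
have z1E : sigma z1 = z by exact: subfx_inj_root.
have sigmaK (x : K) : sigma x%:A = iota x by apply: subfx_inj_base.
pose ev (q : {poly rat}) : L := (map_poly (in_alg L) (map_poly (in_alg K) q)).[z1].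
have evE q : sigma (ev q) = (map_poly ratr q).[z].
  rewrite /ev -horner_map z1E -!map_poly_comp; congr _.[z].
  by apply: eq_map_poly => c; rewrite /= sigmaK alg_num_field fmorph_rat.
exists L, sigma, (map ev ps); split=> //.
  by rewrite sE -map_comp; apply: eq_map => q /=; exact: evE.
have szs : size ps = size s by rewrite sE size_map.
have z1in : z1 \in <<1 & map ev ps>>%VS.
  have -> : z1 = \sum_(i < size s) (map ev ps)`_i *+ m i.
    apply: (fmorph_inj sigma); rewrite z1E zE rmorph_sum; apply: eq_bigr => i _.
    rewrite rmorphMn {1}sE !(nth_map 0) ?szs //; congr (_ *+ _).
    by rewrite evE.
  by apply: memv_suml => i _; rewrite rpredMn // seqv_sub_adjoin // mem_nth // size_map szs.
apply/vspaceP => x; rewrite memvf.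
have [q ->] := subfxEroot pz p0 x; apply: rpred_horner => //.
by apply/polyOverP => i; rewrite coef_map; apply: (@memvZ K L); apply: mem1v.
Qed.

End AdjoinNumbers.

Lemma even_double_swap (T : finType) (i0 i1 i2 i3 : T) (s : {perm T}) :
  uniq [:: i0; i1; i2; i3] -> (forall i, i \in [:: i0; i1; i2; i3]) ->
  s i0 = i1 -> s i1 = i0 -> s i2 = i3 -> s i3 = i2 -> ~~ odd_perm s.
Proof.
rewrite /= !inE !negb_or -!andbA andbT => /and5P[n01 n02 n03 n12 /andP[n13 n23]] all s0 s1 s2 s3.
have -> : s = (tperm i0 i1 * tperm i2 i3)%g.
  apply/permP => i; rewrite permM; have := all i; rewrite !inE => /or4P[] /eqP ->.
  - by rewrite tpermL s0 tpermD // 1?eq_sym.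
  - by rewrite tpermR s1 tpermD // 1?eq_sym.
  - by rewrite [tperm i0 i1 _]tpermD // tpermL s2.
  - by rewrite [tperm i0 i1 _]tpermD // tpermR s3.
by rewrite odd_permM !odd_tperm n01 n23.
Qed.

Section SignedSums.
Variables (K : fieldType) (L : splittingFieldType K) (a c t y : K).
Hypotheses (two0 : 2%:R != 0 :> K) (pc0 : [pchar L] =i pred0).
Variables x1 x2 x3 g1 g2 g3 : L.
Hypothesis cubicE : forall z : L,
  abscissa_cubic c%:A t%:A z = (z - x1) * (z - x2) * (z - x3).
Hypotheses (x2E : x2 = c%:A * (x1 - c%:A) / x1) (x3E : x3 = c%:A * (x2 - c%:A) / x2).
Hypothesis x1E : x1 = c%:A * (x3 - c%:A) / x3.
Hypotheses (g1E : g1 ^+ 2 = x1 * (x1 - 1) * (x1 - a%:A)).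
Hypotheses (g2E : g2 ^+ 2 = x2 * (x2 - 1) * (x2 - a%:A)).
Hypotheses (g3E : g3 ^+ 2 = x3 * (x3 - 1) * (x3 - a%:A)) (gE : g1 * g2 * g3 = y%:A).
Hypothesis g_free : forall e1 e2 e3 : K,
  e1 *: g1 + e2 *: g2 + e3 *: g3 = 0 -> [/\ e1 = 0, e2 = 0 & e3 = 0].
Hypothesis gen : <<1 & [:: x1; x2; x3; g1; g2; g3]>>%VS = fullv.
Hypothesis dim12 : (12 <= \dim {:L})%N.

Let galT := gal_of {:L}.
Notation G := 'Gal({:L} / 1)%g.

Let two0L : 2%:R != 0 :> L.
Proof. by rewrite -(rmorph_nat (in_alg L)) fmorph_eq0. Qed.

Let y0 : y%:A != 0 :> L.
Proof.
rewrite -gE !mulf_neq0 //; apply/eqP => E.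
- by have := @g_free 1 0 0; rewrite E scaler0 !scale0r !addr0 => /(_ erefl) [/eqP]; rewrite oner_eq0.
- by have := @g_free 0 1 0; rewrite E scaler0 !scale0r !addr0 => /(_ erefl) [_ /eqP]; rewrite oner_eq0.
- by have := @g_free 0 0 1; rewrite E scaler0 !scale0r !addr0 => /(_ erefl) [_ _ /eqP]; rewrite oner_eq0.
Qed.

(** The third sign is e1 (+) e2 because automorphisms fix the nonzero product g1 g2 g3 = y. *)
Definition signed_image (s : L -> L) (h1 h2 h3 : L) : Prop := exists e1 e2 : bool,
  [/\ s g1 = (-1) ^+ e1 * h1, s g2 = (-1) ^+ e2 * h2 & s g3 = (-1) ^+ (e1 (+) e2) * h3].

Let signedP (s : galT) h1 h2 h3 : s \in G -> h1 * h2 * h3 = y%:A ->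
  s g1 ^+ 2 = h1 ^+ 2 -> s g2 ^+ 2 = h2 ^+ 2 -> s g3 ^+ 2 = h3 ^+ 2 ->
  signed_image s h1 h2 h3.
Proof.
move=> sG hE.
have sg (u w : L) : u ^+ 2 = w ^+ 2 -> exists e : bool, u = (-1) ^+ e * w.
  move/eqP; rewrite eqf_sqr => /orP[] /eqP ->; first by exists false; rewrite mul1r.
  by exists true; rewrite expr1 mulN1r.
move=> /sg[e1 E1] /sg[e2 E2] /sg[e3 E3].
suff e123 : e3 = e1 (+) e2 by exists e1, e2; rewrite -e123.
have : s (y%:A) = y%:A by rewrite (fixed_gal (sub1v _) sG) // memvZ ?mem1v.
rewrite -{1}gE !rmorphM /= E1 E2 E3.
have -> : (-1) ^+ e1 * h1 * ((-1) ^+ e2 * h2) * ((-1) ^+ e3 * h3) =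
  (-1) ^+ e1 * (-1) ^+ e2 * (-1) ^+ e3 * (h1 * h2 * h3) by ring.
rewrite hE -!signr_addb -{2}[y%:A]mul1r => /(mulIf y0).
case: (e1 (+) e2) {E1 E2 E3} e3 => -[] //= /eqP; rewrite expr1 -subr_eq0 -opprB oppr_eq0 opprK.
  by rewrite (negPf two0L).
by rewrite (negPf two0L).
Qed.

(** An automorphism commutes with rho, so the image of x1 determines a cyclic shift of the roots;
    the g_i follow the same shift up to signs. *)
Lemma gal_cases (s : galT) : s \in G ->
  [\/ [/\ s x1 = x1, s x2 = x2, s x3 = x3 & signed_image s g1 g2 g3],
      [/\ s x1 = x2, s x2 = x3, s x3 = x1 & signed_image s g2 g3 g1] |
      [/\ s x1 = x3, s x2 = x1, s x3 = x2 & signed_image s g3 g1 g2]].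
Proof.
move=> sG; have sK (k : K) : s k%:A = k%:A.
  by rewrite (fixed_gal (sub1v _) sG) // memvZ ?mem1v.
have rho x : s (c%:A * (x - c%:A) / x) = c%:A * (s x - c%:A) / s x.
  by rewrite !rmorphM rmorphB fmorphV /= sK.
have sf x : s (x * (x - 1) * (x - a%:A)) = s x * (s x - 1) * (s x - a%:A).
  by rewrite !rmorphM !rmorphB rmorph1 /= sK.
have : abscissa_cubic c%:A t%:A (s x1) = 0.
  have := congr1 s (cubicE x1); rewrite subrr !mul0r rmorph0 => <-.
  by rewrite /abscissa_cubic !(rmorph_nat, rmorphD, rmorphN, rmorphM, rmorphXn) /= !sK.
rewrite cubicE => /eqP; rewrite !mulf_eq0 !subr_eq0 -orbA => /or3P[] /eqP E1.
- have E2 : s x2 = x2 by rewrite x2E rho E1.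
  have E3 : s x3 = x3 by rewrite x3E rho E2.
  by constructor 1; split=> //; apply: signedP; rewrite // -rmorphXn /= ?(g1E, g2E, g3E) sf ?(E1, E2, E3).
- have E2 : s x2 = x3 by rewrite x2E rho E1 -x3E.
  have E3 : s x3 = x1 by rewrite x3E rho E2 -x1E.
  constructor 2; split=> //; apply: signedP; rewrite -?rmorphXn //= ?(g1E, g2E, g3E) ?sf ?(E1, E2, E3) //.
  by rewrite mulrC mulrA gE.
- have E2 : s x2 = x1 by rewrite x2E rho E1 -x1E.
  have E3 : s x3 = x2 by rewrite x3E rho E2 -x2E.
  constructor 3; split=> //; apply: signedP; rewrite -?rmorphXn //= ?(g1E, g2E, g3E) ?sf ?(E1, E2, E3) //.
  by rewrite -mulrA mulrC gE.
Qed.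

Definition sign_sum (b1 b2 : bool) : L :=
  (-1) ^+ b1 * g1 + (-1) ^+ b2 * g2 + (-1) ^+ (b1 (+) b2) * g3.
(** The two bits of an index are the signs of g1 and g2 in a sum, so that sign changes act by
    exclusive or. *)
Definition bit1 (i : 'I_4) : bool := (1 < i)%N.
Definition bit2 (i : 'I_4) : bool := odd i.
Definition ord_of_bits (b1 b2 : bool) : 'I_4 := inord (b1.*2 + b2).

Let bits1 b1 b2 : bit1 (ord_of_bits b1 b2) = b1.
Proof. by rewrite /bit1 inordK; case: b1 b2 => [] []. Qed.
Let bits2 b1 b2 : bit2 (ord_of_bits b1 b2) = b2.
Proof. by rewrite /bit2 inordK; case: b1 b2 => [] []. Qed.
Let bitsK i : ord_of_bits (bit1 i) (bit2 i) = i.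
Proof. by apply: val_inj; rewrite /= inordK; case: i => [[|[|[|[]]]]]. Qed.

Let rt (i : 'I_4) : L := sign_sum (bit1 i) (bit2 i).

Let sign_inj (e e' : bool) : (-1) ^+ e - (-1) ^+ e' = 0 :> K -> e = e'.
Proof.
case: e e' => -[] //= /eqP; rewrite expr0 expr1; last by rewrite opprK (negPf two0).
by rewrite -opprD oppr_eq0 (negPf two0).
Qed.

Let rt_inj : injective rt.
Proof.
move=> i k /eqP; rewrite -subr_eq0 => /eqP E.
have := @g_free ((-1) ^+ bit1 i - (-1) ^+ bit1 k) ((-1) ^+ bit2 i - (-1) ^+ bit2 k)
  ((-1) ^+ (bit1 i (+) bit2 i) - (-1) ^+ (bit1 k (+) bit2 k)).
have sgnZ (e : bool) (u : L) : ((-1) ^+ e : K) *: u = (-1) ^+ e * u.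
  by case: e; rewrite ?scaleN1r ?mulN1r ?scale1r ?mul1r.
rewrite !scalerBl !sgnZ -[X in X = 0 -> _](_ : rt i - rt k = _); last by rewrite /rt /sign_sum; ring.
by move=> /(_ E) [/sign_inj e1 /sign_inj e2 _]; rewrite -(bitsK i) -(bitsK k) e1 e2.
Qed.

Let gal_rtE (s : galT) i : s (rt i) = (-1) ^+ bit1 i * s g1 + (-1) ^+ bit2 i * s g2
    + (-1) ^+ (bit1 i (+) bit2 i) * s g3.
Proof. by rewrite /rt /sign_sum !rmorphD !rmorphM !rmorph_sign. Qed.

Let gal_rt (s : galT) i : s \in G -> exists k, s (rt i) = rt k.
Proof.
move=> sG; rewrite gal_rtE; case: (gal_cases sG) => -[_ _ _ [e1 [e2 [-> -> ->]]]].
- exists (ord_of_bits (bit1 i (+) e1) (bit2 i (+) e2)); rewrite /rt bits1 bits2 /sign_sum.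
  by rewrite !mulrA -!signr_addb addbACA.
- exists (ord_of_bits (bit1 i (+) bit2 i (+) (e1 (+) e2)) (bit1 i (+) e1)).
  rewrite /rt bits1 bits2 /sign_sum !mulrA -!signr_addb.
  rewrite (_ : _ (+) (bit1 i (+) e1) = bit2 i (+) e2); last by case: (bit1 i) (bit2 i) e1 e2 => [] [] [] [].
  by rewrite addrC addrA.
- exists (ord_of_bits (bit2 i (+) e2) (bit1 i (+) bit2 i (+) (e1 (+) e2))).
  rewrite /rt bits1 bits2 /sign_sum !mulrA -!signr_addb.
  rewrite (_ : _ (+) (bit1 i (+) bit2 i (+) _) = bit1 i (+) e1); last by case: (bit1 i) (bit2 i) e1 e2 => [] [] [] [].
  by rewrite -addrA addrC.
Qed.

Let act_fun (s : galT) (i : 'I_4) : 'I_4 := odflt i [pick k | rt k == s (rt i)].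

Let act_funE s i : s \in G -> rt (act_fun s i) = s (rt i).
Proof.
move=> sG; rewrite /act_fun; case: pickP => [k /eqP //|none].
by have [k E] := gal_rt i sG; have := none k; rewrite E eqxx.
Qed.

(** The identity is the default value outside G, so that [perm] applies to every s. *)
Let act_inj s : injective (fun i => if s \in G then act_fun s i else i).
Proof.
case: (boolP (s \in G)) => [sG|_] i k //= E.
have Es : s (rt i) = s (rt k) by rewrite -!act_funE // E.
by apply: rt_inj; apply: (fmorph_inj s).
Qed.

Definition sign_perm (s : galT) : {perm 'I_4} := perm (act_inj (s := s)).

Let sign_permE s i : s \in G -> rt (sign_perm s i) = s (rt i).
Proof. by move=> sG; rewrite permE sG act_funE. Qed.

Fact sign_perm_morph : {in G &, {morph sign_perm : s u / (s * u)%g}}.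
Proof.
move=> s u sG uG; apply/permP => i; apply: rt_inj.
by rewrite permM !sign_permE ?groupM // galM ?memvf.
Qed.

Canonical sign_perm_morphism := Morphism sign_perm_morph.

Let rt_sum1 : rt ord0 + rt (inord 1) = 2%:R * g1.
Proof. by rewrite /rt /bit1 /bit2 !inordK //= /sign_sum /=; ring. Qed.
Let rt_sum2 : rt ord0 + rt (inord 2) = 2%:R * g2.
Proof. by rewrite /rt /bit1 /bit2 !inordK //= /sign_sum /=; ring. Qed.
Let rt_sum3 : rt ord0 + rt (inord 3) = 2%:R * g3.
Proof. by rewrite /rt /bit1 /bit2 !inordK //= /sign_sum /=; ring. Qed.

Let sums_fix (s : galT) k g : s \in G -> rt ord0 + rt k = 2%:R * g ->
  s (rt ord0) + s (rt k) = 2%:R * s g.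
Proof. by move=> sG E; rewrite -rmorphD E rmorphM rmorph_nat. Qed.

Let g_indep (e1 e2 e3 : K) : (e1 != 0) || (e2 != 0) || (e3 != 0) ->
  e1%:A * g1 + e2%:A * g2 + e3%:A * g3 != 0.
Proof.
move=> ne; apply/eqP; rewrite -!scalerAl !mul1r => /g_free[E1 E2 E3].
by rewrite E1 E2 E3 eqxx in ne.
Qed.

Let one_neg e : ((-1) ^+ (e : bool) : L) = ((-1) ^+ e : K)%:A.
Proof. by rewrite -[RHS]/(in_alg L _) rmorph_sign. Qed.

(** A nontrivial shift would send g1 to g2 or g3 up to sign, against their linear independence. *)
Let gal_fix_x (s : galT) (e : bool) : s \in G -> s g1 = (-1) ^+ e * g1 ->
  [/\ s x1 = x1, s x2 = x2 & s x3 = x3].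
Proof.
move=> sG sg1; case: (gal_cases sG) => -[s1 s2 s3 [e1 [e2 [E _ _]]]] //; exfalso.
- have := @g_indep ((-1) ^+ e) (- (-1) ^+ e1) 0; rewrite signr_eq0 => /(_ isT) /eqP; apply.
  by rewrite scale0r mul0r addr0 scaleNr -!one_neg mulNr -E sg1 subrr.
- have := @g_indep ((-1) ^+ e) 0 (- (-1) ^+ e1); rewrite signr_eq0 => /(_ isT) /eqP; apply.
  by rewrite scale0r mul0r addr0 scaleNr -!one_neg mulNr -E sg1 subrr.
Qed.

Lemma injm_sign_perm : ('injm sign_perm)%g.
Proof.
apply/fintype.subsetP => s /morphpreP[sG /set1P ps1]; rewrite inE.
have srt i : s (rt i) = rt i by rewrite -sign_permE // ps1 perm1.
have fixg k g : rt ord0 + rt k = 2%:R * g -> s g = g.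
  by move=> E; apply: (mulfI two0L); rewrite -(sums_fix sG E) !srt.
have [f1 f2 f3] := And3 (fixg _ _ rt_sum1) (fixg _ _ rt_sum2) (fixg _ _ rt_sum3).
have [fx1 fx2 fx3] : [/\ s x1 = x1, s x2 = x2 & s x3 = x3].
  by apply: (@gal_fix_x s false); rewrite // mul1r.
have sub : (<<1 & [:: x1; x2; x3; g1; g2; g3]>> <= fixedField [set s])%VS.
  apply/Fadjoin_seqP; split; first exact: sub1v.
  move=> u; rewrite !inE => H; apply/fixedFieldP; rewrite ?memvf // => ? /set1P ->.
  by move: H => /orP[|/orP[|/orP[|/orP[|/orP[]]]]] /eqP ->.
apply/gal_eqP => u _; rewrite gal_id.
have /(subvP sub) : u \in <<1 & [:: x1; x2; x3; g1; g2; g3]>>%VS by rewrite gen memvf.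
by move/fixedFieldP; apply; rewrite ?memvf ?set11.
Qed.

Let o := ord_of_bits.

Let o_inj b1 b2 d1 d2 : (o b1 b2 == o d1 d2) = (b1 == d1) && (b2 == d2).
Proof.
apply/eqP/andP => [E|[/eqP -> /eqP ->] //].
have := congr1 bit1 E; have := congr1 bit2 E.
by rewrite /o !bits1 !bits2 => -> ->; rewrite !eqxx.
Qed.

Let f_inj (u v h k : L) : h ^+ 2 = u * (u - 1) * (u - a%:A) -> k ^+ 2 = v * (v - 1) * (v - a%:A) ->
  u = v -> exists e : bool, h = (-1) ^+ e * k.
Proof.
move=> hE kE uv; have /eqP : h ^+ 2 = k ^+ 2 by rewrite hE kE uv.
rewrite eqf_sqr => /orP[] /eqP ->; first by exists false; rewrite mul1r.
by exists true; rewrite expr1 mulN1r.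
Qed.

Let x12 : x1 != x2.
Proof.
apply/eqP => /(f_inj g1E g2E)[e E]; have := @g_indep 1 (- (-1) ^+ e) 0.
rewrite oner_eq0 => /(_ isT) /eqP; apply.
by rewrite scale0r mul0r addr0 scale1r mul1r scaleNr -one_neg mulNr -E subrr.
Qed.

Let x13 : x1 != x3.
Proof.
apply/eqP => /(f_inj g1E g3E)[e E]; have := @g_indep 1 0 (- (-1) ^+ e).
rewrite oner_eq0 => /(_ isT) /eqP; apply.
by rewrite scale0r mul0r addr0 scale1r mul1r scaleNr -one_neg mulNr -E subrr.
Qed.

(** Such an s fixes all roots and only changes signs. It translates the bits, hence is trivial or a
    product of two disjoint transpositions. *)
Let even_fix (s : galT) : s \in G -> s x1 = x1 -> ~~ odd_perm (sign_perm s).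
Proof.
move=> sG sx1.
have [e1 [e2 pE]] : exists e1 e2 : bool, forall b1 b2,
    sign_perm s (o b1 b2) = o (b1 (+) e1) (b2 (+) e2).
  have [e1 [e2 [E1 E2 E3]]] : signed_image s g1 g2 g3.
    case: (gal_cases sG) => -[s1 _ _ //]; exfalso.
      by move: x12; rewrite -s1 sx1 eqxx.
    by move: x13; rewrite -s1 sx1 eqxx.
  exists e1, e2 => b1 b2; apply: rt_inj; rewrite sign_permE // gal_rtE /rt !bits1 !bits2 /sign_sum.
  rewrite E1 E2 E3 !mulrA -!signr_addb.
  by rewrite addbACA.
case: e1 e2 pE => -[] pE.
- apply: (@even_double_swap _ (o false false) (o true true) (o false true) (o true false)); rewrite ?pE //.
    by rewrite /= !inE !o_inj.
  by move=> i; rewrite -(bitsK i) !inE !o_inj; case: (bit1 i) (bit2 i) => [] [].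
- apply: (@even_double_swap _ (o false false) (o true false) (o false true) (o true true)); rewrite ?pE //.
    by rewrite /= !inE !o_inj.
  by move=> i; rewrite -(bitsK i) !inE !o_inj; case: (bit1 i) (bit2 i) => [] [].
- apply: (@even_double_swap _ (o false false) (o false true) (o true false) (o true true)); rewrite ?pE //.
    by rewrite /= !inE !o_inj.
  by move=> i; rewrite -(bitsK i) !inE !o_inj; case: (bit1 i) (bit2 i) => [] [].
rewrite (_ : sign_perm s = 1%g) ?odd_perm1 //; apply/permP => i.
by rewrite -(bitsK i) pE !addbF perm1.
Qed.

(** The cube of s fixes x1, so it is even, and s has the same parity as its cube. *)
Let sign_perm_even (s : galT) : s \in G -> ~~ odd_perm (sign_perm s).
Proof.
move=> sG; have s3 : (s * s * s)%g x1 = x1.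
  rewrite !galM ?memvf //; case: (gal_cases sG) => -[E1 E2 E3 _]; by rewrite ?(E1, E2, E3).
have := even_fix (groupM (groupM sG sG) sG) s3.
rewrite !sign_perm_morph ?groupM // !odd_permM.
by case: (odd_perm _).
Qed.

Lemma sign_field_galois : galois 1%VS {:L}%VS.
Proof.
apply/and3P; split; [exact: sub1v | | exact: normalFieldf].
by apply/separableP => u _; apply: pcharf0_separable.
Qed.

Lemma card_sign_gal : #|G| = \dim {:L}.
Proof. by rewrite -galois_dim ?sign_field_galois // dimv1 divn1. Qed.

(** The image lies in a group of order 12, and injectivity gives it order [L : K] >= 12. *)
Lemma sign_perm_image : (sign_perm @* G = 'Alt_('I_4))%g.
Proof.
have sub : (sign_perm @* G \subset 'Alt_('I_4))%g.
  by apply/fintype.subsetP => _ /morphimP[s _ sG ->]; rewrite Alt_even; apply: sign_perm_even.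
have cA : #|('Alt_('I_4))%g| = 12%N.
  by apply: double_inj; rewrite -mul2n card_Alt card_ord.
by apply/eqP; rewrite eqEcard sub card_injm ?injm_sign_perm // cA card_sign_gal.
Qed.

Lemma sign_field_A4 : A4_extension L.
Proof.
split; first exact: sign_field_galois.
rewrite -sign_perm_image; exact: sub_isog injm_sign_perm.
Qed.

Lemma sign_field_dim : \dim {:L} = 12%N.
Proof.
rewrite -card_sign_gal -(card_injm injm_sign_perm) // sign_perm_image.
by apply: double_inj; rewrite -mul2n card_Alt card_ord.
Qed.

Lemma exists_gal_perm (p : {perm 'I_4}) : ~~ odd_perm p ->
  exists2 s, s \in G & forall i, s (rt i) = rt (p i).
Proof.
rewrite -Alt_even -sign_perm_image => /morphimP[s _ sG ->].
by exists s => // i; rewrite sign_permE.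
Qed.

(** Reading indices modulo 3 turns the 3-cycle into a shift of the index. *)
Definition abscissa (i : nat) : L := nth 0 [:: x1; x2; x3] (i %% 3).
Definition ordinate (i : nat) : L := nth 0 [:: g1; g2; g3] (i %% 3).

Let rt_o b1 b2 : rt (o b1 b2) = sign_sum b1 b2.
Proof. by rewrite /rt bits1 bits2. Qed.

Let sum_g1 : sign_sum false false + sign_sum false true = 2%:R * g1.
Proof. by rewrite /sign_sum /=; ring. Qed.
Let sum_g2 : sign_sum false false + sign_sum true false = 2%:R * g2.
Proof. by rewrite /sign_sum /=; ring. Qed.
Let sum_g3 : sign_sum false false + sign_sum true true = 2%:R * g3.
Proof. by rewrite /sign_sum /=; ring. Qed.

Let gal_g (s : galT) g u b1 b2 : sign_sum false false + sign_sum b1 b2 = 2%:R * g ->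
  s (sign_sum false false) + s (sign_sum b1 b2) = 2%:R * u -> s g = u.
Proof.
move=> E E'; apply: (mulfI two0L); rewrite -E' -rmorphD E rmorphM /=.
by rewrite rmorph_nat.
Qed.

Let double_swap_gal b1 b2 d1 d2 : uniq [:: o false false; o b1 b2; o d1 d2; o (b1 (+) d1) (b2 (+) d2)] ->
  exists2 s, s \in G & [/\ s (sign_sum false false) = sign_sum b1 b2,
    s (sign_sum b1 b2) = sign_sum false false,
    s (sign_sum d1 d2) = sign_sum (b1 (+) d1) (b2 (+) d2) &
    s (sign_sum (b1 (+) d1) (b2 (+) d2)) = sign_sum d1 d2].
Proof.
rewrite /= !inE !negb_or -!andbA andbT => /and5P[n01 n02 n03 n12 /andP[n13 n23]].
have ev : ~~ odd_perm (tperm (o false false) (o b1 b2) *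
    tperm (o d1 d2) (o (b1 (+) d1) (b2 (+) d2)))%g.
  by rewrite odd_permM !odd_tperm n01 n23.
have [s sG sE] := exists_gal_perm ev; exists s => //.
rewrite -!rt_o !sE !permM; split.
- by rewrite tpermL tpermD // eq_sym.
- by rewrite tpermR tpermD // eq_sym.
- by rewrite [tperm (o false false) _ _]tpermD // tpermL.
- by rewrite [tperm (o false false) _ _]tpermD // tpermR.
Qed.

(** Translation of the bits by 01, 10 or 11 fixes g1, g2 or g3 respectively and negates the other
    two. *)
Lemma exists_sign_gal (k : 'I_3) : exists2 s, s \in G &
  forall i : 'I_3, s (abscissa i) = abscissa i /\ s (ordinate i) = if i == k then ordinate i else - ordinate i.
Proof.
suff [s sG [e [E0 E1 E2 E3]]] : exists2 s : galT, s \in G & exists e : bool, [/\ s g1 = (-1) ^+ e * g1,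
    (s g1 = if k == 0 :> nat then g1 else - g1),
    (s g2 = if k == 1 :> nat then g2 else - g2) &
    (s g3 = if k == 2 :> nat then g3 else - g3)].
  have [X1 X2 X3] := gal_fix_x sG E0.
  exists s => // i; rewrite -val_eqE eq_sym /abscissa /ordinate.
  by case: i => [[|[|[|//]]] ?].
case: k => [[|[|[|//]]] ?] /=.
- have [|s sG [S0 S1 S2 S3]] := @double_swap_gal false true true false; first by rewrite /= !inE !o_inj.
  exists s => //; exists false; rewrite mul1r /= in S3 *.
  have E1 : s g1 = g1 by apply: (gal_g sum_g1); rewrite S0 S1 /sign_sum /=; ring.
  split=> //; [apply: (gal_g sum_g2) | apply: (gal_g sum_g3)];
    by rewrite S0 ?S2 ?S3 /sign_sum /=; ring.
- have [|s sG [S0 S1 S2 S3]] := @double_swap_gal true false false true; first by rewrite /= !inE !o_inj.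
  exists s => //; exists true; rewrite expr1 mulN1r /= in S3 *.
  have E1 : s g1 = - g1 by apply: (gal_g sum_g1); rewrite S0 S2 /sign_sum /=; ring.
  split=> //; [apply: (gal_g sum_g2) | apply: (gal_g sum_g3)];
    by rewrite S0 ?S1 ?S3 /sign_sum /=; ring.
- have [|s sG [S0 S1 S2 S3]] := @double_swap_gal true true false true; first by rewrite /= !inE !o_inj.
  exists s => //; exists true; rewrite expr1 mulN1r /= in S3 *.
  have E1 : s g1 = - g1 by apply: (gal_g sum_g1); rewrite S0 S2 /sign_sum /=; ring.
  split=> //; [apply: (gal_g sum_g2) | apply: (gal_g sum_g3)];
    by rewrite S0 ?S1 ?S3 /sign_sum /=; ring.
Qed.

(** The 3-cycle of sign sums that fixes g1 + g2 + g3 moves g1 to g2, g2 to g3 and g3 to g1; by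
    linear independence the roots can only move in the same way. *)
Lemma exists_cycle_gal (k : nat) : exists2 s, s \in G &
  forall i, s (abscissa i) = abscissa (i + k) /\ s (ordinate i) = ordinate (i + k).
Proof.
suff [s sG sE] : exists2 s : galT, s \in G & forall i, s (abscissa i) = abscissa i.+1 /\ s (ordinate i) = ordinate i.+1.
  elim: k => [|k [u uG uE]].
    by exists 1%g => // i; rewrite !gal_id addn0.
  exists (u * s)%g; first exact: groupM.
  move=> i; rewrite !galM ?memvf //; have [-> ->] := uE i; rewrite addnS; exact: sE.
have ev : ~~ odd_perm (tperm (o false true) (o true false) * tperm (o false true) (o true true))%g.
  by rewrite odd_permM !odd_tperm !o_inj.
have [s sG sE] := exists_gal_perm ev; exists s => //.
have S b1 b2 := sE (o b1 b2).
have S0 : s (sign_sum false false) = sign_sum false false.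
  by rewrite -!rt_o sE permM !tpermD ?o_inj.
have S1 : s (sign_sum false true) = sign_sum true false.
  by rewrite -!rt_o sE permM tpermL tpermD ?o_inj.
have S2 : s (sign_sum true false) = sign_sum true true.
  by rewrite -!rt_o sE permM tpermR tpermL.
have S3 : s (sign_sum true true) = sign_sum false true.
  by rewrite -!rt_o sE permM [tperm _ (o true false) _]tpermD ?o_inj // tpermR.
have E1 : s g1 = g2 by apply: (gal_g sum_g1); rewrite S0 S1 /sign_sum /=; ring.
have E2 : s g2 = g3 by apply: (gal_g sum_g2); rewrite S0 S2 /sign_sum /=; ring.
have E3 : s g3 = g1 by apply: (gal_g sum_g3); rewrite S0 S3 /sign_sum /=; ring.
have [X1 X2 X3] : [/\ s x1 = x2, s x2 = x3 & s x3 = x1].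
  case: (gal_cases sG) => -[s1 s2 s3 [e1 [e2 [E _ _]]]] //; exfalso.
  - have := @g_indep (- (-1) ^+ e1) 1 0; rewrite oner_eq0 orbT => /(_ isT) /eqP; apply.
    by rewrite scale0r mul0r addr0 scale1r mul1r scaleNr -one_neg mulNr -E E1 addNr.
  - have := @g_indep 0 1 (- (-1) ^+ e1); rewrite oner_eq0 orbT => /(_ isT) /eqP; apply.
    by rewrite scale0r mul0r add0r scale1r mul1r scaleNr -one_neg mulNr -E E1 subrr.
move=> i; rewrite /abscissa /ordinate -[i.+1]addn1 -(modnDml i 1 3).
by have := ltn_pmod i (isT : 0 < 3)%N; case: (i %% 3)%N => [|[|[|]]].
Qed.

End SignedSums.

(** * Linear disjointness *)

Section Disjointness.
Local Open Scope classical_set_scope.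
Variables (K Om : fieldType) (iota : {rmorphism K -> Om}).
Implicit Types (E M S : set Om).

Lemma subfield_setP S : subfield_set S <->
  [/\ S 1, forall x y, S x -> S y -> S (x - y) & forall x y, S x -> S y -> S (x / y)].
Proof.
split=> [[/set_mem S1 SB SV]|[S1 SB SV]].
  split=> // x y Sx Sy; apply: set_mem; first by apply: SB; apply: mem_set.
  by apply: SV; apply: mem_set.
split; first exact: mem_set.
  by move=> x y /set_mem Sx /set_mem Sy; apply: mem_set; apply: (SB).
by move=> x y /set_mem Sx /set_mem Sy; apply: mem_set; apply: (SV).
Qed.

Section Closure.
Variable S : set Om.
Hypothesis sS : subfield_set S.

Lemma subfield1 : S 1. Proof. by case/subfield_setP: sS. Qed.
Lemma subfieldB x y : S x -> S y -> S (x - y).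
Proof. by case/subfield_setP: sS => _ H _; apply: H. Qed.
Lemma subfieldV x y : S x -> S y -> S (x / y).
Proof. by case/subfield_setP: sS => _ _ H; apply: H. Qed.
Lemma subfield0 : S 0. Proof. by rewrite -(subrr 1); apply: subfieldB; exact: subfield1. Qed.
Lemma subfieldD x y : S x -> S y -> S (x + y).
Proof.
move=> Sx Sy; rewrite -(opprK y); apply: subfieldB => //; rewrite -sub0r.
by apply: subfieldB => //; exact: subfield0.
Qed.
Lemma subfieldM x y : S x -> S y -> S (x * y).
Proof.
move=> Sx Sy; rewrite -(invrK y); apply: subfieldV => //; rewrite -div1r.
by apply: subfieldV => //; exact: subfield1.
Qed.
Lemma subfield_sum (I : Type) (r : seq I) (P : pred I) (e : I -> Om) :
  (forall i, P i -> S (e i)) -> S (\sum_(i <- r | P i) e i).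
Proof.
by move=> H; elim/big_ind: _ => //; [exact: subfield0 | exact: subfieldD].
Qed.
End Closure.

Lemma subfield_range : subfield_set (range iota).
Proof.
apply/subfield_setP; split; first by exists 1; rewrite ?rmorph1.
  by move=> _ _ [x _ <-] [y _ <-]; exists (x - y); rewrite ?rmorphB.
by move=> _ _ [x _ <-] [y _ <-]; exists (x / y); rewrite ?fmorph_div.
Qed.

(** The coordinate matrix of v over K has full row rank, hence a right inverse over K. A relation
    over M vanishes in every coordinate because b is independent over M, and the right inverse
    recovers its coefficients. *)
Lemma lin_disjoint_basis (d : nat) (b : 'I_d -> Om) E M :
  subfield_set M -> (forall x, M (iota x)) -> lin_indep_over M b ->
  (forall e, E e -> exists A : 'I_d -> K, e = \sum_i iota (A i) * b i) ->
  lin_disjoint (range iota) E M.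
Proof.
move=> sM kM bM EA n v Ev vK.
have /choice[A AE] : forall i, exists A : 'I_d -> K, v i = \sum_j iota (A j) * b j.
  by move=> i; apply: EA.
pose B : 'M[K]_(n, d) := \matrix_(i, j) A i j.
have free : row_free B.
  rewrite -kermx_eq0; apply/eqP/row_matrixP => i; rewrite row0.
  set u := row i _; have uB : u *m B = 0 by rewrite -row_mul mulmx_ker row0.
  apply/rowP => l; rewrite [RHS]mxE; apply: (fmorph_inj iota); rewrite rmorph0.
  apply: (vK (fun l => iota (u 0 l))); first by move=> l'; exists (u 0 l').
  under eq_bigr => l' _ do rewrite AE mulr_sumr.
  rewrite exchange_big big1 // => j _ /=.
  transitivity (iota ((u *m B) 0 j) * b j); last by rewrite uB mxE rmorph0 mul0r.
  rewrite mxE rmorph_sum mulr_suml; apply: eq_bigr => l' _.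
  by rewrite rmorphM [B _ _]mxE mulrA.
have /row_freeP[D BD] := free.
move=> c Mc cv l.
have cA j : \sum_i c i * iota (A i j) = 0.
  apply: (bM (fun j => \sum_i c i * iota (A i j))).
    by move=> j'; apply: subfield_sum => // i _; apply: subfieldM.
  rewrite -[RHS]cv; under eq_bigr => j' _ do rewrite mulr_suml.
  rewrite exchange_big; apply: eq_bigr => i _ /=.
  by rewrite AE mulr_sumr; apply: eq_bigr => j' _; rewrite mulrA.
transitivity (\sum_i c i * iota ((B *m D) i l)).
  rewrite BD (bigD1 l) //= mxE eqxx rmorph1 mulr1 big1 ?addr0 // => i il.
  by rewrite mxE (negPf il) rmorph0 mulr0.
under eq_bigr => i _ do rewrite mxE rmorph_sum mulr_sumr.
rewrite exchange_big big1 // => j _ /=.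
transitivity ((\sum_i c i * iota (A i j)) * iota (D j l)); last by rewrite cA mul0r.
by rewrite mulr_suml; apply: eq_bigr => i _; rewrite rmorphM [B _ _]mxE mulrA.
Qed.

Lemma smallest_subfield (G : set Om) : subfield_set (smallest (@subfield_set Om) G).
Proof.
apply/subfield_setP; split.
- by move=> S [/subfield_setP[]].
- move=> x y Sx Sy S [sS SE]; have Sx' := Sx S (conj sS SE); have Sy' := Sy S (conj sS SE).
  exact: subfieldB.
- move=> x y Sx Sy S [sS SE]; have Sx' := Sx S (conj sS SE); have Sy' := Sy S (conj sS SE).
  exact: subfieldV.
Qed.

Lemma smallest_subfield_min (G S : set Om) :
  subfield_set S -> G `<=` S -> smallest (@subfield_set Om) G `<=` S.
Proof. by move=> sS GS x; apply; split. Qed.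

Lemma sub_smallest_subfield (G : set Om) : G `<=` smallest (@subfield_set Om) G.
Proof. by move=> x Gx S [_]; apply. Qed.

Lemma lin_disjoint_sub E M S : M `<=` S ->
  lin_disjoint (range iota) E S -> lin_disjoint (range iota) E M.
Proof.
move=> MS dS n v Ev vk c Mc cv i.
by apply: (dS n v Ev vk c _ cv) => i'; apply: MS.
Qed.

(** * From successive to mutual linear disjointness *)

Section SpanOver.
Variables (F E : set Om) (d : nat) (b : 'I_d -> Om).
Hypotheses (sF : subfield_set F) (sE : subfield_set E) (kF : forall x, F (iota x)).
Hypotheses (bE : forall i, E (b i)).
Hypothesis Espan : forall e, E e -> exists A : 'I_d -> K, e = \sum_i iota (A i) * b i.

Definition span_over : set Om :=
  [set x | exists2 m : 'I_d -> Om, forall i, F (m i) & x = \sum_i m i * b i].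

Let spanB x y : span_over x -> span_over y -> span_over (x - y).
Proof.
move=> [m Fm ->] [m' Fm' ->]; exists (fun i => m i - m' i) => [i|].
  exact: subfieldB.
by rewrite -sumrB; apply: eq_bigr => i _; rewrite mulrBl.
Qed.

Let span0 : span_over 0.
Proof.
exists (fun=> 0); first by move=> _; exact: subfield0.
by rewrite big1 // => i _; rewrite mul0r.
Qed.

Let span_sum (I : Type) (r : seq I) (e : I -> Om) :
  (forall i, span_over (e i)) -> span_over (\sum_(i <- r) e i).
Proof.
move=> H; elim/big_ind: _ => // x y Sx Sy.
by rewrite -(opprK y); apply: spanB => //; rewrite -sub0r; apply: spanB.
Qed.

Let spanZ z x : F z -> span_over x -> span_over (z * x).
Proof.
move=> Fz [m Fm ->]; exists (fun i => z * m i) => [i|]; first exact: subfieldM.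
by rewrite mulr_sumr; apply: eq_bigr => i _; rewrite mulrA.
Qed.

Lemma span_overE e : E e -> span_over e.
Proof. by move=> /Espan[A ->]; exists (fun i => iota (A i)). Qed.

Lemma span_overF z : F z -> span_over z.
Proof. by move=> Fz; rewrite -[z]mulr1; apply: spanZ => //; apply: span_overE; exact: subfield1. Qed.

Lemma span_overM x y : span_over x -> span_over y -> span_over (x * y).
Proof.
move=> [m Fm ->] [m' Fm' ->]; rewrite mulr_suml; apply: span_sum => i.
rewrite mulr_sumr; apply: span_sum => j.
rewrite mulrACA; apply: spanZ; first exact: subfieldM.
by apply: span_overE; apply: subfieldM.
Qed.

(** Fractions of the ring that b spans over F. They form a field containing F and E, and a common
    denominator brings a relation back to that ring. *)
Definition span_frac : set Om :=
  [set x | exists2 w, w != 0 & span_over w /\ span_over (x * w)].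

Lemma span_frac_subfield : subfield_set span_frac.
Proof.
have s1 : span_over 1 by apply: span_overF; exact: subfield1.
apply/subfield_setP; split.
- by exists 1; rewrite ?oner_neq0 // mulr1.
- move=> x y [u u0 [Su Sxu]] [w w0 [Sw Syw]]; exists (u * w); first exact: mulf_neq0.
  split; first exact: span_overM.
  rewrite (_ : _ * _ = (x * u) * w - (y * w) * u); last by ring.
  by apply: spanB; apply: span_overM.
- move=> x y [u u0 [Su Sxu]] [w w0 [Sw Syw]].
  case: (eqVneq y 0) => [->|y0]; first by exists 1; rewrite ?oner_neq0 // invr0 mulr0 mul0r.
  exists (u * (y * w)); first by rewrite !mulf_neq0.
  split; first exact: span_overM.
  rewrite (_ : _ * _ = (x * u) * w); last by field.
  exact: span_overM.
Qed.

Lemma span_frac_common (n : nat) (c : 'I_n -> Om) : (forall i, span_frac (c i)) ->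
  exists2 W, W != 0 & forall i, span_over (c i * W).
Proof.
move=> cS; have /choice[w wP] : forall i, exists w, w != 0 /\ span_over w /\ span_over (c i * w).
  by move=> i; have [w w0 Sw] := cS i; exists w.
have S1 : span_over 1 by apply: span_overF; exact: subfield1.
have prodS (P : pred 'I_n) : span_over (\prod_(i < n | P i) w i).
  elim/big_ind: _ => //; first exact: span_overM.
  by move=> i _; case: (wP i) => _ [].
exists (\prod_(i < n) w i).
  by apply/prodf_neq0 => i _; case: (wP i).
by move=> i; rewrite (bigD1 i) //= mulrA; apply: span_overM => //; case: (wP i) => _ [].
Qed.

End SpanOver.

Variables (E : nat -> set Om) (d : nat -> nat) (b : forall n, 'I_(d n) -> Om).
Hypotheses (sE : forall n, subfield_set (E n)) (bE : forall n i, E n (@b n i)).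
Hypothesis kE : forall n x, E n (iota x).
Hypothesis bK : forall n, lin_indep_over (range iota) (@b n).
Hypothesis Espan : forall n e, E n e ->
  exists A : 'I_(d n) -> K, e = \sum_i iota (A i) * @b n i.
Let C (J : set nat) := smallest (@subfield_set Om) (range iota `|` \bigcup_(j in J) E j).

Hypothesis Eseq : forall n, lin_disjoint (range iota) (E n) (C [set j | (j < n)%N]).

Let sC J : subfield_set (C J). Proof. exact: smallest_subfield. Qed.
Let CK J x : C J (iota x). Proof. by apply: sub_smallest_subfield; left; exists x. Qed.
Let CE (J : set nat) i : J i -> E i `<=` C J.
Proof. by move=> Ji x Ex; apply: sub_smallest_subfield; right; exists i. Qed.
Let C_min (J : set nat) S : subfield_set S -> (forall x, S (iota x)) ->
  (forall i, J i -> E i `<=` S) -> C J `<=` S.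
Proof.
move=> sS kS ES; apply: smallest_subfield_min => // x [[y _ <-]|[i Ji Ex]]; first exact: kS.
exact: ES Ex.
Qed.
Let C_mono (J J' : set nat) : J `<=` J' -> C J `<=` C J'.
Proof. by move=> JJ; apply: C_min => // i Ji; apply: CE; apply: JJ. Qed.

(** When E_N is added to the other fields, the coefficients of a relation are cleared of
    denominators and expanded along the basis of E_N. Disjointness of E_N from all earlier fields,
    E_i included, splits the relation into relations over the previous compositum, settled by
    induction. *)
Lemma lin_disjoint_finite N i : (i < N)%N ->
  lin_disjoint (range iota) (E i) (C [set j | (j < N)%N /\ j <> i]).
Proof.
elim: N i => // N IH i; rewrite ltnS leq_eqVlt => /orP[/eqP -> | iN].
  apply: (lin_disjoint_sub _ (@Eseq N)); apply: C_mono => j /= [].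
  by rewrite ltnS leq_eqVlt => /orP[/eqP//|].
move=> n v Ev vK c Cc cv.
set F := C [set j | (j < N)%N /\ j <> i].
have Ffrac : C [set j | (j < N.+1)%N /\ j <> i] `<=` span_frac F (@b N).
  have Sf := span_frac_subfield (sC _ : subfield_set F) (sE N) (@CK _) (@bE N) (@Espan N).
  have fr x : span_over F (@b N) x -> span_frac F (@b N) x.
    exists 1; first exact: oner_neq0.
    split; last by rewrite mulr1.
    exact: (span_overF (sC _) (sE N) (@CK _) (@Espan N) (subfield1 (sC _))).
  have FF x : F x -> span_frac F (@b N) x by move=> Fx; apply: fr; exact: (span_overF (sC _) (sE N) (@CK _) (@Espan N) Fx).
  apply: C_min => // [x|j [jN ji] x Ex]; first by apply: FF; exact: CK.
  move: jN; rewrite /= ltnS leq_eqVlt => /orP[/eqP jN|jN].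
    by rewrite jN in Ex; apply: fr; exact: (span_overE (@CK _) (@Espan N) Ex).
  by apply: FF; apply: (@CE _ j).
have [W W0 SW] : exists2 W, W != 0 & forall l, span_over F (@b N) (c l * W).
  apply: (span_frac_common (sC _) (sE N) (@CK _) (@bE N) (@Espan N)) => l.
  by apply: Ffrac; apply: Cc.
have /choice[m mP] : forall l, exists m : 'I_(d N) -> Om,
    (forall j, F (m j)) /\ c l * W = \sum_j m j * @b N j.
  by move=> l; have [m Fm mE] := SW l; exists m.
have bN : lin_indep_over (C [set j | (j < N)%N]) (@b N) by apply: Eseq.
have subN : F `<=` C [set j | (j < N)%N] by apply: C_mono => j [].
have m0 j : \sum_l m l j * v l = 0.
  apply: (bN (fun j => \sum_l m l j * v l)).
    move=> j'; apply: (subfield_sum (sC _)) => l _; apply: (subfieldM (sC _)).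
      exact: subN ((mP l).1 j').
    exact: (@CE [set j | (j < N)%N] i iN _ (Ev l)).
  transitivity (W * \sum_l c l * v l); last by rewrite cv mulr0.
  under eq_bigr => j' _ do rewrite mulr_suml.
  rewrite exchange_big mulr_sumr; apply: eq_bigr => l _ /=.
  rewrite mulrA [W * _]mulrC (mP l).2 mulr_suml; apply: eq_bigr => j' _.
  by rewrite mulrAC.
have mz l j : m l j = 0.
  exact: (IH i iN n v Ev vK (fun l => m l j) (fun l' => (mP l').1 j) (m0 j) l).
move=> l; apply: (mulIf W0); rewrite mul0r (mP l).2 big1 // => j _.
by rewrite mz mul0r.
Qed.

(** A relation has finitely many coefficients, which lie in the compositum of finitely many
    fields. *)
Lemma lin_disjoint_family_of_seq : lin_disjoint_family (range iota) E.
Proof.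
move=> i n v Ev vK c Cc cv.
have Cfin : compositum [set j | j <> i] E `<=`
    \bigcup_N C [set j | (j < N)%N /\ j <> i].
  have CN N N' : (N <= N')%N -> C [set j | (j < N)%N /\ j <> i] `<=` C [set j | (j < N')%N /\ j <> i].
    by move=> NN; apply: C_mono => j /= [jN ji]; split=> //; apply: leq_trans NN.
  apply: smallest_subfield_min; last first.
    move=> x [j /= ji Ex]; exists j.+1 => //; apply: (@CE _ j) => //=; by split.
  apply/subfield_setP; split.
  - by exists 0%N => //; apply: subfield1; exact: sC.
  - move=> x y [N _ Nx] [N' _ Ny]; exists (maxn N N') => //; apply: (subfieldB (sC _)).
      exact: CN (leq_maxl _ _) _ Nx.
    exact: CN (leq_maxr _ _) _ Ny.
  - move=> x y [N _ Nx] [N' _ Ny]; exists (maxn N N') => //; apply: (subfieldV (sC _)).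
      exact: CN (leq_maxl _ _) _ Nx.
    exact: CN (leq_maxr _ _) _ Ny.
have /choice[N NP] : forall l, exists N, C [set j | (j < N)%N /\ j <> i] (c l).
  by move=> l; have [N _ cN] := Cfin _ (Cc l); exists N.
pose N' := maxn i.+1 (\max_l N l).
apply: (@lin_disjoint_finite N' i _ n v Ev vK c _ cv); first exact: leq_maxl.
move=> l; apply: C_mono (NP l) => j /= [jN ji]; split=> //.
by rewrite (leq_trans jN) // leq_max (leq_bigmax l) orbT.
Qed.

End Disjointness.

(** * Construction of the extensions *)

Section NearOne.
Variables (R : set algC) (a : algC) (ell : elliptic a).
Hypothesis vR : two_adic_ring R.
Variable m : nat.
Hypotheses (Ra : R (2%:R ^+ m * a)) (Ra1 : R (2%:R ^+ m * (1 - a)^-1)).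

Let RM := two_adicM vR.
Let RD := two_adicD vR.
Let R1 := two_adic1 vR.
Let RX n x := @two_adicX _ _ vR x n.
Let Rn := two_adic_nat vR.

(** The doubling formula gives 1/x(2P) = 4 x (x - 1) (x - a) / (x^2 - a)^2. Of the four factors 2^m
    in x - 1, two clear (1 - a)^-2, one clears x - a, and one clears the factor a in a / x(2P). *)
Lemma near_one_nontorsion (P : ec_group ell) (x y : algC) (n : nat) :
  val P = Some (x, y) -> y != 0 -> R ((x - 1) / 2%:R ^+ (4 * m).+1) ->
  P *+ n = 0 -> n = 0%N.
Proof.
move=> PE y0; set r := _ / _ => Rr Pn.
have two0 : (2%:R : algC) != 0 by rewrite pnatr_eq0.
have a1 : 1 - a != 0 by case/and3P: ell => _ _ a1; rewrite subr_eq0 eq_sym.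
pose k : algC := 2%:R ^+ m; have Rka : R (k * a) := Ra.
have Rs : R (k * (1 - a)^-1) := Ra1.
have k0 : k != 0 by rewrite expf_neq0.
have Rk : R k by apply: RX; exact: Rn.
have R2 : R 2%:R := Rn 2.
have xE : x = 1 + 2%:R * k ^+ 4 * r.
  have k4 : 2%:R ^+ (4 * m) = k ^+ 4 by rewrite /k -exprM mulnC.
  by rewrite /r (exprS _ (4 * m)) k4; field; rewrite k0.
have Rx : R x by rewrite xE; apply: RD => //; do 2!apply: RM => //; apply: RX.
set s := k * (1 - a)^-1 in Rs.
pose e := k ^+ 3 * r * s * (2%:R + 2%:R * k ^+ 4 * r).
have Re : R e.
  apply: RM; last by apply: RD => //; do 2!apply: RM => //; apply: RX.
  by apply: RM => //; apply: RM => //; apply: RX.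
have [U0 RU] := two_adic_unit vR Re.
have qE : x ^+ 2 - a = (1 - a) * (1 + 2%:R * e) by rewrite xE /e /s; field.
have q0 : x ^+ 2 - a != 0 by rewrite qE mulf_neq0.
have C : on_curve a (Some (x, y)) by rewrite -PE; exact: (svalP P).
have [y' D] := double_abscissa ell C y0.
have f0 : x * (x - 1) * (x - a) != 0 by move: C => /= /eqP <-; rewrite expf_neq0.
have Rxa : R (k * (x - a)).
  by rewrite mulrBr; apply: (two_adicB vR) => //; apply: RM.
set U := (1 + 2%:R * e)^-1 in RU.
have wE : ((x ^+ 2 - a) ^+ 2 / (4%:R * (x * (x - 1) * (x - a))))^-1 =
    2%:R * (4%:R * k * x * r * (k * (x - a)) * s ^+ 2 * U ^+ 2).
  rewrite invf_div qE /U /s {2}xE; field; rewrite U0 a1 //.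
have n2 : near_infinity R a (val (P *+ 2)).
  rewrite mulr2n [val _]/= (PE : sval P = _) D; split.
  - apply: mulf_neq0; first exact: expf_neq0.
    by rewrite invr_eq0 mulf_neq0 // pnatr_eq0.
  - rewrite wE mulrAC mulfV // mul1r.
    by repeat first [assumption | exact: Rn | apply: RM | apply: RX].
  - rewrite wE mulrCA mulrAC mulfV // mul1r.
    rewrite (_ : a * _ = 4%:R * (k * a) * x * r * (k * (x - a)) * s ^+ 2 * U ^+ 2); last by ring.
    by repeat first [assumption | exact: Rn | apply: RM | apply: RX].
by apply: (near_infinity_nontorsion vR n2); rewrite mulrnAC Pn mul0rn.
Qed.

Lemma some_factor_small (K : nat) (z1 z2 z3 : algC) :
  R (z1 * z2 * z3 / (2%:R ^+ K) ^+ 3) ->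
  [\/ R (z1 / 2%:R ^+ K), R (z2 / 2%:R ^+ K) | R (z3 / 2%:R ^+ K)].
Proof.
set k := 2%:R ^+ K => H; have k0 : k != 0 by rewrite expf_neq0 // pnatr_eq0.
have R0 := two_adic0 vR.
case: (pselect (R (z1 / k))) => [|n1]; first by constructor 1.
case: (pselect (R (z2 / k))) => [|n2]; first by constructor 2.
case: (pselect (R (z3 / k))) => [|n3]; first by constructor 3.
have inv z : ~ R (z / k) -> z != 0 /\ R (k / z).
  move=> nz; split; first by apply/eqP => z0; apply: nz; rewrite z0 mul0r.
  by case: vR => _ _ _ /(_ (z / k)) [//|] + _; rewrite invf_div.
have [z10 r1] := inv _ n1; have [z20 r2] := inv _ n2; have [z30 r3] := inv _ n3.
case: n1; rewrite (_ : z1 / k = z1 * z2 * z3 / k ^+ 3 * ((k / z2) * (k / z3))).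
  by apply: RM => //; apply: RM.
by field; rewrite k0 z20 z30.
Qed.

End NearOne.

(** At w = 0 the number 1 is a root of the cubic, whence the factor w^2; this is how a power of 2 in
    w brings a root close to 1. *)
Lemma cubic_at_one (F : fieldType) (a c w : F) : den_t a c w != 0 ->
  abscissa_cubic c (par_t a c w) 1 =
  c * w ^+ 2 * (num0 c * den2 a c - den0 c * num2 a c) / den_t a c w.
Proof.
move=> nz; rewrite /abscissa_cubic /par_t; move: nz; rewrite /den_t => nz.
rewrite /num0 /num2 /den0 /den2 in nz *; field; exact: nz.
Qed.

Lemma exists_nontorsion_level (a : algC) (ell : elliptic a) (c : nat) :
  (1 < c)%N -> exists N : nat, forall (w : nat) (x1 x2 x3 y1 y2 y3 : algC)
    (P1 P2 P3 : ec_group ell),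
  (2 ^ N %| w)%N -> den_t a c%:R w%:R != 0 ->
  abscissa_cubic c%:R (par_t a c%:R w%:R) 1 = (1 - x1) * (1 - x2) * (1 - x3) ->
  val P1 = Some (x1, y1) -> val P2 = Some (x2, y2) -> val P3 = Some (x3, y3) ->
  y1 != 0 -> y2 != 0 -> y3 != 0 ->
  [\/ forall n, P1 *+ n = 0 -> n = 0%N, forall n, P2 *+ n = 0 -> n = 0%N |
      forall n, P3 *+ n = 0 -> n = 0%N].
Proof.
move=> c1; have [R vR] := two_adic_exists.
have RM := two_adicM vR; have Rn := two_adic_nat vR.
have RX n x : R x -> R (x ^+ n) := @two_adicX _ _ vR x n.
have two0 : (2%:R : algC) != 0 by rewrite pnatr_eq0.
have arch2 (u v : algC) : exists m, R (2%:R ^+ m * u) /\ R (2%:R ^+ m * v).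
  have [i Ri] := two_adic_archimedean u vR; have [k Rk] := two_adic_archimedean v vR.
  exists (i + k)%N; rewrite exprD; split.
    by rewrite [_ ^+ i * _]mulrC -mulrA; apply: (RM) => //; apply: (RX).
  by rewrite -mulrA; apply: (RM) => //; apply: (RX).
have [m [Ra Ra1]] := arch2 a (1 - a)^-1.
pose C : algC := c%:R; pose D := num0 C * den2 a C - den0 C * num2 a C.
have [J1 [RJ1 RJ1']] := arch2 (den0 C)^-1 (C * den2 a C).
have [J2 [RJ2 _]] := arch2 (C * D) 0.
pose J := (J1 + J2)%N; pose K := (4 * m).+1.
(* J clears the denominators of 1/den0, c den2 and c D; 3 K gives each of three factors a chance to
   absorb 2^K, the precision required near 1; the last factor 2 makes [den_t] equal to den0 times a
   unit 1 + 2 e. *)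
exists (J + 3 * K).+1 => w x1 x2 x3 y1 y2 y3 P1 P2 P3 /dvdnP[w' wE] nz H E1 E2 E3 y10 y20 y30.
have C0 : den0 C != 0.
  by rewrite /den0 /C mulf_neq0 ?subr_eq0 ?pnatr_eq1 ?pnatr_eq0 //; case: (c) c1 => [|[|]].
pose k : algC := 2%:R ^+ K; have k0 : k != 0 by rewrite expf_neq0.
pose j1 : algC := 2%:R ^+ J1; pose j2 : algC := 2%:R ^+ J2.
have [j10 j20] : j1 != 0 /\ j2 != 0 by rewrite !expf_neq0.
have Rk : R k by apply: (RX); exact: Rn.
have [Rj1 Rj2] : R j1 /\ R j2 by split; apply: (RX); exact: Rn.
have wE' : w%:R = 2%:R * j1 * j2 * k ^+ 3 * w'%:R :> algC.
  rewrite wE natrM natrX exprS !exprD mulrC -/j1 -/j2 -exprM mulnC; ring.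
have R2 : R 2%:R := Rn 2; have Rw' : R w'%:R := Rn w'.
pose e := 2%:R * j2 ^+ 2 * k ^+ 6 * w'%:R ^+ 2 * (j1 * (den0 C)^-1) * (j1 * (C * den2 a C)).
have Rd : R (j1 * (den0 C)^-1) := RJ1; have Rd' : R (j1 * (C * den2 a C)) := RJ1'.
have RD : R (j2 * (C * D)) := RJ2.
have Re : R e by rewrite /e; repeat first [assumption | apply: (RM) | apply: (RX)].
have [U0 RU] := two_adic_unit vR Re.
have denE : den_t a C w%:R = den0 C * (1 + 2%:R * e).
  by rewrite /den_t wE' /e; field.
have small : R ((1 - x1) * (1 - x2) * (1 - x3) / k ^+ 3).
  rewrite -H cubic_at_one // -/C -/D denE.
  rewrite (_ : _ / k ^+ 3 = 4%:R * j1 * j2 * k ^+ 3 * w'%:R ^+ 2 * (j1 * (den0 C)^-1) *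
     (j2 * (C * D)) * (1 + 2%:R * e)^-1).
    by repeat first [assumption | exact: Rn | apply: (RM) | apply: (RX)].
  by rewrite wE'; field; rewrite C0 U0 k0.
have flip u : R ((1 - u) / k) -> R ((u - 1) / k).
  by move=> Ru; rewrite -opprB mulNr; apply: (two_adicN vR).
have nt (P : ec_group ell) u v : val P = Some (u, v) -> v != 0 -> R ((1 - u) / k) ->
    forall n, P *+ n = 0 -> n = 0%N.
  by move=> PE v0 Ru n; apply: (near_one_nontorsion vR Ra Ra1 PE v0); apply: flip.
case: (some_factor_small vR small) => S.
- by constructor 1; apply: nt E1 y10 S.
- by constructor 2; apply: nt E2 y20 S.
- by constructor 3; apply: nt E3 y30 S.
Qed.

Lemma par_t_morph (F F' : fieldType) (phi : {rmorphism F -> F'}) (a c w : F) :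
  phi (par_t a c w) = par_t (phi a) (phi c) (phi w).
Proof.
rewrite /par_t /den_t /num0 /num2 /den0 /den2 fmorph_div.
by rewrite !(rmorph_nat, rmorphD, rmorphN, rmorphM, rmorphXn, rmorph1).
Qed.

Lemma den_t_morph (F F' : fieldType) (phi : {rmorphism F -> F'}) (a c w : F) :
  phi (den_t a c w) = den_t (phi a) (phi c) (phi w).
Proof.
rewrite /den_t /den0 /den2.
by rewrite !(rmorph_nat, rmorphD, rmorphN, rmorphM, rmorphXn, rmorph1).
Qed.

Lemma par_y_morph (F F' : fieldType) (phi : {rmorphism F -> F'}) (a c w : F) :
  phi (par_y a c w) = par_y (phi a) (phi c) (phi w).
Proof.
rewrite /par_y /num2 /den2 -par_t_morph; move: (par_t a c w) => t.
by rewrite !(rmorph_nat, rmorphD, rmorphN, rmorphM, rmorphXn, rmorph1).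
Qed.

Lemma good_c_morph (F F' : fieldType) (phi : {rmorphism F -> F'}) (a c : F) :
  good_c (phi a) (phi c) = good_c a c.
Proof.
have E1 : phi c ^+ 2 - phi a * phi c + phi a ^+ 2 = phi (c ^+ 2 - a * c + a ^+ 2).
  by rewrite !(rmorphD, rmorphN, rmorphM, rmorphXn).
have E2 : phi c ^+ 2 - phi c + 1 = phi (c ^+ 2 - c + 1).
  by rewrite !(rmorphD, rmorphN, rmorphM, rmorphXn, rmorph1).
have E3 : phi c ^+ 2 - phi a * phi c + phi a = phi (c ^+ 2 - a * c + a).
  by rewrite !(rmorphD, rmorphN, rmorphM, rmorphXn).
have E4 : phi c ^+ 2 - phi c + phi a = phi (c ^+ 2 - c + a).
  by rewrite !(rmorphD, rmorphN, rmorphM, rmorphXn).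
by rewrite /good_c E1 E2 E3 E4 !fmorph_eq0 fmorph_eq1 (inj_eq (fmorph_inj phi)).
Qed.

Lemma horner_map_cubic (F F' : fieldType) (phi : {rmorphism F -> F'}) (a c w : F) x :
  (map_poly phi (cubic_poly a c w)).[x] = abscissa_cubic (phi c) (phi (par_t a c w)) x.
Proof.
rewrite /cubic_poly; move: (par_t a c w) => t.
rewrite !(rmorphD, rmorphN) /= !map_polyZ /= !map_polyXn map_polyX map_polyC /= !hornerE.
rewrite /abscissa_cubic [phi (c * t)]rmorphM [phi (c ^+ 2 * _)]rmorphM rmorphB !rmorphXn.
by rewrite rmorph_nat /=; ring.
Qed.

(** * The roots and square roots in [algC], seen over the auxiliary field M *)

Record sextic_tower (M : fieldExtType rat) (j : {rmorphism M -> algC}) (a c w : M)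
    (x1 x2 x3 g1 g2 g3 : algC) : Prop := SexticTower {
  tower_den : den_t a c w != 0;
  tower_no_root : forall x, abscissa_cubic c (par_t a c w) x != 0;
  tower_no_res : forall e, resolvent a c w e != 0;
  tower_roots : cubic_roots j a c w x1 x2 x3;
  tower_x2 : x2 = j c * (x1 - j c) / x1;
  tower_x3 : x3 = j c * (x2 - j c) / x2;
  tower_x1 : x1 = j c * (x3 - j c) / x3;
  tower_g1 : g1 ^+ 2 = x1 * (x1 - 1) * (x1 - j a);
  tower_g2 : g2 ^+ 2 = x2 * (x2 - 1) * (x2 - j a);
  tower_g3 : g3 ^+ 2 = x3 * (x3 - 1) * (x3 - j a);
  tower_g : g1 * g2 * g3 = j (par_y a c w) }.

Lemma exists_sextic_tower (K : fieldExtType rat) (iota : {rmorphism K -> algC}) (a : K)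
    (c N : nat) (s : seq algC) :
  a != 0 -> a != 1 -> good_c a c%:R ->
  exists (M : fieldExtType rat) (j : {rmorphism M -> algC}) (a' : M) (w : nat)
    (x1 x2 x3 g1 g2 g3 : algC),
  [/\ forall x, x \in s -> range j x, forall x, range j (iota x), j a' = iota a,
      (2 ^ N %| w)%N & sextic_tower j a' c%:R w%:R x1 x2 x3 g1 g2 g3].
Proof.
move=> a0 a1 gc; pose al := iota a; pose C : algC := c%:R.
pose om : algC := (- 1 + sqrtC (- 3%:R)) / 2%:R.
have om2 : om ^+ 2 + om + 1 = 0.
  have E : sqrtC (- 3%:R) ^+ 2 = - 3%:R :> algC by rewrite sqrtCK.
  transitivity ((sqrtC (- 3%:R) ^+ 2 + 3%:R : algC) / 4%:R); first by rewrite /om; field.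
  by rewrite E addNr mul0r.
pose h1 := sqrtC (- (1 + C * om) ^+ 3 / (C * (al + C * om) ^+ 3)).
pose h2 := sqrtC (- den0 C / (C * den2 al C)).
pose kb := [seq iota x | x <- vbasis {:K}].
(* Besides om and the two targets h1, h2 for w, M receives K, through a basis, and the numbers s. *)
have [M [j [l lE _]]] := num_field_exists ([:: om; h1; h2; al] ++ kb ++ s).
have inM x : x \in [:: om; h1; h2; al] ++ kb ++ s -> exists x', j x' = x.
  by rewrite -lE => /mapP[x' _ ->]; exists x'.
have kbM x : range j (iota x).
  have bM (i : 'I_(\dim {:K})) : exists y, j y = iota (vbasis {:K})`_i.
    apply: inM; rewrite !mem_cat; apply/orP; right; apply/orP; left.
    by apply: map_f; rewrite mem_nth ?size_tuple.
  have [y yE] := choice bM.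
  exists (\sum_i coord (vbasis {:K}) i x *: y i) => //.
  rewrite {2}(coord_vbasis (memvf x)) !rmorph_sum; apply: eq_bigr => i _.
  by rewrite !rmorphZ_num yE.
have [om' omE] : exists x', j x' = om by apply: inM; rewrite !inE eqxx.
have [h1' h1E] : exists x', j x' = h1 by apply: inM; rewrite !inE eqxx ?orbT.
have [h2' h2E] : exists x', j x' = h2 by apply: inM; rewrite !inE eqxx ?orbT.
have [a' aE] : exists x', j x' = al by apply: inM; rewrite !inE eqxx ?orbT.
have jn n : j n%:R = n%:R by rewrite rmorph_nat.
have cE : j c%:R = C by rewrite jn.
have a'0 : a' != 0 by rewrite -(fmorph_eq0 j) aE fmorph_eq0.
have a'1 : a' != 1 by rewrite -(inj_eq (fmorph_inj j)) aE rmorph1 fmorph_eq1.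
have gc' : good_c a' c%:R.
  by rewrite -(good_c_morph j) aE cE -[C](rmorph_nat iota) good_c_morph.
have om'2 : om' ^+ 2 + om' + 1 = 0.
  by apply: (fmorph_inj j); rewrite !rmorphD rmorphXn rmorph1 rmorph0 omE.
have h1'2 : h1' ^+ 2 = - (1 + c%:R * om') ^+ 3 / (c%:R * (a' + c%:R * om') ^+ 3).
  apply: (fmorph_inj j); rewrite rmorphXn /= h1E sqrtCK fmorph_div.
  by rewrite !(rmorphXn, rmorphN, rmorphD, rmorphM, rmorph1) /= omE cE aE.
have h2'2 : h2' ^+ 2 = - den0 c%:R / (c%:R * den2 a' c%:R).
  apply: (fmorph_inj j); rewrite rmorphXn /= h2E sqrtCK fmorph_div /den0 /den2.
  by rewrite !(rmorphD, rmorphN, rmorphM, rmorph1) /= cE aE.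
have [w [Nw nz nr nres]] := exists_parameter N a'0 a'1 gc' om'2 h1'2 h2'2.
have c0 : c%:R != 0 :> M by case/and5P: gc'.
have C0 : j c%:R != 0 by rewrite fmorph_eq0.
have /closed_rootP[x1 hx1] : size (map_poly j (cubic_poly a' c%:R w%:R)) != 1%N.
  by rewrite size_map_poly size_cubic.
set t := par_t a' c%:R w%:R in nr.
have hx : abscissa_cubic (j c%:R) (j t) x1 = 0.
  by rewrite -horner_map_cubic; apply/rootP.
have [x10 x1c S1 S2 S3] := cubic_orbit C0 hx.
set x2 := _ * _ / x1 in S1 S2 S3; set x3 := _ / (_ - x1) in S1 S2 S3.
have xs : cubic_roots j a' c%:R w%:R x1 x2 x3.
  split.
  - by rewrite S1 rmorphM.
  - by rewrite S2 rmorphM rmorphB rmorphXn [j 3%:R]rmorph_nat.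
  - by rewrite S3 rmorphN rmorphXn.
pose g1 := sqrtC (x1 * (x1 - 1) * (x1 - j a')); pose g2 := sqrtC (x2 * (x2 - 1) * (x2 - j a')).
have g1E : g1 ^+ 2 = x1 * (x1 - 1) * (x1 - j a') := sqrtCK _.
have g2E : g2 ^+ 2 = x2 * (x2 - 1) * (x2 - j a') := sqrtCK _.
(* Being a non-square, f(x) is in particular not the square of 0. *)
have nzf x y z : cubic_roots j a' c%:R w%:R x y z -> x * (x - 1) * (x - j a') != 0.
  move=> xyz; apply/eqP => E; apply: (nonsquare_f nz nr nres xyz (p := 0)).
  by rewrite rmorph0 horner0 expr0n E.
have g10 : g1 != 0 by apply: contra (nzf _ _ _ xs) => /eqP g0; rewrite -g1E g0 expr0n.
have g20 : g2 != 0 by apply: contra (nzf _ _ _ (cubic_rootsC xs)) => /eqP g0; rewrite -g2E g0 expr0n.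
(* Taken as a quotient rather than a square root, so that the product of the g_i is y with the right
   sign. *)
pose g3 := j (par_y a' c%:R w%:R) / (g1 * g2).
have x1c' : x1 - j c%:R != 0 by rewrite -opprB oppr_eq0.
exists M, j, a', w, x1, x2, x3, g1, g2, g3; split=> //.
  by move=> x xs'; have [x' <-] : exists x', j x' = x; [apply: inM; rewrite !mem_cat xs' !orbT | exists x'].
split=> //.
- by rewrite /x3 /x2; field; rewrite ?x10 -(jn c) x1c x1c' C0.
- by rewrite /x3; field; rewrite -(jn c) ?x1c ?C0.
- rewrite /g3 expr_div_n -(prod_f nz xs) /= exprMn g1E g2E mulrC mulKf //.
  by rewrite mulf_neq0 // ?(nzf _ _ _ xs) ?(nzf _ _ _ (cubic_rootsC xs)).
- by rewrite /g3 mulrC divfK // mulf_neq0.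
Qed.

Section TowerMonomials.
Variables (M : fieldExtType rat) (j : {rmorphism M -> algC}) (a c w : M).
Variables x1 x2 x3 g1 g2 g3 : algC.
Hypothesis tw : sextic_tower j a c w x1 x2 x3 g1 g2 g3.

Let free := monomials_free (negbT (pnatr_eq0 algC 2)) (tower_den tw) (tower_no_root tw)
  (tower_no_res tw) (tower_roots tw) (tower_x2 tw) (tower_x3 tw) (tower_x1 tw)
  (tower_g1 tw) (tower_g2 tw) (tower_g3 tw) (tower_g tw).

Lemma tower_monomials_indep : lin_indep_over (range j)
  (fun k : 'I_12 => x1 ^+ (k %% 3) * nth 0 [:: 1; g1; g2; g3] (k %/ 3)).
Proof.
move=> u uM u0; have /choice[m mE] : forall k, exists m, j m = u k.
  by move=> k; have [m _ mE] := uM k; exists m.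
pose P n : {poly M} := \poly_(i < 3) m (inord (3 * n + i)).
have sP n : (size (P n) <= 3)%N by exact: size_poly.
have PE n : (map_poly j (P n)).[x1] =
    u (inord (3 * n)) + u (inord (3 * n + 1)) * x1 + u (inord (3 * n + 2)) * x1 ^+ 2.
  rewrite (@horner_coef_wide _ 3) ?(leq_trans (size_poly _ _)) //.
  by rewrite !big_ord_recl big_ord0 /= !coef_map !coef_poly /= !mE !addn0 expr0 mulr1 expr1 addr0 addrA.
have [|P0 P1 P2 P3] := free (sP 0%N) (sP 1%N) (sP 2%N) (sP 3%N).
  rewrite !PE -[RHS]u0.
  have uE (k : 'I_12) : u k = u (inord k) by rewrite inord_val.
  under eq_bigr => k _ do rewrite uE.
  by rewrite !big_ord_recr big_ord0 /=; ring.
move=> k; rewrite -mE.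
have k4 : (k %/ 3 < 4)%N by rewrite ltn_divLR.
have Pk : P (k %/ 3)%N = 0 by move: k4; case: (k %/ 3)%N => [|[|[|[|]]]].
have := congr1 (fun p : {poly M} => p`_(k %% 3)) Pk.
rewrite coef_poly ltn_pmod // coef0 mulnC -divn_eq inord_val => ->.
exact: rmorph0.
Qed.

Lemma tower_signs_free (e1 e2 e3 : M) :
  j e1 * g1 + j e2 * g2 + j e3 * g3 = 0 -> [/\ e1 = 0, e2 = 0 & e3 = 0].
Proof.
move=> E; have sC e : (size (e%:P : {poly M}) <= 3)%N by rewrite (leq_trans (size_polyC_leq1 _)).
have [|_ P1 P2 P3] := free (sC 0) (sC e1) (sC e2) (sC e3).
  by rewrite !map_polyC !hornerC /= rmorph0 add0r.
by split; apply: polyC_inj.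
Qed.

End TowerMonomials.

(** * Descent of the tower from M to K *)

Lemma in_alg_line (K : fieldType) (L : fieldExtType K) (u : K) : u%:A \in (1%VS : {vspace L}).
Proof. by rewrite memvZ // mem1v. Qed.

Section Splitting.
Variables (K : fieldType) (L : fieldExtType K) (a c t y : K) (x1 x2 x3 g1 g2 g3 : L).
Hypotheses (S1 : x1 + x2 + x3 = (c * t)%:A)
  (S2 : x1 * x2 + x1 * x3 + x2 * x3 = (c ^+ 2 * (t - 3%:R))%:A)
  (S3 : x1 * x2 * x3 = (- c ^+ 3)%:A).
Hypotheses (g1E : g1 ^+ 2 = x1 * (x1 - 1) * (x1 - a%:A)).
Hypotheses (g2E : g2 ^+ 2 = x2 * (x2 - 1) * (x2 - a%:A)).
Hypotheses (g3E : g3 ^+ 2 = x3 * (x3 - 1) * (x3 - a%:A)) (gE : g1 * g2 * g3 = y%:A).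
Hypothesis gen : <<1 & [:: x1; x2; x3; g1; g2; g3]>>%VS = fullv.

(** L is generated by the roots of the cubic times the product of the X^2 - f(x_i), whose
    coefficients are symmetric functions of the x_i and so lie in K. *)
Lemma tower_splitting : splitting_field_axiom L.
Proof.
pose rs := [:: x1; x2; x3; g1; - g1; g2; - g2; g3; - g3].
exists (\prod_(z <- rs) ('X - z%:P)); last first.
  exists rs; rewrite ?eqpxx //; apply/eqP; rewrite eqEsubv subvf -gen.
  by apply: adjoin_seqSr => z; rewrite !inE => /or4P[||| /or3P[]] /eqP ->; rewrite eqxx ?orbT.
have algE (u : K) : u%:A = in_alg L u by [].
have sf : g1 ^+ 2 + g2 ^+ 2 + g3 ^+ 2 =
    (sum_f a (c * t) (c ^+ 2 * (t - 3%:R)) (- c ^+ 3))%:A.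
  rewrite g1E g2E g3E (sum_fE a%:A) S1 S2 S3 !algE.
  move: (c * t) (c ^+ 2 * _) (- c ^+ 3) => s1 s2 s3 {algE}.
  by rewrite /sum_f !(rmorph_nat, rmorphXn, rmorphD, rmorphN, rmorphM, rmorph1).
have sff : g1 ^+ 2 * g2 ^+ 2 + g1 ^+ 2 * g3 ^+ 2 + g2 ^+ 2 * g3 ^+ 2 =
    (sum_ff a (c * t) (c ^+ 2 * (t - 3%:R)) (- c ^+ 3))%:A.
  rewrite g1E g2E g3E (sum_ffE a%:A) S1 S2 S3 !algE.
  move: (c * t) (c ^+ 2 * _) (- c ^+ 3) => s1 s2 s3 {algE}.
  by rewrite /sum_ff !(rmorph_nat, rmorphXn, rmorphD, rmorphN, rmorphM, rmorph1).
have -> : \prod_(z <- rs) ('X - z%:P) =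
   ('X^3 - (x1 + x2 + x3)%:P * 'X^2 + (x1 * x2 + x1 * x3 + x2 * x3)%:P * 'X - (x1 * x2 * x3)%:P) *
   ('X^6 - (g1 ^+ 2 + g2 ^+ 2 + g3 ^+ 2)%:P * 'X^4
    + (g1 ^+ 2 * g2 ^+ 2 + g1 ^+ 2 * g3 ^+ 2 + g2 ^+ 2 * g3 ^+ 2)%:P * 'X^2
    - ((g1 * g2 * g3) ^+ 2)%:P).
  by rewrite !big_cons big_nil !(polyCD, polyCM, polyCN, polyC_exp); ring.
have gE2 : (g1 * g2 * g3) ^+ 2 = (y ^+ 2)%:A by rewrite gE !algE rmorphXn.
rewrite S1 S2 S3 sf sff gE2.
by rewrite !(rpredM, rpredB, rpredD, rpredX) ?polyOverX ?polyOverC ?in_alg_line.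
Qed.

End Splitting.

Record sign_field (K : fieldType) (L : fieldExtType K) (a c t y : K)
    (x1 x2 x3 g1 g2 g3 : L) : Prop := SignField {
  sign_sum1 : x1 + x2 + x3 = (c * t)%:A;
  sign_sum2 : x1 * x2 + x1 * x3 + x2 * x3 = (c ^+ 2 * (t - 3%:R))%:A;
  sign_prod : x1 * x2 * x3 = (- c ^+ 3)%:A;
  sign_x2 : x2 = c%:A * (x1 - c%:A) / x1;
  sign_x3 : x3 = c%:A * (x2 - c%:A) / x2;
  sign_x1 : x1 = c%:A * (x3 - c%:A) / x3;
  sign_g1 : g1 ^+ 2 = x1 * (x1 - 1) * (x1 - a%:A);
  sign_g2 : g2 ^+ 2 = x2 * (x2 - 1) * (x2 - a%:A);
  sign_g3 : g3 ^+ 2 = x3 * (x3 - 1) * (x3 - a%:A);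
  sign_g : g1 * g2 * g3 = y%:A;
  sign_free : forall e1 e2 e3 : K,
    e1 *: g1 + e2 *: g2 + e3 *: g3 = 0 -> [/\ e1 = 0, e2 = 0 & e3 = 0];
  sign_gen : <<1 & [:: x1; x2; x3; g1; g2; g3]>>%VS = fullv;
  sign_dim : (12 <= \dim {:L})%N }.

Lemma sign_cubic (K : fieldType) (L : fieldExtType K) (a c t y : K)
    (x1 x2 x3 g1 g2 g3 : L) : sign_field a c t y x1 x2 x3 g1 g2 g3 ->
  forall z : L, abscissa_cubic c%:A t%:A z = (z - x1) * (z - x2) * (z - x3).
Proof.
move=> sf z; rewrite /abscissa_cubic.
have -> : (z - x1) * (z - x2) * (z - x3) =
  z ^+ 3 - (x1 + x2 + x3) * z ^+ 2 + (x1 * x2 + x1 * x3 + x2 * x3) * z - x1 * x2 * x3.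
  by ring.
rewrite (sign_sum1 sf) (sign_sum2 sf) (sign_prod sf).
have algE (u : K) : u%:A = in_alg L u by [].
by rewrite !algE !(rmorph_nat, rmorphXn, rmorphD, rmorphN, rmorphM) opprK.
Qed.

Section Descent.
Variables (K : fieldExtType rat) (iota : {rmorphism K -> algC}) (a : K) (c w : nat).
Variables (M : fieldExtType rat) (j : {rmorphism M -> algC}) (a' : M).
Variables (L : fieldExtType K) (sigma : {rmorphism L -> algC}).
Variables x1 x2 x3 g1 g2 g3 : L.
Hypotheses (jK : forall x, range j (iota x)) (aE : j a' = iota a).
Hypothesis sigmaK : forall x : K, sigma x%:A = iota x.
Hypothesis gen : <<1 & [:: x1; x2; x3; g1; g2; g3]>>%VS = fullv.
Hypothesis tw : sextic_tower j a' c%:R w%:R (sigma x1) (sigma x2) (sigma x3)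
  (sigma g1) (sigma g2) (sigma g3).

Let natE (n : nat) : j n%:R = iota n%:R.
Proof. by rewrite !rmorph_nat. Qed.

Let tE : j (par_t a' c%:R w%:R) = iota (par_t a c%:R w%:R).
Proof. by rewrite !par_t_morph aE !natE. Qed.

Let sigmaZ e z : sigma (e *: z) = iota e * sigma z.
Proof. by rewrite -mulr_algl rmorphM /= sigmaK. Qed.

Let monomial (k : 'I_12) : L := x1 ^+ (k %% 3) * nth 0 [:: 1; g1; g2; g3] (k %/ 3).

Let monomialE k : sigma (monomial k) = sigma x1 ^+ (k %% 3) *
  nth 0 [:: 1; sigma g1; sigma g2; sigma g3] (k %/ 3).
Proof.
have k4 : (k %/ 3 < 4)%N by rewrite ltn_divLR.
rewrite /monomial rmorphM rmorphXn; congr (_ * _).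
by move: k4; case: (k %/ 3)%N => [|[|[|[|]]]] //= _; rewrite rmorph1.
Qed.

Let monomial_indep : lin_indep_over (range j) (fun k => sigma (monomial k)).
Proof.
move=> u uM u0; apply: (tower_monomials_indep tw uM).
by rewrite -[RHS]u0; apply: eq_bigr => k _; rewrite monomialE.
Qed.

Let monomial_free : free [tuple monomial k | k < 12].
Proof.
apply/freeP => u u0 k; apply: (fmorph_inj iota); rewrite rmorph0.
apply: (@monomial_indep (fun k => iota (u k))) => //.
rewrite -[RHS](rmorph0 sigma) -u0 rmorph_sum; apply: eq_bigr => i _.
by rewrite -tnth_nth tnth_mktuple sigmaZ.
Qed.

(** The identities are checked in [algC], where K and M meet. The bound on the dimension comes from
    the 12 monomials, independent over M and hence over K. *)
Lemma descent_sign_field :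
  sign_field a c%:R (par_t a c%:R w%:R) (par_y a c%:R w%:R) x1 x2 x3 g1 g2 g3.
Proof.
have [S1 S2 S3] := tower_roots tw.
have cE : sigma c%:R%:A = j c%:R by rewrite sigmaK natE.
split; try (apply: (fmorph_inj sigma)); rewrite ?sigmaK.
- move: S1 tE; move: (par_t a' _ _) (par_t a _ _) => t' t S1' E.
  by rewrite !rmorphD /= S1' !rmorphM natE E.
- move: S2 tE; move: (par_t a' _ _) (par_t a _ _) => t' t S2' E.
  rewrite !rmorphD !rmorphM /= S2' !rmorphM !rmorphB /= natE E.
  by rewrite !rmorph_nat.
- by rewrite !rmorphM /= S3 !rmorphN !rmorphXn /= natE.
- by rewrite fmorph_div rmorphM rmorphB /= cE -(tower_x2 tw).
- by rewrite fmorph_div rmorphM rmorphB /= cE -(tower_x3 tw).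
- by rewrite fmorph_div rmorphM rmorphB /= cE -(tower_x1 tw).
- by rewrite rmorphXn !rmorphM !rmorphB rmorph1 /= sigmaK -aE (tower_g1 tw).
- by rewrite rmorphXn !rmorphM !rmorphB rmorph1 /= sigmaK -aE (tower_g2 tw).
- by rewrite rmorphXn !rmorphM !rmorphB rmorph1 /= sigmaK -aE (tower_g3 tw).
- by rewrite par_y_morph 2![sigma _]rmorphM /= (tower_g tw) par_y_morph aE !natE.
- move=> e1 e2 e3 E.
  have [e1' _ e1E] := jK e1; have [e2' _ e2E] := jK e2; have [e3' _ e3E] := jK e3.
  have [] := @tower_signs_free _ _ _ _ _ _ _ _ _ _ _ tw e1' e2' e3'.
    by rewrite e1E e2E e3E -!sigmaZ -!rmorphD E rmorph0.
  move=> z1 z2 z3; move: e1E e2E e3E; rewrite z1 z2 z3 rmorph0.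
  by split; apply: (fmorph_inj iota); rewrite rmorph0.
- exact: gen.
- move/eqP: monomial_free; rewrite size_tuple => <-.
  exact: dimvS (subvf _).
Qed.

(** In dimension exactly 12 the monomials form a K-basis of L, and they stay independent over M. *)
Lemma descent_lin_disjoint : \dim {:L} = 12%N ->
  lin_disjoint (range iota) (range sigma) (range j).
Proof.
move=> dimL; apply: (lin_disjoint_basis _ jK monomial_indep).
  exact: subfield_range.
move=> _ [l _ <-].
have bL : basis_of {:L} [tuple monomial k | k < 12].
  by rewrite basisEfree monomial_free subvf size_tuple dimL.
exists (coord [tuple monomial k | k < 12] ^~ l).
rewrite {1}(coord_basis bL (memvf l)) rmorph_sum; apply: eq_bigr => k _.
by rewrite -tnth_nth tnth_mktuple sigmaZ.
Qed.

End Descent.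

(** * The rank over L *)

Section SignRank.
Variables (K : fieldType) (L : splittingFieldType K) (a c t y : K).
Hypotheses (two0 : 2%:R != 0 :> K) (pc0 : [pchar L] =i pred0).
Variables x1 x2 x3 g1 g2 g3 : L.
Hypothesis sf : sign_field a c t y x1 x2 x3 g1 g2 g3.

Lemma sign_A4 : A4_extension L.
Proof. exact: (sign_field_A4 two0 pc0 (sign_cubic sf) (sign_x2 sf) (sign_x3 sf) (sign_x1 sf)
  (sign_g1 sf) (sign_g2 sf) (sign_g3 sf) (sign_g sf) (sign_free sf) (sign_gen sf) (sign_dim sf)). Qed.

Lemma sign_dimE : \dim {:L} = 12%N.
Proof. exact: (sign_field_dim two0 pc0 (sign_cubic sf) (sign_x2 sf) (sign_x3 sf) (sign_x1 sf)
  (sign_g1 sf) (sign_g2 sf) (sign_g3 sf) (sign_g sf) (sign_free sf) (sign_gen sf) (sign_dim sf)). Qed.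

Variables (ell : elliptic a) (ell' : elliptic (a%:A : L)).

Notation x_ := (abscissa x1 x2 x3).
Notation g_ := (ordinate g1 g2 g3).

Let on_Q i : on_curve (a%:A : L) (Some (x_ i, g_ i)).
Proof.
rewrite /= /abscissa /ordinate; have : (i %% 3 < 3)%N by rewrite ltn_pmod.
by case: (i %% 3)%N => [|[|[|]]] //= _;
  rewrite ?(sign_g1 sf) ?(sign_g2 sf) ?(sign_g3 sf).
Qed.

Definition sign_point i : ec_group ell' := exist (on_curve _) _ (on_Q i).

Let gal_a (s : gal_of {:L}) : s \in 'Gal({:L} / 1)%g -> s a%:A = a%:A.
Proof. by move=> sG; rewrite (fixed_gal (sub1v _) sG) // in_alg_line. Qed.

(** One non-torsion point suffices, as the Galois group permutes the three points cyclically. *)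
Lemma sign_rank (k0 : nat) : (forall n, sign_point k0 *+ n = 0 -> n = 0%N) ->
  (mw_rank a + 3%:E <= mw_rank (a%:A : L))%E.
Proof.
move=> tors0.
have flip (k : 'I_3) : exists s : gal_of {:L}, s \in 'Gal({:L} / 1)%g /\
  forall i : 'I_3, s (x_ i) = x_ i /\ s (g_ i) = if i == k then g_ i else - g_ i.
  have [s sG sE] := exists_sign_gal two0 pc0 (sign_cubic sf) (sign_x2 sf) (sign_x3 sf) (sign_x1 sf)
    (sign_g1 sf) (sign_g2 sf) (sign_g3 sf) (sign_g sf) (sign_free sf) (sign_gen sf) (sign_dim sf) k.
  by exists s.
have [s /all_and2[sG sE]] := choice flip.
have phia : in_alg L a = a%:A by [].
pose S k : {additive ec_group ell' -> ec_group ell'} :=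
  map_point (phi := s k) ell' (gal_a (sG k)).
apply: (@mw_rank_sign_jump _ _ (in_alg L) _ _ ell ell' phia (fun i : 'I_3 => sign_point i) S).
- move=> i [[[u v]|] onP]; apply: val_inj => //=.
  by rewrite !(fixed_gal (sub1v _) (sG i)) // in_alg_line.
- move=> i k; apply: val_inj => /=; have [-> ->] := sE i k.
  by rewrite eq_sym; case: eqP.
- move=> i n Qn; apply: tors0.
  (* The shift is i - k0 modulo 3; adding 3 k0 keeps the subtraction within the natural numbers. *)
  have [u uG uE] : exists2 u : gal_of {:L}, u \in 'Gal({:L} / 1)%g &
    forall m, u (x_ m) = x_ (m + (i + 3 * k0 - k0)) /\ u (g_ m) = g_ (m + (i + 3 * k0 - k0)).
    have [u uG uE] := exists_cycle_gal two0 pc0 (sign_cubic sf) (sign_x2 sf) (sign_x3 sf) (sign_x1 sf)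
      (sign_g1 sf) (sign_g2 sf) (sign_g3 sf) (sign_g sf) (sign_free sf) (sign_gen sf) (sign_dim sf) (i + 3 * k0 - k0).
    by exists u.
  apply: (@map_point_inj _ _ u _ _ ell' ell' (gal_a uG)).
  rewrite raddfMn raddf0 -{}Qn; congr (_ *+ _); apply: val_inj => /=.
  have [-> ->] := uE k0.
  have -> : (k0 + (i + 3 * k0 - k0) = k0 * 3 + i)%N by lia.
  by rewrite /abscissa /ordinate !modnMDl.
Qed.

End SignRank.

(** An equality of structures, so that a field already equipped with its elements and its embedding
    can be replaced by substitution. *)
Lemma splittingFieldType_exists (K : fieldType) (L : fieldExtType K) :
  splitting_field_axiom L -> exists L' : splittingFieldType K, L = L' :> fieldExtType K.
Proof.
move=> splL; exists (HB.pack L (FieldExt_isSplittingField.Build K L splL) : splittingFieldType K).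
by case: L splL => T [].
Qed.

(** The list s will hold generators of the fields already built. M contains them, so disjointness
    from M passes to the subfield they generate over K. *)
Lemma next_field (K : fieldExtType rat) (iota : {rmorphism K -> algC}) (a : K) (s : seq algC) :
  a != 0 -> a != 1 ->
  exists (L : splittingFieldType K) (sigma : {rmorphism L -> algC}),
  [/\ forall x : K, sigma x%:A = iota x, A4_extension L,
      (mw_rank a + 3%:E <= mw_rank (a%:A : L))%E
    & lin_disjoint (range iota) (range sigma)
        (smallest (@subfield_set algC) (range iota `|` [set` s]))%classic].
Proof.
move=> a0 a1.
have two0 : 2%:R != 0 :> K by rewrite fieldext_natr_eq0.
have ell : elliptic a by rewrite /elliptic two0 a0 a1.
have ellC : elliptic (iota a).
  by rewrite /elliptic -(rmorph_nat iota) !fmorph_eq0 two0 a0 fmorph_eq1 a1.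
have [c gc] := exists_good_c (@fieldext_natr_eq0 K) a0 a1.
have c1 : (1 < c)%N by move: gc; case: c => [|[|c]] //; rewrite /good_c eqxx ?andbF.
have [N level] := exists_nontorsion_level ellC c1.
have [M [j [a' [w [y1 [y2 [y3 [h1 [h2 [h3 [sM jK aE Nw tw]]]]]]]]]]] :=
  exists_sextic_tower iota N s a0 a1 gc.
have [L0 [sigma0 [r [rE gen sigmaK]]]] := adjoin_numbers iota [:: y1; y2; y3; h1; h2; h3].
case: r rE gen => [|x1 [|x2 [|x3 [|g1 [|g2 [|g3 [|x4 r]]]]]]] //= [E1 E2 E3 E4 E5 E6] gen.
rewrite -{}E1 -{}E2 -{}E3 -{}E4 -{}E5 -{}E6 in tw.
have sf := descent_sign_field jK aE sigmaK gen tw.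
have spl : splitting_field_axiom L0.
  exact: (tower_splitting (sign_sum1 sf) (sign_sum2 sf) (sign_prod sf) (sign_g1 sf)
    (sign_g2 sf) (sign_g3 sf) (sign_g sf) gen).
have [L EL] := splittingFieldType_exists spl; subst L0.
have pc0 : [pchar L] =i pred0.
  move=> p; apply/negbTE; apply/negP => /andP[pp].
  by rewrite -(rmorph_nat (in_alg L)) fmorph_eq0 fieldext_natr_eq0 => /eqP p0; rewrite p0 in pp.
have ellL : elliptic (a%:A : L).
  by rewrite /elliptic -(rmorph_nat (in_alg L)) -[a%:A]/(in_alg L a) !fmorph_eq0 two0 a0 fmorph_eq1 a1.
exists L, sigma0; split=> //.
- exact: (sign_A4 two0 pc0 sf).
- have sigmaa : (sigma0 : {rmorphism L -> algC}) a%:A = iota a by [].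
  (* Torsion is tested on the images in [algC], where the 2-adic ring lives. *)
  pose P i := map_point ellC sigmaa (sign_point sf ellL i).
  suff [k Pk] : exists k, forall n, P k *+ n = 0 -> n = 0%N.
    apply: (sign_rank two0 pc0 (sf := sf) ell (k0 := k)) => n Qn; apply: Pk.
    by rewrite /P -raddfMn Qn raddf0.
  have den0 : den_t (iota a) c%:R w%:R != 0.
    have := tower_den tw; rewrite -(fmorph_eq0 j) den_t_morph aE.
    by rewrite !rmorph_nat.
  have cub1 : abscissa_cubic c%:R (par_t (iota a) c%:R w%:R) 1 =
    (1 - sigma0 x1) * (1 - sigma0 x2) * (1 - sigma0 x3).
    have := congr1 sigma0 (sign_cubic sf 1).
    rewrite !rmorphM !rmorphB rmorph1 /= => <-.
    rewrite -(rmorph_nat iota c) -(rmorph_nat iota w) -par_t_morph.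
    move: (par_t _ _ _) => t; rewrite /abscissa_cubic.
    by rewrite !(rmorph_nat, rmorphXn, rmorphD, rmorphN, rmorphM, rmorph1) /= !sigmaK !rmorph_nat.
  have gn0 g : g != 0 -> sigma0 g != 0 by rewrite fmorph_eq0.
  have g10 : g1 != 0.
    apply/eqP => E; have := @sign_free _ _ _ _ _ _ _ _ _ _ _ _ sf 1 0 0.
    by rewrite E scaler0 !scale0r !addr0 => /(_ erefl) [/eqP]; rewrite oner_eq0.
  have g20 : g2 != 0.
    apply/eqP => E; have := @sign_free _ _ _ _ _ _ _ _ _ _ _ _ sf 0 1 0.
    by rewrite E scaler0 !scale0r !addr0 => /(_ erefl) [_ /eqP]; rewrite oner_eq0.
  have g30 : g3 != 0.
    apply/eqP => E; have := @sign_free _ _ _ _ _ _ _ _ _ _ _ _ sf 0 0 1.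
    by rewrite E scaler0 !scale0r !addr0 => /(_ erefl) [_ _ /eqP]; rewrite oner_eq0.
  have [H|H|H] := level w _ _ _ _ _ _ (P 0%N) (P 1%N) (P 2%N) Nw den0 cub1 erefl erefl erefl
    (gn0 _ g10) (gn0 _ g20) (gn0 _ g30); [by exists 0%N | by exists 1%N | by exists 2%N].
- apply: (@lin_disjoint_sub _ _ _ _ _ (range j)); last first.
    exact: (descent_lin_disjoint jK sigmaK tw (sign_dimE two0 pc0 sf)).
  apply: smallest_subfield_min; first exact: subfield_range.
  by move=> z [[x _ <-]|] //; exact: sM.
Qed.

Theorem theorem1p2 (K : fieldExtType rat) (iota : {rmorphism K -> algC}) (a : K)
    (ha0 : a != 0) (ha1 : a != 1) (haj : a ^+ 2 - a + 1 != 0)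
    (hi : exists s : K, s ^+ 2 = -1)
    (hd : exists d : K, d ^+ 2 = a * (1 - a) * (a ^+ 2 - a + 1)) :
  exists (L : nat -> splittingFieldType K)
         (sigma : forall i : nat, {rmorphism L i -> algC}),
    [/\ forall (i : nat) (x : K), sigma i x%:A = iota x,
        forall i : nat, A4_extension (L i),
        lin_disjoint_family (range iota) (fun i : nat => range (sigma i))
      & forall i : nat,
          (mw_rank a + 3%:E <= mw_rank (a%:A : L i))%E].
Proof.
pose field := {L : splittingFieldType K & {rmorphism L -> algC}}.
have next (s : seq algC) : exists e : field,
  [/\ forall x : K, projT2 e x%:A = iota x, A4_extension (projT1 e),
      (mw_rank a + 3%:E <= mw_rank (a%:A : projT1 e))%E
    & lin_disjoint (range iota) (range (projT2 e))
        (smallest (@subfield_set algC) (range iota `|` [set` s]))%classic].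
  by have [L [sigma P]] := next_field iota s ha0 ha1; exists (existT _ L sigma).
have [e /all_and4[eK eA4 erank edisj]] := choice next.
pose gens (L : field) : seq algC := [seq projT2 L x | x <- vbasis {:projT1 L}].
(* The list st n collects bases of the first n fields, so the field chosen for it is linearly
   disjoint from their compositum. *)
pose st := fix st n := if n is m.+1 then st m ++ gens (e (st m)) else [::].
have st_gens m n : (m < n)%N -> {subset gens (e (st m)) <= st n}.
  elim: n => // n IH; rewrite ltnS leq_eqVlt => /predU1P[-> | /IH sub] x xg /=.
    by rewrite mem_cat xg orbT.
  by rewrite mem_cat sub.
pose b n (i : 'I_(\dim {:projT1 (e (st n))})) :=
  projT2 (e (st n)) (vbasis {:projT1 (e (st n))})`_i.
have Z n u z : projT2 (e (st n)) (u *: z) = iota u * projT2 (e (st n)) z.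
  by rewrite -mulr_algl rmorphM /= eK.
have span n z : projT2 (e (st n)) z =
    \sum_i iota (coord (vbasis {:projT1 (e (st n))}) i z) * b n i.
  by rewrite {1}(coord_vbasis (memvf z)) rmorph_sum; apply: eq_bigr => i _; rewrite Z.
exists (fun n => projT1 (e (st n))), (fun n => projT2 (e (st n))); split=> //.
apply: (lin_disjoint_family_of_seq (b := b)) => n.
- exact: subfield_range.
- by move=> i; exists (vbasis {:projT1 (e (st n))})`_i.
- move=> u uK u0; have /choice[k kE] : forall i, exists k, iota k = u i.
    by move=> i; have [k _ kE] := uK i; exists k.
  have /freeP indep := basis_free (vbasisP {:projT1 (e (st n))}).
  move=> i; rewrite -kE (indep k) ?rmorph0 //.
  apply: (fmorph_inj (projT2 (e (st n)))); rewrite rmorph0 rmorph_sum -[RHS]u0.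
  by apply: eq_bigr => l _; rewrite Z kE.
- move=> _ [z _ <-]; exists (fun i => coord (vbasis {:projT1 (e (st n))}) i z).
  exact: span.
- apply: lin_disjoint_sub (edisj (st n)); set S := smallest _ (_ `|` [set` _])%classic.
  have sS : subfield_set S by exact: smallest_subfield.
  have iS x : S (iota x) by apply: sub_smallest_subfield; left; exists x.
  apply: smallest_subfield_min => // _ [[x _ <-] // | [m /= mn [z _ <-]]].
  rewrite span; apply: (subfield_sum sS) => i _; apply: (subfieldM sS) => //.
  apply: sub_smallest_subfield; right; apply: (st_gens m) => //.
  by apply: map_f; rewrite mem_nth // size_tuple.
Qed.
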